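(* Let $g\ge 2$ be an integer and $B$ a connected closed oriented surface with base point $b_0$. Assume that $g$ is odd. If $\Gamma$ and $\Gamma'$ are $\mathcal{C}_0$-charts in $B$ such that $\Gamma'$ is obtained from $\Gamma$ by a chart move of transition, then $w(\Gamma)=w(\Gamma')$ in $\mathbb{Z}_2$.
   Context: **Charts.** Let $\mathcal{X}$ be a set, $\mathcal{R},\mathcal{S}$ sets of words in $\mathcal{X}\cup\mathcal{X}^{-1}$, $\mathcal{C}=(\mathcal{X},\mathcal{R},\mathcal{S})$, $G=\langle\mathcal{X}\mid\mathcal{R}\rangle$. Let $\Gamma$ be a finite graph in $B$ (possibly empty or with hoops, i.e. closed edges without vertices) with each edge oriented and labeled by an element of $\mathcal{X}$. For a path $\gamma$ meeting the edges transversely and missing the vertices, the intersection word $w_\Gamma(\gamma)$ is obtained by reading along $\gamma$ the labels of the edges crossed, with exponent $+1$ or $-1$ according to the direction of crossing (a fixed convention, e.g. $+1$ if the edge crosses $\gamma$ from right to left). For a vertex $v$, $m_v$ is a small counterclockwise loop around $v$. $\Gamma$ is a $\mathcal{C}$-chart if its vertices are divided into white and black vertices such that $w_\Gamma(m_v)$ is a cyclic permutation of an element of $\mathcal{R}\cup\mathcal{R}^{-1}$ if $v$ is white, and of an element of $\mathcal{S}$ if $v$ is black. A white vertex $v$ is of type $r$ (resp. $r^{-1}$), $r\in\mathcal{R}$, if $w_\Gamma(m_v)^{-1}$ is a cyclic permutation of $r$ (resp. $r^{-1}$); a black vertex is of type $s\in\mathcal{S}$ if $w_\Gamma(m_v)$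 is a cyclic permutation of $s$. Charts are disjoint from the base point $b_0$. **$\mathcal{C}_0$-charts.** $\mathcal{C}_0=(\mathcal{X}_0,\mathcal{R}_0,\mathcal{S}_0)$ with $\mathcal{X}_0=\{\xi_1,\ldots,\xi_{2g+1}\}$; $\mathcal{R}_0$ consists of $r_1(i,j)=\xi_i\xi_j\xi_i^{-1}\xi_j^{-1}$ ($1\le i<j-1\le 2g$), $r_2(i)=\xi_i\xi_{i+1}\xi_i\xi_{i+1}^{-1}\xi_i^{-1}\xi_{i+1}^{-1}$ ($1\le i\le 2g$), $r_3=\xi_1\xi_2\cdots\xi_{2g+1}\xi_{2g+1}\cdots\xi_2\xi_1$, $r_4=(\xi_1\xi_2\cdots\xi_{2g+1})^{2g+2}$; $\mathcal{S}_0$ consists of $\xi_i^{\pm1}$ ($1\le i\le 2g+1$) and $\ell_h^{\pm1}$, $\ell_h=(\xi_1\xi_2\cdots\xi_{2h})^{4h+2}$ ($1\le h\le[g/2]$). The group $\langle\mathcal{X}_0\mid\mathcal{R}_0\rangle$ is the mapping class group $\mathcal{M}_{0,2g+2}$ of $S^2$ with $2g+2$ marked points. **The number $w$.** For a $\mathcal{C}_0$-chart $\Gamma$, $w(\Gamma)\in\mathbb{Z}_2$ is the number modulo 2 of white vertices of types $r_4^{\pm1}$ in $\Gamma$. **Chart move of transition.** Let $s,s'\in\mathcal{S}$ and let $u$ be a word in $\mathcal{X}\cup\mathcal{X}^{-1}$ such that $s'$ and $usu^{-1}$ determine the same element of $G$. Suppose $\Gamma$ has a black vertex $v$ of type $s$,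 and let $D\subset B-\{b_0\}$ be a small disk around $v$ in which $\Gamma$ consists of $v$ and the edge germs at $v$. A chart move of transition replaces $\Gamma\cap D$ by the following subchart with the same boundary: a black vertex of type $s'$ and a sub-disk (box) $T\subset D$ not containing it, whose boundary has intersection word $usu^{-1}s'^{-1}$, where the edges crossing the $s'$-part of $\partial T$ run to the black vertex of type $s'$, the edges crossing the $u$-part of $\partial T$ are joined to those crossing the $u^{-1}$-part by parallel arcs going around the black vertex, and the edges crossing the $s$-part run to $\partial D$; the box $T$ is filled in an arbitrary way with edges and white vertices only. *)

(* Defs.v *)
From HB Require Import structures.
From mathcomp Require Import all_boot all_order all_algebra finmap.
From mathcomp Require Import all_classical all_reals all_analysis.

Set Implicit Arguments.
Unset Strict Implicit.
Unset Printing Implicit Defensive.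

Import Order.TTheory GRing.Theory Num.Theory numFieldNormedType.Exports.

Local Open Scope classical_set_scope.
Local Open Scope ring_scope.

Section Words.
Variable X : Type.

(* (x, false) is the letter x and (x, true) is its inverse. *)
Definition word := seq (X * bool).

Definition word_inv (w : word) : word := rev [seq (l.1, ~~ l.2) | l <- w].

Definition cyclic_perm (w w' : word) : Prop := exists k : nat, w = rot k w'.

(* w and w' represent the same element of the group < X | Rel >. *)
Inductive pres_eq (Rel : set word) : word -> word -> Prop :=
| pres_refl w : pres_eq Rel w w
| pres_sym w w' : pres_eq Rel w w' -> pres_eq Rel w' w
| pres_trans w1 w2 w3 :
    pres_eq Rel w1 w2 -> pres_eq Rel w2 w3 -> pres_eq Rel w1 w3
| pres_cat w1 w1' w2 w2' :
    pres_eq Rel w1 w1' -> pres_eq Rel w2 w2' ->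
    pres_eq Rel (w1 ++ w2) (w1' ++ w2')
| pres_free x b : pres_eq Rel [:: (x, b); (x, ~~ b)] [::]
| pres_rel r : Rel r -> pres_eq Rel r [::].

End Words.

Section Surface.
Variable R : realType.
Variable B : topologicalType.

Definition cx (z : 'rV[R]_2) : R := z 0 0.
Definition cy (z : 'rV[R]_2) : R := z 0 1.
Definition pt (x y : R) : 'rV[R]_2 := \row_(i < 2) (if i == 0 then x else y).

(* Coordinates are written as maps from the plane to B; only their restriction
   to the open square box matters. *)
Definition box : set 'rV[R]_2 := [set z | `|cx z| < 1 /\ `|cy z| < 1].
Definition disc : set 'rV[R]_2 := [set z | cx z ^+ 2 + cy z ^+ 2 <= 2^-1 ^+ 2].
Definition odisc : set 'rV[R]_2 := [set z | cx z ^+ 2 + cy z ^+ 2 < 2^-1 ^+ 2].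
Definition bdisc : set 'rV[R]_2 := [set z | cx z ^+ 2 + cy z ^+ 2 = 2^-1 ^+ 2].

Definition open_embedding (k : 'rV[R]_2 -> B) : Prop :=
  [/\ {in box &, injective k},
      forall z, box z -> {for z, continuous k} &
      forall U, open U -> U `<=` box -> open (k @` U)].

(* If k z = l z', the transition map l^-1 \o k is differentiable with positive
   Jacobian determinant at z. *)
Definition positive_at (k l : 'rV[R]_2 -> B) (z z' : 'rV[R]_2) : Prop :=
  exists h : 'rV[R]_2 -> 'rV[R]_2,
    [/\ h z = z',
        \forall y \near z, box (h y) /\ l (h y) = k y,
        differentiable h z &
        0 < \det (jacobian h z)].

Definition oriented_atlas (A : set ('rV[R]_2 -> B)) : Prop :=
  [/\ forall k, A k -> open_embedding k,
      forall p, exists k z, [/\ A k, box z & k z = p] &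
      forall k l z z', A k -> A l -> box z -> box z' -> k z = l z' ->
        positive_at k l z z'].

Definition closed_oriented_surface (A : set ('rV[R]_2 -> B)) : Prop :=
  [/\ compact [set: B], connected [set: B], hausdorff_space B &
      oriented_atlas A].

(* Positive coordinates centered at p.  They need not be differentiable at the
   center, so that edges may have corners there, and may arrive at a vertex in
   any directions, or even tangentially to each other. *)
Definition centered_coord (A : set ('rV[R]_2 -> B)) (p : B)
    (k : 'rV[R]_2 -> B) : Prop :=
  [/\ k 0 = p, open_embedding k &
      forall l z z', A l -> box z -> box z' -> z != 0 -> k z = l z' ->
        positive_at k l z z'].

(* The counterclockwise parametrization of k @` bdisc, for t in [0, 1]. *)
Definition circle (k : 'rV[R]_2 -> B) (t : R) : B :=
  k (pt (2^-1 * cos (2 * pi * t)) (2^-1 * sin (2 * pi * t))).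

End Surface.

Arguments box {R}.
Arguments disc {R}.
Arguments odisc {R}.
Arguments bdisc {R}.

Section Graphs.
Variable R : realType.
Variable B : topologicalType.
Variable X : Type.

(* The arc i is parametrized by ]0, 1[ (with end points at 0 and 1), or, if it
   is a hoop, by the whole line with period 1; the parametrization gives the
   orientation of the edge. *)
Record graph := Graph {
  white : set B;
  black : set B;
  nedges : nat;
  hoop : 'I_nedges -> bool;
  edge_arc : 'I_nedges -> R -> B;
  label : 'I_nedges -> X }.

Definition vertices (G : graph) : set B := white G `|` black G.

Definition edge_dom (G : graph) (i : 'I_(nedges G)) : set R :=
  if hoop i then setT else `]0, 1[%classic.

Definition edges (G : graph) : set B :=
  \bigcup_(i in [set: 'I_(nedges G)]) (edge_arc i @` edge_dom i).

Definition graph_support (G : graph) : set B := vertices G `|` edges G.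

Variable A : set ('rV[R]_2 -> B).

(* Positive coordinates at the point p of an edge labeled x in which the graph
   is the horizontal axis, oriented to the right: the left side of the edge is
   0 < cy z, and the right side is cy z < 0. *)
Definition edge_at (G : graph) (p : B) (x : X) (k : 'rV[R]_2 -> B) : Prop :=
  [/\ centered_coord A p k,
      forall z, box z -> ~ vertices G (k z),
      forall z, box z -> (graph_support G (k z) <-> cy z = 0) &
      exists i : 'I_(nedges G), label i = x /\
        exists f : R -> R,
          [/\ {in `]-1, 1[ &, {homo f : s t / s < t}},
              forall s : R, s \in `]-1, 1[ -> edge_dom i (f s) &
              forall s : R, s \in `]-1, 1[ -> k (pt s 0) = edge_arc i (f s)]].

(* Positive coordinates at the vertex v in which the graph is a cone. *)
Definition star_at (G : graph) (v : B) (k : 'rV[R]_2 -> B) : Prop :=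
  [/\ centered_coord A v k, vertices G v,
      forall z, box z -> vertices G (k z) -> z = 0 &
      forall z c, box z -> 0 < c <= 1 ->
        (graph_support G (k (c *: z)) <-> graph_support G (k z))].

(* At time t the path p crosses an edge, with letter (x, b): from the left side
   of the edge to its right side if b = false, i.e., the edge crosses the path
   from right to left. *)
Definition crosses (G : graph) (p : R -> B) (t : R) (l : X * bool) : Prop :=
  let side (b : bool) (z : 'rV[R]_2) := if b then cy z < 0 else 0 < cy z in
  exists k, edge_at G (p t) l.1 k /\
    \forall s \near t,
      (s < t -> exists z, [/\ box z, side l.2 z & k z = p s]) /\
      (t < s -> exists z, [/\ box z, side (~~ l.2) z & k z = p s]).

(* The path p, on [0, 1], is transverse to G, meets it exactly at the times ts,
   and has intersection word w. *)
Definition reads_at (G : graph) (p : R -> B) (ts : seq R) (w : word X) : Prop :=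
  [/\ {within `[0, 1], continuous p},
      size ts = size w /\ sorted <%R ts,
      {subset ts <= `]0, 1[},
      forall t : R, t \in `[0, 1] -> (graph_support G (p t) <-> t \in ts) &
      forall j t0 l0, (j < size w)%N ->
        crosses G p (nth t0 ts j) (nth l0 w j)].

Definition intersection_word (G : graph) (p : R -> B) (w : word X) : Prop :=
  exists ts, reads_at G p ts w.

(* w is the intersection word of arbitrarily small counterclockwise loops
   around v; it depends on a starting point, and so is only determined up to
   cyclic permutation. *)
Definition vertex_word (G : graph) (v : B) (w : word X) : Prop :=
  forall N : set B, nbhs v N ->
    exists k, [/\ star_at G v k, k @` box `<=` N &
                  intersection_word G (circle k) w].

Definition finite_graph (G : graph) : Prop :=
  [/\ finite_set (white G), finite_set (black G),
      white G `&` black G = set0,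
      edges G `&` vertices G = set0 &
      [/\ forall i : 'I_(nedges G), ~~ hoop i ->
        [/\ {within `[0, 1], continuous (edge_arc i)},
            vertices G (edge_arc i 0), vertices G (edge_arc i 1) &
            {in `]0, 1[ &, injective (edge_arc i)}],
      forall i : 'I_(nedges G), hoop i ->
        continuous (edge_arc i) /\
        forall s t,
          edge_arc i s = edge_arc i t <-> exists m : int, s - t = m%:~R,
      forall (i j : 'I_(nedges G)) s t, edge_dom i s -> edge_dom j t ->
        edge_arc i s = edge_arc j t -> i = j,
      forall p, edges G p -> exists x k, edge_at G p x k &
      forall v, vertices G v -> exists k, star_at G v k]].

Variables Rel S : set (word X).

Definition white_ok (G : graph) (v : B) : Prop :=
  exists w, vertex_word G v w /\
    exists2 r, Rel r & cyclic_perm w r \/ cyclic_perm w (word_inv r).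

Definition black_ok (G : graph) (v : B) : Prop :=
  exists w, vertex_word G v w /\ exists2 s, S s & cyclic_perm w s.

(* G is a (X, Rel, S)-chart in B, with base point b0. *)
Definition is_chart (b0 : B) (G : graph) : Prop :=
  [/\ finite_graph G, ~ graph_support G b0,
      forall v, white G v -> white_ok G v &
      forall v, black G v -> black_ok G v].

(* The type may be an element r of Rel or its inverse word_inv r. *)
Definition white_type (G : graph) (v : B) (r : word X) : Prop :=
  white G v /\ exists2 w, vertex_word G v w & cyclic_perm (word_inv w) r.

Definition black_type (G : graph) (v : B) (s : word X) : Prop :=
  black G v /\ exists2 w, vertex_word G v w & cyclic_perm w s.

(* G and G' coincide outside the closed disc D with interior D0, and have the
   same points on the boundary of D. *)
Definition same_outside (D D0 : set B) (G G' : graph) : Prop :=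
  [/\ forall p, ~ D p -> (white G p <-> white G' p),
      forall p, ~ D p -> (black G p <-> black G' p),
      forall p, ~ D0 p -> (graph_support G p <-> graph_support G' p) &
      forall p x k, k @` box `<=` ~` D ->
        (edge_at G p x k <-> edge_at G' p x k)].

(* The part of G' in the disc D = d @` disc outside the box T = t @` disc.  Its
   arcs a j start at the crossings of the boundary of T with G', which occur at
   the times ts and spell u s u^-1 s'^-1.  They are indexed by the letters of
   u (joined to the mirror letters of u^-1), of s (running to the boundary of
   D), and of s'^-1 (running to the black vertex v'). *)
Definition transition_arcs (G' : graph) (d t : 'rV[R]_2 -> B) (v' : B)
    (ts : seq R) (u s s' : word X) (a : nat -> R -> B) : Prop :=
  let m := size u in
  let n := size s in
  let u_part j := (j < m)%N in
  let s_part j := (m <= j < m + n)%N in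
  let s'_part j := (m + n + m <= j < m + n + m + size s')%N in
  let J j := [|| u_part j, s_part j | s'_part j] in
  let D := d @` disc in
  let T := t @` disc in
  let q j := circle t (nth 0 ts j) in
  [/\ forall j, J j ->
        [/\ {within `[0, 1], continuous (a j)},
            {in `[0, 1] &, injective (a j)},
            a j 0 = q j &
            forall x : R, x \in `]0, 1[ ->
              [/\ (d @` odisc) (a j x), ~ T (a j x) & a j x <> v']],
      [/\ forall j, u_part j -> a j 1 = q (m + n + (m - j.+1))%N,
          forall j, s_part j -> (d @` bdisc) (a j 1) &
          forall j, s'_part j -> a j 1 = v'],
      forall i j (x y : R), J i -> J j -> x \in `]0, 1[ -> y \in `]0, 1[ ->
        a i x = a j y -> i = j,
      forall p, D p -> ~ (t @` odisc) p ->
        (graph_support G' p <->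
         p = v' \/ exists j (x : R), [/\ J j, x \in `[0, 1] & p = a j x]) &
      (* The arcs of u go around v', i.e., together with T they separate it
         from the boundary of D. *)
      forall j (K : set B), u_part j -> connected K ->
        K `<=` D `\` (T `|` a j @` `[0, 1]%classic) -> K v' ->
        K `&` d @` bdisc = set0].

Definition transition (b0 : B) (G G' : graph) : Prop :=
  exists (s s' u : word X) (v v' : B) (d t : 'rV[R]_2 -> B),
    let D := d @` disc in
    let D0 := d @` odisc in
    let T := t @` disc in
    [/\ [/\ S s, S s' & pres_eq Rel s' (u ++ s ++ word_inv u)],
        [/\ black_type G v s, star_at G v d & ~ D b0],
        same_outside D D0 G G',
        [/\ black_type G' v' s', D0 v', ~ T v',
            forall p, D p -> (black G' p <-> p = v') &
            forall p, D p -> white G' p -> T p] &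
        [/\ centered_coord A (t 0) t, T `<=` D0 &
            exists (ts : seq R) (a : nat -> R -> B),
              reads_at G' (circle t) ts
                (u ++ s ++ word_inv u ++ word_inv s') /\
              transition_arcs G' d t v' ts u s s' a]].

End Graphs.

Section C0.
Variable g : nat.

(* The generator xi_i is represented by the ordinal i - 1. *)
Definition X0 := 'I_(2 * g + 1).

Definition xi (i : X0) : word X0 := [:: (i, false)].
Definition xi_inv (i : X0) : word X0 := [:: (i, true)].

Definition chain (n : nat) : word X0 :=
  [seq (i, false) | i <- take n (enum 'I_(2 * g + 1))].

Definition word_exp (w : word X0) (n : nat) : word X0 := flatten (nseq n w).

Definition r1 (i j : X0) : word X0 := xi i ++ xi j ++ xi_inv i ++ xi_inv j.
Definition r2 (i j : X0) : word X0 :=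
  xi i ++ xi j ++ xi i ++ xi_inv j ++ xi_inv i ++ xi_inv j.
Definition r3 : word X0 := chain (2 * g + 1) ++ rev (chain (2 * g + 1)).
Definition r4 : word X0 := word_exp (chain (2 * g + 1)) (2 * g + 2).
Definition ell (h : nat) : word X0 := word_exp (chain (2 * h)) (4 * h + 2).

Definition R0 : set (word X0) :=
  [set r | [\/ exists i j : X0, (i.+1 < j)%N /\ r = r1 i j,
               exists i j : X0, j = i.+1 :> nat /\ r = r2 i j,
               r = r3 | r = r4]].

Definition S0 : set (word X0) :=
  [set s | (exists i : X0, s = xi i \/ s = xi_inv i) \/
           (exists h : nat, (1 <= h <= g./2)%N /\
              (s = ell h \/ s = word_inv (ell h)))].

Definition w_number (R : realType) (B : topologicalType)
    (A : set ('rV[R]_2 -> B)) (G : graph R B X0) : 'Z_2 :=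
  (#|` fset_set [set v | white_type A G v r4 \/
                         white_type A G v (word_inv r4)] |%fset)%:R.

End C0.

(* Main.v *)
(** Let the words act on the colorings of 2g+2 strands by the Alexander quandle
    with parameter t (the Burau representation), where t^(2g+2) = 1 and t <> 1;
    take the colorings of weight 0 modulo the constant ones, and rescale every
    generator by c with c^(2(2g+1)) t = 1.  Then r1, r2 and r3 act trivially, and
    r4, a full twist of length (2g+1)(2g+2), acts by c^((2g+1)(2g+2)) = -1.

    For such an action, a chart has flat sections, i.e., functions off the chart
    which are locally constant and change by the action of the label across the
    edges.  Around a white vertex of type r4 or r4^-1 their monodromy is -1, and
    around the other white vertices it is trivial, so that the boundary word of a
    disc without black vertices acts by (-1)^k, where k is the number of its
    vertices of types r4 and r4^-1.

    A transition changes w by the parity of this k for the box T, whose boundary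
    word is u s u^-1 s'^-1.  If g is odd, then s and s' are words in at most g-1
    generators, all with the same exponent; such a word multiplies by a power of
    c the colorings which are fixed by these generators up to scale, a subspace of
    codimension at most g-1.  By dimension count u s u^-1 and s' have a common
    eigenvector, and the quotient of their eigenvalues is not -1 if c is of order
    2(2g+1)(2g+2).  Hence k is even. *)

Require Import Defs.
From mathcomp Require Import all_boot all_order all_algebra all_field finmap.
From mathcomp Require Import all_classical all_reals all_analysis.
From mathcomp Require Import ring lra zify.

Set Implicit Arguments.
Unset Strict Implicit.
Unset Printing Implicit Defensive.

Import Order.TTheory GRing.Theory Num.Theory numFieldNormedType.Exports.

Local Open Scope classical_set_scope.
Local Open Scope ring_scope.

(** No homotopy of loops is used: sections are extended locally and compared by connectedness. Over
    a starshaped region local extendability gives global sections, so the monodromy around the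
    vertices must first be removed. This is done by letting sections jump by -1 along horizontal
    cuts going left from the vertices of types r4 and r4^-1; the boundary circle meets each cut
    once.

    The obstacle is that the word of a vertex is read along small circles in star coordinates
    unrelated to those of the box. Since -1 is an involution commuting with the action, the
    unordered pairs {y, -y} have no monodromy in the star coordinates, hence none in a smaller
    punctured square of the box. So the monodromy in the box is 1 or -1; and if it is 1, a small
    circle shows that -1 fixes the values of the section, so that it is -1 as well.

    Left and right of an edge are only meaningful through positive Jacobians, while coordinates may
    fail to be differentiable at their centers; two edge coordinate systems are therefore compared
    at a nearby point of the edge. *)

Lemma nbhs_setI (T : topologicalType) (p : T) (N N' : set T) :
  nbhs p N -> nbhs p N' -> nbhs p (N `&` N').
Proof. exact: filterI. Qed.

(** The hypothesis on [N] is symmetric in [x] and [y], so [Q] is locally constant and cuts out a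
    relatively open and closed subset of [A]. *)
Lemma connected_ind (T : topologicalType) (A : set T) (Q : T -> Prop) (a : T) :
  connected A -> A a -> Q a ->
  (forall p, A p -> exists N : set T, nbhs p N /\
     forall x y, N x -> N y -> A x -> A y -> Q x -> Q y) ->
  forall p, A p -> Q p.
Proof.
move=> cA Aa Qa step.
have oE (S : set T) : open [set p : T | \forall q \near p, S q].
  by rewrite openE => p; exact: nbhs_interior.
suff eA : A `&` Q = A by move=> p; rewrite -eA => -[].
apply: cA; first by exists a.
  exists [set p : T | \forall q \near p, A q -> Q q]; first exact: oE.
  rewrite eqEsubset; split=> p [Ap Qp]; split=> //.
    have [N [Np NP]] := step p Ap.
    by apply: filterS (Np) => q Nq Aq; apply: NP Qp => //; exact: nbhs_singleton.
  exact: (nbhs_singleton Qp).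
exists (~` [set p : T | \forall q \near p, A q -> ~ Q q]).
  by apply: open_closedC; exact: oE.
rewrite eqEsubset; split=> p [Ap Qp]; split=> //.
  by move=> nQ; exact: (nbhs_singleton nQ).
apply: contrapT => nQ; apply: Qp.
have [N [Np NP]] := step p Ap.
apply: filterS (Np) => q Nq Aq Qq; apply: nQ; apply: NP Qq => //.
exact: nbhs_singleton.
Qed.

(** * Local systems *)

Section LocalSystem.
Variables (B : topologicalType) (Y : Type).

(* [P p f]: near p, the function f, of which only the values in Om matter, is a
   section.  A section on a small neighborhood is determined by any one value. *)
Record local_system (Om : set B) (P : B -> (B -> Y) -> Prop) : Prop := {
  ls_germ : forall (p : B) f f', P p f ->
    (\forall q \near p, Om q -> f q = f' q) -> P p f';
  ls_uniq : forall (p : B) f f', P p f -> P p f' ->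
    exists N : set B, [/\ nbhs p N & forall z, N z -> Om z -> f z = f' z ->
      forall q, N q -> Om q -> f q = f' q];
  ls_dense : forall (p : B) (N : set B), nbhs p N -> exists q, N q /\ Om q }.

Variables (Om : set B) (P : B -> (B -> Y) -> Prop).

Definition sections (U : set B) (f : B -> Y) := forall p, U p -> P p f.

(** Triviality of the local system over [U]: for [U] open and connected, [sections_uniq] then makes
    evaluation at a point of [Om] a bijection from sections, up to their values off [Om], to [Y]. *)
Definition extendable (U : set B) := forall q y, U q -> Om q ->
  exists f, sections U f /\ f q = y.

Lemma extendable_sub (U U' : set B) :
  U' `<=` U -> extendable U -> extendable U'.
Proof.
move=> sub ext q y /sub Uq Oq; have [f [sf fq]] := ext q y Uq Oq.
by exists f; split=> // p /sub; exact: sf.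
Qed.

Hypothesis LS : local_system Om P.

(** The property propagated is agreement near [p], not at [p]: values off [Om] carry no information,
    and density of [Om] supplies the point of comparison when passing from one neighborhood to the
    next. *)
Lemma sections_uniq (U : set B) f f' z : open U -> connected U ->
  sections U f -> sections U f' -> U z -> Om z -> f z = f' z ->
  forall q, U q -> Om q -> f q = f' q.
Proof.
move=> oU cU sf sf' Uz Oz ez.
pose Q (p : B) := \forall q \near p, Om q -> f q = f' q.
suff h : forall p, U p -> Q p by move=> q /h Qq; exact: (nbhs_singleton Qq).
have step p : U p -> exists N, nbhs p N /\
    forall x y, N x -> N y -> U x -> U y -> Q x -> Q y.
  move=> Up; have [N [Np NP]] := ls_uniq LS (sf _ Up) (sf' _ Up).
  exists N^°; split=> [|x y Nx Ny _ _ Qx]; first exact: nbhs_interior.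
  have [w [[Nw Qw] Ow]] := ls_dense LS (filterI Nx Qx).
  by apply: filterS Ny => q Nq Oq; exact: NP (Qw Ow) _ Nq Oq.
apply: (connected_ind cU Uz _ step).
have [N [Nz NP]] := ls_uniq LS (sf _ Uz) (sf' _ Uz).
have Nzz := nbhs_singleton Nz.
by apply: filterS Nz => q Nq Oq; exact: NP ez _ Nq Oq.
Qed.

(** All members contain [b] and meet pairwise in connected sets, so the sections matching a given
    one near [b] are forced to match each other on every overlap. *)
Lemma extendable_bigcup (I : Type) (U : I -> set B) (b : B) :
  (forall i, open (U i)) -> (forall i j, connected (U i `&` U j)) ->
  (forall i, U i b) -> (forall i, extendable (U i)) ->
  extendable (\bigcup_i U i).
Proof.
move=> oU cU Ub ext q y [i0 _ Uq] Oq.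
have [f0 [sf0 f0q]] := ext i0 q y Uq Oq.
have oI i j : open (U i `&` U j) by apply: openI.
have step i : exists f, sections (U i) f /\
    forall z, U i z -> U i0 z -> Om z -> f z = f0 z.
  have [w [[Uw Uw0] Ow]] := ls_dense LS (open_nbhs_nbhs (conj (oI i i0) (conj (Ub i) (Ub i0)))).
  have [f [sf fw]] := ext i w (f0 w) Uw Ow.
  exists f; split=> // z Uz U0z Oz.
  apply: (@sections_uniq (U i `&` U i0) f f0 w) => //.
    by move=> p [Up _]; exact: sf.
  by move=> p [_ Up]; exact: sf0.
have [F FP] := choice step.
(* The triple intersection need not be connected; it only provides one point of [Om] at which [F i]
   and [F j] both equal [f0]. Connectedness of [U i] with [U j] does the rest. *)
have agree i j z : U i z -> U j z -> Om z -> F i z = F j z.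
  move=> Ui Uj Oz.
  have oT : open (U i `&` U j `&` U i0) by apply: openI.
  have [w [[[Uw Uw'] Uw0] Ow]] := ls_dense LS (open_nbhs_nbhs
    (conj oT (conj (conj (Ub i) (Ub j)) (Ub i0)))).
  apply: (@sections_uniq (U i `&` U j) (F i) (F j) w) => //.
  - by move=> p [Up _]; exact: (FP i).1.
  - by move=> p [_ Up]; exact: (FP j).1.
  - by rewrite (FP i).2 // (FP j).2.
(* The index is chosen pointwise, without continuity; by [agree] the resulting function coincides
   with [F i] on [U i] inside [Om]. *)
have /choice[c cP] : forall z, exists i, (\bigcup_i U i) z -> U i z.
  move=> z; have [[i _ Uz]|no] := pselect ((\bigcup_i U i) z); first by exists i.
  by exists i0.
exists (fun z => F (c z) z); split.
  move=> p [i _ Up]; apply: (ls_germ LS ((FP i).1 p Up)).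
  have : nbhs p (U i) by apply: open_nbhs_nbhs.
  apply: filterS => z Uz Oz; apply: agree => //.
  by apply: cP; exists i.
rewrite (FP _).2 //; apply: cP; by exists i0.
Qed.

Lemma extendableU (U V : set B) (b : B) : open U -> open V ->
  connected U -> connected V -> connected (U `&` V) ->
  U b -> V b -> extendable U -> extendable V -> extendable (U `|` V).
Proof.
move=> oU oV cU cV cUV Ub Vb eU eV.
have -> : U `|` V = \bigcup_i (fun b : bool => if b then U else V) i.
  rewrite eqEsubset; split=> [p [Up|Vp]|p [[] _ h]];
    [by exists true|by exists false|by left|by right].
apply: (extendable_bigcup (b := b)); case=> //.
- by case=> //; rewrite setIid.
- by case; rewrite ?setIid // setIC.
Qed.

End LocalSystem.

(** * The plane and coordinate squares *)

Section Plane.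
Variable R : realType.
Implicit Types (a b c z : 'rV[R]_2) (C : set 'rV[R]_2) (s e : R).

Lemma cxD a b : cx (a + b) = cx a + cx b. Proof. by rewrite /cx mxE. Qed.
Lemma cyD a b : cy (a + b) = cy a + cy b. Proof. by rewrite /cy mxE. Qed.
Lemma cxN a : cx (- a) = - cx a. Proof. by rewrite /cx mxE. Qed.
Lemma cyN a : cy (- a) = - cy a. Proof. by rewrite /cy mxE. Qed.
Lemma cxZ s a : cx (s *: a) = s * cx a. Proof. by rewrite /cx mxE. Qed.
Lemma cyZ s a : cy (s *: a) = s * cy a. Proof. by rewrite /cy mxE. Qed.
Lemma cx0 : cx (0 : 'rV[R]_2) = 0. Proof. by rewrite /cx mxE. Qed.
Lemma cy0 : cy (0 : 'rV[R]_2) = 0. Proof. by rewrite /cy mxE. Qed.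
Lemma cx_pt s e : cx (pt s e) = s. Proof. by rewrite /cx mxE. Qed.
Lemma cy_pt s e : cy (pt s e) = e. Proof. by rewrite /cy mxE. Qed.
Definition cE := (cx_pt, cy_pt, cxD, cyD, cxN, cyN, cxZ, cyZ, cx0, cy0).

Lemma cxyP a b : cx a = cx b -> cy a = cy b -> a = b.
Proof.
move=> ex ey; apply/rowP => i; case: i => -[|[|//]] p.
- by rewrite (_ : Ordinal p = 0) //; exact: val_inj.
- by rewrite (_ : Ordinal p = 1) //; exact: val_inj.
Qed.

Lemma pt_cxy z : pt (cx z) (cy z) = z. Proof. by apply: cxyP; rewrite !cE. Qed.

Lemma cx_continuous : continuous (@cx R). Proof. exact: coord_continuous. Qed.
Lemma cy_continuous : continuous (@cy R). Proof. exact: coord_continuous. Qed.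
Definition square c e : set 'rV[R]_2 :=
  [set z | `|cx z - cx c| < e /\ `|cy z - cy c| < e].

Lemma square_ballE c e : 0 < e -> square c e = ball c e.
Proof.
move=> e0; rewrite eqEsubset; split=> z.
  move=> [hx hy]; split=> // i j; rewrite (ord1 i) /ball /= distrC.
  case: j => -[|[|//]] p.
  - by rewrite (_ : Ordinal p = 0) //; exact: val_inj.
  - by rewrite (_ : Ordinal p = 1) //; exact: val_inj.
move=> [_ h]; split; rewrite distrC; [exact: (h 0 0)|exact: (h 0 1)].
Qed.

Lemma box_square : @box R = square 0 1.
Proof. by rewrite eqEsubset; split=> z; rewrite /square /box /= !cE !subr0. Qed.

Lemma nbhs_squareP z (N : set 'rV[R]_2) :
  nbhs z N <-> exists2 e, 0 < e & square z e `<=` N.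
Proof.
split=> [/nbhs_ballP[e /= e0 h]|[e e0 h]]; last apply/nbhs_ballP.
  by exists e; rewrite ?square_ballE.
by exists e => //; rewrite -square_ballE.
Qed.

Lemma square_center c e : 0 < e -> square c e c.
Proof. by rewrite /square /= !subrr normr0. Qed.

Lemma open_square c e : open (square c e).
Proof.
have op (h : 'rV[R]_2 -> R) s : continuous h -> open [set z | `|h z - s| < e].
  move=> hc; apply: (@open_comp _ _ (fun z => `|h z - s|) [set x | x < e]).
    move=> z _; apply: (@continuous_comp _ _ _ (fun z => h z - s) Num.norm).
      by apply: (@continuousB _ _ _ h (fun=> s)); [exact: hc|exact: cst_continuous].
    exact: norm_continuous.
  exact: open_lt.
rewrite (_ : square c e = [set z | `|cx z - cx c| < e] `&`
  [set z | `|cy z - cy c| < e]) //.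
by apply: openI; apply: op; [exact: cx_continuous|exact: cy_continuous].
Qed.

Lemma nbhs_square c e : 0 < e -> nbhs c (square c e).
Proof. by move=> e0; apply/nbhs_squareP; exists e. Qed.

Lemma open_box : open (@box R).
Proof. by rewrite box_square; exact: open_square. Qed.

Definition starshaped c C := forall z s, C z -> 0 <= s <= 1 -> C (c + s *: (z - c)).
Definition cvx C := forall c, C c -> starshaped c C.

Lemma cvxI C C' : cvx C -> cvx C' -> cvx (C `&` C').
Proof.
by move=> h h' c [Cc Cc'] z s [Cz Cz'] s01; split; [exact: h|exact: h'].
Qed.

Lemma comb_lt (u v w s : R) : 0 <= s <= 1 -> u < w -> v < w -> u + s * (v - u) < w.
Proof.
move=> /andP[s0 s1] uw vw; have [->|sn0] := eqVneq s 0; first by lra.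
have {}s0 : 0 < s by rewrite lt_def sn0.
have h1 : 0 < s * (w - v) by apply: mulr_gt0 => //; lra.
have h2 : 0 <= (1 - s) * (w - u) by apply: mulr_ge0; lra.
nra.
Qed.

Lemma cvx_square c e : cvx (square c e).
Proof.
move=> a [ax ay] z s [zx zy] s01; rewrite /square /= !cE.
have h (u v w : R) : `|u - w| < e -> `|v - w| < e -> `|u + s * (v - u) - w| < e.
  rewrite !ltr_norml => /andP[u1 u2] /andP[v1 v2].
  have := @comb_lt (u - w) (v - w) e s s01 u2 v2.
  have := @comb_lt (w - u) (w - v) e s s01.
  move=> /(_ ltac:(lra) ltac:(lra)) h1 h2; apply/andP; split; lra.
by split; apply: h.
Qed.

Lemma cvx_cxlt s : cvx [set z | cx z < s].
Proof. by move=> a /= as' z e /= zs e01; rewrite !cE; exact: comb_lt. Qed.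
Lemma cvx_cylt s : cvx [set z | cy z < s].
Proof. by move=> a /= as' z e /= zs e01; rewrite !cE; exact: comb_lt. Qed.
Lemma cvx_cygt s : cvx [set z | s < cy z].
Proof.
move=> a /= as' z e /= zs e01; rewrite !cE.
by have := @comb_lt (- cy a) (- cy z) (- s) e e01; nra.
Qed.

Lemma open_cxlt s : open [set z | cx z < s].
Proof.
by apply: (@open_comp _ _ (@cx R) [set x | x < s]) => [z _|]; [exact: cx_continuous|exact: open_lt].
Qed.
Lemma open_cxgt s : open [set z | s < cx z].
Proof.
by apply: (@open_comp _ _ (@cx R) [set x | s < x]) => [z _|]; [exact: cx_continuous|exact: open_gt].
Qed.
Lemma open_cylt s : open [set z | cy z < s].
Proof.
by apply: (@open_comp _ _ (@cy R) [set x | x < s]) => [z _|]; [exact: cy_continuous|exact: open_lt].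
Qed.
Lemma open_cygt s : open [set z | s < cy z].
Proof.
by apply: (@open_comp _ _ (@cy R) [set x | s < x]) => [z _|]; [exact: cy_continuous|exact: open_gt].
Qed.

Definition seg a b s : 'rV[R]_2 := a + s *: (b - a).

Lemma seg_continuous a b : continuous (seg a b).
Proof.
move=> s; rewrite /seg; apply: cvgD; first exact: cvg_cst.
by apply: cvgZr_tmp; exact: cvg_id.
Qed.

Lemma seg0 a b : seg a b 0 = a. Proof. by rewrite /seg scale0r addr0. Qed.
Lemma seg1 a b : seg a b 1 = b. Proof. by rewrite /seg scale1r subrKC. Qed.

Lemma starshaped_connected c C : C c -> starshaped c C -> connected C.
Proof.
move=> Cc sC.
have -> : C = \bigcup_(z in C) (seg c z @` `[0, 1]).
  rewrite eqEsubset; split=> [z Cz|z [y Cy [s /= s01 <-]]].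
    by exists z => //; exists 1; rewrite ?seg1 //= in_itv /= ler01 lexx.
  by apply: sC => //; rewrite in_itv in s01.
apply: bigcup_connected.
  by exists c => z Cz; exists 0; rewrite ?seg0 //= in_itv /= ler01 lexx.
move=> z Cz; apply: connected_continuous_connected; first exact: segment_connected.
by apply: continuous_subspaceT; exact: seg_continuous.
Qed.

Lemma cvx_connected C : cvx C -> connected C.
Proof.
move=> cC; have [->|/set0P[c Cc]] := eqVneq C set0; first exact: connected0.
by apply: (@starshaped_connected c) => //; exact: cC.
Qed.

End Plane.

Section Coordinates.
Variables (R : realType) (B : topologicalType) (k : 'rV[R]_2 -> B).
Hypothesis kE : open_embedding k.
Implicit Type C : set 'rV[R]_2.

Lemma emb_inj y z : box y -> box z -> k y = k z -> y = z.
Proof. by case: kE => h _ _ by_ bz; apply: h; rewrite inE. Qed.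

Lemma emb_cvg z : box z -> k y @[y --> z] --> k z.
Proof. by case: kE => _ h _ /h. Qed.

Lemma emb_open C : open C -> C `<=` box -> open (k @` C).
Proof. by case: kE => _ _; apply. Qed.

Lemma emb_nbhs C z : nbhs z C -> box z -> nbhs (k z) (k @` C).
Proof.
move=> Nz bz.
have oD : open (C^° `&` box) by apply: openI; [exact: open_interior|exact: open_box].
have := emb_open oD (@subIsetr _ _ _).
rewrite openE => /(_ (k z)) h.
have : nbhs (k z) (k @` (C^° `&` box)).
  by apply: h; exists z => //; split=> //; exact: nbhs_singleton (nbhs_interior Nz).
by apply: filterS => _ [y [/interior_subset Cy _] <-]; exists y.
Qed.

Lemma emb_connected C : C `<=` box -> connected C -> connected (k @` C).
Proof.
move=> sub cC; apply: connected_continuous_connected => //.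
by apply: continuous_in_subspaceT => z; rewrite inE => /sub; exact: emb_cvg.
Qed.

Lemma emb_imageI C C' : C `<=` box -> C' `<=` box ->
  k @` C `&` k @` C' = k @` (C `&` C').
Proof.
move=> sC sC'; rewrite eqEsubset; split; last first.
  by move=> _ [z [Cz C'z] <-]; split; exists z.
move=> _ [[z Cz <-] [y C'y /emb_inj e]].
by exists z => //; split=> //; rewrite -e //; [exact: sC'|exact: sC].
Qed.

Lemma emb_imageP C z : C `<=` box -> box z -> (k @` C) (k z) <-> C z.
Proof.
move=> sC bz; split=> [[y Cy /emb_inj e]|Cz]; last by exists z.
by rewrite -e //; exact: sC.
Qed.

(** * Extension of sections over starshaped regions *)

Section Star.
Variables (Y : Type) (Om : set B) (P : B -> (B -> Y) -> Prop).
Hypothesis LS : local_system Om P.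
Variables (C : set 'rV[R]_2) (a : 'rV[R]_2).
Hypotheses (Cb : C `<=` box) (oC : open C) (sC : starshaped a C).
Hypothesis loc : forall z, C z -> exists N, nbhs (k z) N /\ extendable Om P N.

(** A thickened segment, being open and convex, meets a further square in a connected set, as
    [extendableU] requires. *)
Let tube b (s e : R) : set 'rV[R]_2 :=
  \bigcup_(s' in [set x | 0 <= x <= s]) square (seg a b s') e.

Let tube_open b s e : open (tube b s e).
Proof. by apply: bigcup_open => s' _; exact: open_square. Qed.

Let tube_cvx b s e : cvx (tube b s e).
Proof.
move=> y [u /andP[u0 us] [yx yy]] z v [w /andP[w0 ws] [zx zy]] /andP[v0 v1].
exists (u + v * (w - u)).
  by apply/andP; split; nra.
move: yx yy zx zy; rewrite /square /= /seg !cE.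
have h p q x x' (c : R) : `|x - (p + u * q)| < e -> `|x' - (p + w * q)| < e ->
    `|x + v * (x' - x) - (p + (u + v * (w - u)) * q)| < e.
  rewrite !ltr_norml => /andP[h1 h2] /andP[h3 h4].
  have v01 : 0 <= v <= 1 by apply/andP.
  have := @comb_lt _ (x - (p + u * q)) (x' - (p + w * q)) e v v01 h2 h4.
  have := @comb_lt _ (p + u * q - x) (p + w * q - x') e v v01.
  move=> /(_ ltac:(lra) ltac:(lra)) h5 h6; apply/andP; split; nra.
by move=> h1 h2 h3 h4; split; apply: h.
Qed.

(** Continuous induction along the segment from [a] to [b]: a tube that reaches one parameter is
    prolonged by gluing the small square around a nearby point of the segment, at the cost of making
    it thinner. *)
Lemma extendable_segment b : C b ->
  exists T, [/\ open T, cvx T, T `<=` C, T a & T b /\ extendable Om P (k @` T)].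
Proof.
move=> Cb'.
pose S (s : R) := exists e : R, [/\ 0 < e, tube b s e `<=` C & extendable Om P (k @` (tube b s e))].
have locs (s : R) : 0 <= s <= 1 -> exists e : R, [/\ 0 < e, square (seg a b s) e `<=` C &
    extendable Om P (k @` square (seg a b s) e)].
  move=> s01; have Cs : C (seg a b s) by apply: sC.
  have [N [Nz ext]] := loc Cs.
  have : nbhs (seg a b s) (C `&` k @^-1` N).
    apply: filterI; first exact: open_nbhs_nbhs.
    exact: (emb_cvg (Cb Cs)).
  move=> /nbhs_squareP[e e0 sub]; exists e; split=> //.
    by move=> z /sub[].
  by apply: extendable_sub ext => _ [z /sub[_ h] <-].
have S1 : S 1.
  apply: (@connected_ind R `[0, 1]%classic S 0).
  - exact: segment_connected.
  - by rewrite /= in_itv /= lexx ler01.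
  - have [|e [e0 sub ext]] := locs 0; first by rewrite lexx ler01.
    have eT : tube b 0 e = square (seg a b 0) e.
      rewrite eqEsubset; split=> [z [s /andP[s0 s1]]|z sz].
        by have -> : s = 0 by lra.
      by exists 0 => //=; rewrite lexx.
    by exists e; rewrite eT.
  - move=> s /=; rewrite in_itv /= => s01.
    have [e [e0 sub ext]] := locs s s01.
    pose M := 1 + `|cx (b - a)| + `|cy (b - a)|.
    have M0 : 0 < M.
      by rewrite /M; have := normr_ge0 (cx (b - a)); have := normr_ge0 (cy (b - a)); lra.
    (* A change of the parameter by less than [d] moves each coordinate of the point by less than
       [e / 2]. *)
    pose d := e / (2 * M).
    have d0 : 0 < d by apply: divr_gt0 => //; lra.
    have dM : d * M = e / 2 by rewrite /d; field; lra.
    have near s' : `|s - s'| < d -> `|cx (seg a b s') - cx (seg a b s)| < e / 2 /\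
        `|cy (seg a b s') - cy (seg a b s)| < e / 2.
      move=> ds; rewrite /seg !(cxD, cyD, cxZ, cyZ).
      have h p q : `|q| <= M -> `|p + s' * q - (p + s * q)| < e / 2.
        move=> qM; have -> : p + s' * q - (p + s * q) = - ((s - s') * q) by ring.
        rewrite normrN normrM -dM.
        apply: (@le_lt_trans _ _ (`|s - s'| * M)); first exact: ler_wpM2l.
        by rewrite ltr_pM2r.
      have := normr_ge0 (cx (b - a)); have := normr_ge0 (cy (b - a)).
      by rewrite -cxD -cyD; split; apply: h; rewrite /M; lra.
    exists (ball s d); split; first exact: nbhsx_ballx.
    move=> x y /= sx sy; rewrite !in_itv /= => /andP[x0 x1] /andP[y0 y1] [f [f0 fsub fext]].
    have [xx xy] := near x sx; have [yx yy] := near y sy.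
    (* The other half of [e] is left for the width: the new piece of a tube of width [g] stays
       inside the square of size [e]. *)
    pose g := Num.min f (e / 2).
    have g0 : 0 < g by rewrite /g lt_min f0; lra.
    have tsub : tube b y g `<=` tube b x f `|` square (seg a b s) e.
      move=> z [u /andP[u0 uy] [zx zy]].
      have [ux|xu] := leP u x.
        left; exists u; first by apply/andP.
        move: zx zy; rewrite /g /square /=; rewrite !lt_min => /andP[-> _] /andP[-> _].
        by [].
      right.
      have [uxx uyy] : `|cx (seg a b u) - cx (seg a b s)| < e / 2 /\
        `|cy (seg a b u) - cy (seg a b s)| < e / 2.
        apply: near; move: sx sy; rewrite /ball /= !ltr_norml => /andP[h1 h2] /andP[h3 h4].
        apply/andP; split; lra.
      move: zx zy; rewrite /g /square /=; rewrite !lt_min => /andP[_ zx] /andP[_ zy].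
      by split; rewrite !ltr_norml in zx zy uxx uyy *; apply/andP; split; lra.
    have Tx : tube b x f (seg a b x).
      by exists x; [apply/andP; split=> // | exact: square_center].
    have extU : extendable Om P (k @` (tube b x f `|` square (seg a b s) e)).
      rewrite image_setU.
      have sb : square (seg a b s) e `<=` box by move=> z /sub /Cb.
      have fb : tube b x f `<=` box by move=> z /fsub /Cb.
      apply: (extendableU LS (b := k (seg a b x))) => //.
      + by apply: emb_open.
      + by apply: emb_open => //; exact: open_square.
      + by apply: emb_connected => //; exact: cvx_connected.
      + by apply: emb_connected => //; apply: cvx_connected; exact: cvx_square.
      + rewrite emb_imageI //; apply: emb_connected; first by move=> z [/fb].
        by apply: cvx_connected; apply: cvxI => //; exact: cvx_square.
      + exists (seg a b x) => //; split; lra.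
    exists g; split=> //.
      by move=> z /tsub[/fsub|/sub].
    by apply: extendable_sub extU; apply: image_subset.
  - by rewrite /= in_itv /= lexx ler01.
have [e [e0 sub ext]] := S1.
exists (tube b 1 e); split=> //.
- by exists 0; rewrite ?seg0 /=; [rewrite lexx ler01|exact: square_center].
- split=> //; exists 1; rewrite ?seg1 /=; [by rewrite lexx ler01|exact: square_center].
Qed.

(** The tubes toward the various points of [C] are convex and share [a], so any two meet in a convex
    set and [extendable_bigcup] applies. *)
Lemma extendable_starshaped : extendable Om P (k @` C).
Proof.
have /choice[T TP] : forall b, exists T, C b ->
  [/\ open T, cvx T, T `<=` C, T a & T b /\ extendable Om P (k @` T)].
  move=> b; have [Cb'|nC] := pselect (C b); last by exists set0.
  by have [T h] := extendable_segment Cb'; exists T.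
have -> : k @` C = \bigcup_(i : {b | C b}) (k @` T (sval i)).
  rewrite eqEsubset; split=> [_ [z Cz <-]|_ [[z Cz] _ [y /= Ty <-]]].
    by exists (exist _ z Cz) => //=; have [_ _ _ _ [Tz _]] := TP z Cz; exists z.
  by have [_ _ sub _ _] := TP z Cz; exists y => //; exact: sub.
have Tb (i : {b | C b}) : T (sval i) `<=` box.
  by case: i => z Cz /= y; have [_ _ sub _ _] := TP z Cz => /sub/Cb.
apply: (extendable_bigcup LS (b := k a)).
- move=> i; apply: emb_open => //; by case: i => z Cz /=; case: (TP z Cz).
- move=> i j; rewrite emb_imageI //; apply: emb_connected; first by move=> z [/Tb].
  apply: cvx_connected; case: i j => z Cz [y Cy] /=.
  by case: (TP z Cz) => _ h _ _ _; case: (TP y Cy) => _ h' _ _ _; exact: cvxI.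
- by case=> z Cz /=; case: (TP z Cz) => _ _ _ Ta _; exists a.
- by case=> z Cz /=; case: (TP z Cz) => _ _ _ _ [].
Qed.

End Star.
End Coordinates.

(** * The sides of an edge *)

Section Differentials.
Variable R : realType.

Lemma cx_le_norm (v : 'rV[R]_2) : `|cx v| <= `|v|.
Proof. by rewrite [leRHS]/Num.norm /= mx_normrE; apply/bigmax_geP; right => /=; exists (0, 0). Qed.

Lemma cy_le_norm (v : 'rV[R]_2) : `|cy v| <= `|v|.
Proof. by rewrite [leRHS]/Num.norm /= mx_normrE; apply/bigmax_geP; right => /=; exists (0, 1). Qed.

Lemma norm_le_cxy (v : 'rV[R]_2) : `|v| <= `|cx v| + `|cy v|.
Proof.
rewrite [leLHS]/Num.norm /= mx_normrE; apply/bigmax_leP; split.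
  by apply: addr_ge0.
case=> i j _ /=; rewrite (ord1 i); case: j => -[|[|//]] p.
- by rewrite (_ : Ordinal p = 0) ?lerDl //; exact: val_inj.
- by rewrite (_ : Ordinal p = 1) ?lerDr //; exact: val_inj.
Qed.

Lemma cx_mulmx (v : 'rV[R]_2) (M : 'M[R]_2) : cx (v *m M) = cx v * M 0 0 + cy v * M 1 0.
Proof.
rewrite /cx /cy mxE big_ord_recl big_ord1.
by rewrite (_ : lift ord0 ord0 = 1) //; exact: val_inj.
Qed.

Lemma cy_mulmx (v : 'rV[R]_2) (M : 'M[R]_2) : cy (v *m M) = cx v * M 0 1 + cy v * M 1 1.
Proof.
rewrite /cx /cy mxE big_ord_recl big_ord1.
by rewrite (_ : lift ord0 ord0 = 1) //; exact: val_inj.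
Qed.

Lemma mulmx_bound (M : 'M[R]_2) : exists2 K : R, 0 < K &
  forall v : 'rV[R]_2, `|v *m M| <= K * `|v|.
Proof.
exists (1 + `|M 0 0| + `|M 0 1| + `|M 1 0| + `|M 1 1|).
  by rewrite -!addrA; apply: ltr_pwDl => //; rewrite !addr_ge0.
move=> v; apply: le_trans (norm_le_cxy _) _; rewrite cx_mulmx cy_mulmx.
apply: le_trans (lerD (ler_normD _ _) (ler_normD _ _)) _.
rewrite !normrM !mulrDl.
have hx := cx_le_norm v; have hy := cy_le_norm v.
have := ler_wpM2r (normr_ge0 (M 0 0)) hx.
have := ler_wpM2r (normr_ge0 (M 0 1)) hx.
have := ler_wpM2r (normr_ge0 (M 1 0)) hy.
have := ler_wpM2r (normr_ge0 (M 1 1)) hy.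
have := normr_ge0 v.
lra.
Qed.

Lemma differentiable_jacobian (h : 'rV[R]_2 -> 'rV[R]_2) a (e : R) :
  differentiable h a -> 0 < e ->
  \forall v \near (0 : 'rV[R]_2), `|h (v + a) - h a - v *m jacobian h a| <= e * `|v|.
Proof.
move=> /diff_locally /eqaddoP /(_ e) h1 e0; have := h1 e0.
apply: filterS => v /=; rewrite /jacobian mul_rV_lin1.
rewrite (_ : (_ - _) v = h (v + a) - h a - 'd h a v) //.
by rewrite !fctE /= opprD addrA.
Qed.

Lemma nbhs_shift (a : 'rV[R]_2) (N : set 'rV[R]_2) :
  nbhs a N <-> nbhs (0 : 'rV[R]_2) [set v | N (v + a)].
Proof.
split=> /nbhs_squareP[e e0 sub]; apply/nbhs_squareP; exists e => // v.
  by move=> [vx vy]; apply: sub; split; rewrite !cE addrK; rewrite !cE ?subr0 in vx vy.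
move=> [vx vy]; rewrite -(subrK a v); apply: sub.
by split; rewrite !cE !subr0.
Qed.

Lemma positive_at_linear (B : topologicalType) (k l : 'rV[R]_2 -> B) a z :
  positive_at k l a z -> exists h (J : 'M[R]_2),
    [/\ h a = z, \forall y \near a, box (h y) /\ l (h y) = k y, 0 < \det J &
      forall e, 0 < e ->
        \forall v \near (0 : 'rV[R]_2), `|h (v + a) - h a - v *m J| <= e * `|v|].
Proof.
move=> [h [ha hl hd hJ]]; exists h, (jacobian h a).
split; [exact: ha|exact: hl|exact: hJ|].
by move=> e e0; exact: differentiable_jacobian.
Qed.

(* phi is the transition between k and k', which need not belong to the atlas;
   l is only used to compare them. *)
Lemma transition_linear (B : topologicalType) (k k' l phi : 'rV[R]_2 -> _)
    (a z : 'rV[R]_2) :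
  open_embedding (l : _ -> B) -> positive_at k l a z -> positive_at k' l (phi a) z ->
  (\forall y \near a, k' (phi y) = k y) -> {for a, continuous phi} ->
  exists M : 'M[R]_2, 0 < \det M /\ forall e, 0 < e ->
    \forall v \near (0 : 'rV[R]_2), `|phi (v + a) - phi a - v *m M| <= e * `|v|.
Proof.
move=> lE /positive_at_linear[h [J [ha hl hJ hd]]] /positive_at_linear[h' [J' [ha' hl' hJ' hd']]].
move=> kphi cphi.
have uJ' : J' \in unitmx by rewrite unitmxE unitfE gt_eqF.
exists (J *m invmx J'); split.
  have -> : \det (J *m invmx J') = \det J / \det J' by rewrite det_mulmx det_inv.
  exact: divr_gt0.
move=> e e0.
have [K K0 KP] := mulmx_bound (invmx J').
have [C C0 CP] := mulmx_bound (J *m invmx J').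
(* The first bound lets the unknown [|u|] be absorbed in the error estimate, giving
   [|u| <= (2C + 1) |v|]; the second then brings the error K f (|u| + |v|) below [e |v|]. *)
pose f := Num.min (K^-1 / 2) (e / (K * (2 * C + 2))).
have f0 : 0 < f.
  rewrite lt_min divr_gt0 ?invr_gt0 //=; apply: divr_gt0 => //.
  by apply: mulr_gt0 => //; lra.
have f1 : f <= K^-1 / 2 by rewrite ge_min lexx.
have f2 : f <= e / (K * (2 * C + 2)) by rewrite ge_min lexx orbT.
have fK : K * f <= 1 / 2.
  have -> : 1 / 2 = K * (K^-1 / 2) by field; rewrite gt_eqF.
  by rewrite ler_pM2l.
have fe : K * f * (2 * C + 2) <= e.
  have -> : e = K * (e / (K * (2 * C + 2))) * (2 * C + 2).
    by field; rewrite !gt_eqF //; lra.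
  by rewrite ler_pM2r ?ler_pM2l //; lra.
have cphi0 N : nbhs (0 : 'rV[R]_2) N ->
    nbhs (0 : 'rV[R]_2) [set v | N (phi (v + a) - phi a)].
  move=> N0; apply/(nbhs_shift a [set y | N (phi y - phi a)]).
  apply: (cphi [set y | N (y - phi a)]); apply/nbhs_shift.
  by apply: filterS N0 => v; rewrite /= addrK.
have hh : \forall v \near (0 : 'rV[R]_2), h (v + a) = h' (phi (v + a)).
  have H1 := (nbhs_shift _ _).1 hl; have H2 := (nbhs_shift _ _).1 kphi.
  have H3 := (nbhs_shift _ _).1 (cphi _ hl').
  apply: filterS3 H1 H2 H3 => v /= [b1 e1] e2 [b3 e3].
  by apply: (emb_inj lE) => //; rewrite e1 e3.
have D1 := hd _ f0.
have D2 := cphi0 _ (hd' _ f0).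
apply: filterS3 hh D1 D2 => v ev /=; rewrite subrK.
set u := phi (v + a) - phi a; rewrite -ev ha ha' => d1 d2.
set r := h (v + a) - z in d1 d2.
have eu : u = u *m J' *m invmx J' by rewrite mulmxK.
have bound : `|u - v *m (J *m invmx J')| <= K * f * (`|u| + `|v|).
  rewrite {1}eu mulmxA -mulmxBl.
  apply: le_trans (KP _) _; rewrite -mulrA ler_pM2l // mulrDr.
  rewrite (_ : _ - _ = (r - v *m J) - (r - u *m J')); last first.
    by rewrite [RHS]addrC opprB addrA subrK.
  by apply: le_trans (ler_normB _ _) _; rewrite addrC lerD.
have un : `|u| <= (2 * C + 1) * `|v|.
  have h1 : `|u| <= `|u - v *m (J *m invmx J')| + `|v *m (J *m invmx J')|.
    by rewrite -{1}(subrK (v *m (J *m invmx J')) u) ler_normD.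
  have h2 := CP v.
  have h3 : K * f * (`|u| + `|v|) <= 1 / 2 * (`|u| + `|v|).
    by apply: ler_wpM2r => //; rewrite addr_ge0.
  lra.
apply: le_trans bound _.
apply: (@le_trans _ _ (K * f * (2 * C + 2) * `|v|)); last exact: ler_wpM2r.
rewrite -[leRHS]mulrA; apply: ler_wpM2l; last by lra.
by apply/ltW/mulr_gt0.
Qed.

End Differentials.

Lemma ltr_int_add1 (R : realType) (m n : int) :
  m%:~R < n%:~R :> R -> m%:~R + 1 <= n%:~R :> R.
Proof.
by rewrite ltr_int -[1]/(1%:~R : R) -intrD ler_int; lia.
Qed.

Section Sides.
Variables (R : realType) (B : topologicalType) (L : Type).
Variables (A : set ('rV[R]_2 -> B)) (G : graph R B L).
Hypotheses (hA : oriented_atlas A) (fG : finite_graph A G).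

Lemma box0 : box (0 : 'rV[R]_2).
Proof. by rewrite /box /= !cE normr0 ltr01. Qed.

Lemma edge_at_center p x k : edge_at A G p x k -> k 0 = p.
Proof. by case=> -[]. Qed.

Lemma edge_at_emb p x k : edge_at A G p x k -> open_embedding k.
Proof. by case=> -[]. Qed.

Lemma edge_at_support p x k z : edge_at A G p x k -> box z ->
  graph_support G (k z) <-> cy z = 0.
Proof. by case=> _ _ h _; exact: h. Qed.

Lemma edge_arc_same p0 x0 k0 q x k z z0 :
  edge_at A G p0 x0 k0 -> edge_at A G q x k -> box z -> box z0 -> cy z = 0 ->
  k z = k0 z0 -> x = x0.
Proof.
move=> E0 E bz bz0 zy ek.
have zy0 : cy z0 = 0.
  by apply/(edge_at_support E0 bz0); rewrite -ek; apply/(edge_at_support E bz).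
case: E0 => [_ _ _ [i0 [<- [f0 [_ dom0 arc0]]]]].
case: E => [_ _ _ [i [<- [f [_ dom arc]]]]].
have bx (w : 'rV[R]_2) : box w -> cx w \in `]-1, 1[ by rewrite in_itv /= -ltr_norml => -[].
have hz := arc _ (bx _ bz); have hz0 := arc0 _ (bx _ bz0).
rewrite -zy pt_cxy in hz; rewrite -zy0 pt_cxy in hz0.
case: fG => _ _ _ _ [_ _ same _ _].
congr (label _); apply: (same _ _ (f (cx z)) (f0 (cx z0))).
- by apply: dom; exact: bx.
- by apply: dom0; exact: bx.
- by rewrite -hz ek hz0.
Qed.

Lemma edge_arc_int (i : 'I_(nedges G)) s t : edge_dom i s -> edge_dom i t ->
  edge_arc i s = edge_arc i t -> exists m : int, s - t = m%:~R.
Proof.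
case: fG => _ _ _ _ [arcs hoops _ _ _]; rewrite /edge_dom.
case: ifP => [hi _ _ e|/negbT hi ds dt e].
  by have [_ /(_ s t)[h _]] := hoops i hi; exact: h.
have [_ _ _ inj] := arcs i hi.
by exists 0; rewrite (inj s t) ?subrr ?inE.
Qed.

(* At a point of the edge other than the centers, where both coordinates are
   smoothly compatible, the transition has a triangular derivative; its entry
   along the edge is positive because both run along the orientation of the edge,
   hence so is the transverse one, by positivity of the determinant. *)
Lemma side_consistent p0 x0 k0 q x k z1 :
  edge_at A G p0 x0 k0 -> edge_at A G q x k -> box z1 -> k0 z1 = q ->
  exists N : set B, nbhs q N /\ forall z z0, box z -> box z0 -> N (k z) ->
    k z = k0 z0 -> (0 < cy z -> 0 < cy z0) /\ (cy z < 0 -> cy z0 < 0).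
Proof.
move=> E0 E bz1 ez1.
have kq := edge_at_center E.
have k0E := edge_at_emb E0; have kE := edge_at_emb E.
have [eta [eta0 etab etaP]] : exists eta : R, [/\ 0 < eta, square 0 eta `<=` box &
    forall z, square 0 eta z -> exists z0, box z0 /\ k0 z0 = k z].
  have : nbhs (0 : 'rV[R]_2) (box `&` k @^-1` (k0 @` box)).
    apply: filterI; first by apply: open_nbhs_nbhs; split; [exact: open_box|exact: box0].
    apply: (emb_cvg kE box0); rewrite /= kq -ez1; apply: emb_nbhs => //.
    by apply: open_nbhs_nbhs; split=> //; exact: open_box.
  move=> /nbhs_squareP[e e0 sub]; exists e; split=> //.
    by move=> z /sub[].
  by move=> z /sub[_ [z0 bz0 e1]]; exists z0.
have /choice[phi phiP] : forall z, exists z0, square 0 eta z -> box z0 /\ k0 z0 = k z.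
  move=> z; have [sz|nz] := pselect (square 0 eta z); last by exists 0.
  by have [z0 h] := etaP z sz; exists z0.
have phib z : square 0 eta z -> box (phi z) by move=> /phiP[].
have phik z : square 0 eta z -> k0 (phi z) = k z by move=> /phiP[].
have phic z : square 0 eta z -> {for z, continuous phi}.
  move=> sz N Nz; have bz := etab _ sz.
  have Nz' : nbhs (phi z) (N `&` box).
    by apply: filterI => //; apply: open_nbhs_nbhs; split; [exact: open_box|exact: phib].
  have h0 := emb_nbhs k0E Nz' (phib _ sz); rewrite phik // in h0.
  have h : nbhs z (k @^-1` (k0 @` (N `&` box))) := emb_cvg kE bz h0.
  have sz' := open_nbhs_nbhs (conj (@open_square R 0 eta) sz).
  change (nbhs z (phi @^-1` N)).
  apply: filterS2 h sz' => y /= [u [Nu bu] eu] sy.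
  have := phik y sy; rewrite -eu => /(emb_inj k0E (phib _ sy) bu) e.
  by rewrite /= e.
have phiy z : square 0 eta z -> cy (phi z) = 0 <-> cy z = 0.
  move=> sz; have h1 := edge_at_support E0 (phib _ sz).
  have h2 := edge_at_support E (etab _ sz).
  by rewrite phik // in h1; split=> [/h1/h2|/h2/h1].
have phi_inj y z : square 0 eta y -> square 0 eta z -> phi y = phi z -> y = z.
  move=> sy sz e; apply: (emb_inj kE); [exact: etab|exact: etab|].
  by rewrite -!phik // e.
have sqx r : `|r| < eta -> square 0 eta (pt r 0).
  by move=> h; rewrite /square /= !cE !subr0 normr0.
(* The point [a] must differ from the centers of both coordinate systems, where differentiability
   may fail. By injectivity of [phi], at most one of the two candidates is sent to 0. *)
have [s [s0 seta phis]] : exists s, [/\ 0 < s, s < eta & phi (pt s 0) != 0].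
  have [e2|] := eqVneq (phi (pt (eta / 2) 0)) 0; last first.
    by exists (eta / 2); split=> //; lra.
  exists (eta / 3); split; [lra|lra|].
  apply/eqP => e3; have : pt (eta / 3) 0 = pt (eta / 2) 0.
    apply: phi_inj; last by rewrite e2.
    - by apply: sqx; rewrite gtr0_norm; lra.
    - by apply: sqx; rewrite gtr0_norm; lra.
  by move=> /(congr1 (@cx R)); rewrite !cE; lra.
set a := pt s 0 in phis.
have sa : square 0 eta a by apply: sqx; rewrite gtr0_norm.
have a0 : a != 0.
  by apply/eqP => /(congr1 (@cx R)); rewrite /a !cE; lra.
have [hl1 /(_ (k a))[l [zl [Al bzl ezl]]] _] := hA.
have pos1 : positive_at k l a zl.
  by case: E => -[_ _ h] _ _ _; apply: h => //; exact: etab.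
have pos2 : positive_at k0 l (phi a) zl.
  case: E0 => -[_ _ h] _ _ _; apply: h => //; first exact: phib.
  by rewrite phik.
have near_phi : \forall y \near a, k0 (phi y) = k y.
  by apply: filterS (open_nbhs_nbhs (conj (@open_square R 0 eta) sa)) => y /phik.
have [M [detM MP]] := transition_linear (hl1 _ Al) pos1 pos2 near_phi (phic _ sa).
have {MP} MP e : 0 < e -> exists rho : R, 0 < rho /\ forall v, square 0 rho v ->
    square 0 eta (v + a) /\ `|phi (v + a) - phi a - v *m M| <= e * `|v|.
  move=> e0; have h1 := MP e e0.
  have h2 := (nbhs_shift a _).1 (open_nbhs_nbhs (conj (@open_square R 0 eta) sa)).
  by have /nbhs_squareP[rho rho0 sub] := nbhs_setI h2 h1; exists rho.
have sqv rho r r' : `|r| < rho -> `|r'| < rho -> square 0 rho (pt r r' : 'rV[R]_2).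
  by move=> h h'; rewrite /square /= !cE !subr0.
have normx r : `|pt r 0 : 'rV[R]_2| <= `|r|.
  by apply: le_trans (norm_le_cxy _) _; rewrite !cE normr0 addr0.
have normy r : `|pt 0 r : 'rV[R]_2| <= `|r|.
  by apply: le_trans (norm_le_cxy _) _; rewrite !cE normr0 add0r.
have cya : cy (phi a) = 0 by apply/phiy => //; rewrite /a !cE.
(* [phi] maps the horizontal axis into itself, since both axes are the graph; so the image of a
   horizontal increment has no vertical part. *)
have M01 : M 0 1 = 0.
  apply/eqP; apply: contraT => M0; have M0' : 0 < `|M 0 1| by rewrite normr_gt0.
  have [|rho [rho0 h]] := MP (`|M 0 1| / 2); first by lra.
  have [|sv hv] := h (pt (rho / 2) 0).
    by apply: sqv; rewrite ?normr0 // gtr0_norm; lra.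
  have := le_trans (cy_le_norm _) hv.
  rewrite !cE cy_mulmx !cE cya.
  have -> : cy (phi (pt (rho / 2) 0 + a)) = 0 by apply/phiy => //; rewrite /a !cE addr0.
  rewrite subrr mul0r addr0 sub0r normrN normrM.
  have := normx (rho / 2); rewrite gtr0_norm; last by lra.
  have key (m r n : R) : 0 < m -> 0 < r -> n <= r / 2 -> r / 2 * m <= m / 2 * n -> False by nra.
  by move=> h1 h2; case: (key _ _ _ M0' rho0 h1 h2).
have detE : \det M = M 0 0 * M 1 1.
  rewrite (expand_det_row _ 0) big_ord_recl big_ord1 /cofactor /=.
  rewrite (_ : lift ord0 ord0 = 1); last exact: val_inj.
  rewrite M01 mul0r addr0 !det_mx11 !mxE expr0 mul1r; congr (_ * M _ _); exact: val_inj.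
have M00n : M 0 0 != 0 by apply: contraTneq detM; rewrite detE => ->; rewrite mul0r ltxx.
have bx (w : 'rV[R]_2) : box w -> cx w \in `]-1, 1[ by rewrite in_itv /= -ltr_norml => -[].
(* Otherwise the abscissa [sg r] of the image decreases while the point moves right, although [f]
   and [f0] both increase. The difference [g] of the two arc parameters is an integer, since a hoop
   has period 1, so each such move adds at least 1 to it. Arbitrarily many moves fit between 0 and
   [rho / 2], and [g (rho / 2) - g 0] would exceed every natural number. *)
have M00 : 0 < M 0 0.
  rewrite lt_def M00n /= leNgt; apply/negP => M0.
  have [|rho [rho0 h]] := MP (- M 0 0 / 2); first by lra.
  case: (E0) => [_ _ _ [i0 [_ [f0 [f0m f0d f0a]]]]].
  case: (E) => [_ _ _ [i [_ [f [fm fd fa]]]]].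
  have ei : i0 = i.
    case: fG => _ _ _ _ [_ _ same _ _].
    apply: (same _ _ (f0 (cx (phi a))) (f (cx a))).
    - by apply/f0d/bx/phib.
    - by apply/fd/bx/etab.
    - rewrite -f0a; last by apply/bx/phib.
      rewrite -fa; last by apply/bx/etab.
      by rewrite -{1}cya pt_cxy phik // /a !cE.
  subst i0.
  pose sg r := cx (phi (pt r 0 + a)).
  have ea r : pt r 0 + a = pt (r + s) 0 by apply: cxyP; rewrite /a !cE ?addr0.
  have sqr r : 0 <= r < rho -> square 0 eta (pt r 0 + a).
    move=> /andP[r0 rr]; have [|//] := h (pt r 0).
    by apply: sqv; rewrite ?normr0 // ger0_norm.
  have sgP r : 0 <= r < rho ->
      3 / 2 * M 0 0 * r <= sg r - sg 0 <= 1 / 2 * M 0 0 * r.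
    move=> /andP[r0 rr]; have [|sv hv] := h (pt r 0).
      by apply: sqv; rewrite ?normr0 // ger0_norm.
    have := le_trans (cx_le_norm _) hv.
    rewrite !cE cx_mulmx !cE mul0r addr0 -/(sg r).
    have -> : cx (phi a) = sg 0 by rewrite /sg ea add0r.
    have := normx r; rewrite ger0_norm // ler_norml => h1 /andP[h2 h3].
    have h4 : - M 0 0 / 2 * `|pt r 0 : 'rV[R]_2| <= - M 0 0 / 2 * r.
      by apply: ler_wpM2l => //; lra.
    by apply/andP; split; lra.
  pose g r := f (r + s) - f0 (sg r).
  have inr r : 0 <= r < rho -> r + s \in `]-1, 1[.
    by move=> /sqr; rewrite ea => /etab/bx; rewrite cE.
  have insg r : 0 <= r < rho -> sg r \in `]-1, 1[ by move=> /sqr/phib/bx.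
  have gint r : 0 <= r < rho -> exists m : int, g r = m%:~R.
    move=> rr; apply: (@edge_arc_int i).
    - by apply/fd/inr.
    - by apply/f0d/insg.
    - rewrite -f0a; last exact: insg.
      rewrite -fa; last exact: inr.
      have -> : pt (sg r) 0 = phi (pt r 0 + a).
        apply: cxyP; rewrite !cE //; apply/esym/phiy; first exact: sqr.
        by rewrite ea cE.
      by rewrite phik ?ea //; have := sqr r rr; rewrite ea.
  have gdec r r' : 0 <= r < rho -> 0 <= r' < rho -> r < r' -> sg r' < sg r -> g r + 1 <= g r'.
    move=> hr hr' rr' sgr.
    have h1 : f (r + s) < f (r' + s) by apply: fm; [exact: inr|exact: inr|lra].
    have h2 : f0 (sg r') < f0 (sg r) by apply: f0m => //; exact: insg.
    have : g r < g r' by rewrite /g; lra.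
    have [m ->] := gint r hr; have [m' ->] := gint r' hr'.
    exact: ltr_int_add1.
  have r00 : (0 : R) <= 0 < rho by rewrite lexx rho0.
  have gn (n : nat) r : 0 < r < rho -> n%:R <= g r - g 0.
    elim: n r => [|n IH] r /andP[r0 rr].
      have : g 0 + 1 <= g r.
        apply: gdec => //; first by rewrite ltW.
        have /andP[_] := sgP r ltac:(by rewrite ltW); nra.
      by rewrite mulr0n; lra.
    (* [sgP] pins the slope only between 1/2 and 3/2 of [M 0 0]; that [sg] decreases from [r / 4] to
       [r] follows from 3/2 times 1/4 being less than 1/2, which fails for [r / 2]. *)
    have hr4 : 0 < r / 4 < rho by apply/andP; split; lra.
    have h0 := IH _ hr4; rewrite -natr1 -lerBrDr.
    have h1 : g (r / 4) + 1 <= g r.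
      apply: gdec; [by case/andP: hr4 => /ltW -> ->|by rewrite ltW|lra|].
      have /andP[_] := sgP r ltac:(by rewrite ltW).
      have /andP[] := sgP (r / 4) ltac:(by case/andP: hr4 => /ltW -> ->).
      nra.
    by apply: le_trans h0 _; rewrite lerBrDr addrAC lerD2r.
  have hr : 0 < rho / 2 < rho by apply/andP; split; lra.
  have := gn (Num.bound (g (rho / 2) - g 0)) _ hr.
  have := archi_boundP (le_trans (ler0n _ 0) (gn 0%N _ hr)).
  by move=> h1 h2; have := lt_le_trans h1 h2; rewrite ltxx.
have M11 : 0 < M 1 1 by rewrite detE pmulr_rgt0 in detM.
have [|rho [rho0 hrho]] := MP (M 1 1 / 2); first by lra.
have dir r : `|r| < rho -> square 0 eta (pt 0 r + a) /\
    `|cy (phi (pt 0 r + a)) - r * M 1 1| <= M 1 1 / 2 * `|r|.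
  move=> rr; have [|sv hv] := hrho (pt 0 r); first by apply: sqv; rewrite ?normr0.
  split=> //; have := le_trans (cy_le_norm _) hv.
  rewrite !cE cy_mulmx !cE cya mul0r add0r subr0 => h; apply: le_trans h _.
  by apply: ler_wpM2l; [lra|exact: normy].
(* Off the axis the sign of [cy (phi z)] is locally constant, hence constant on each half of the
   square; [dir] gives it at one point above and one point below [a]. *)
have near_sign (h : R -> Prop) : (h = (fun t => 0 < t) \/ h = (fun t => t < 0)) ->
   forall z, square 0 eta z -> h (cy (phi z)) -> nbhs z [set y | h (cy (phi y))].
  move=> hh z sz hz; apply: (phic z sz [set y | h (cy y)]).
  apply: open_nbhs_nbhs; split=> //.
  by case: hh => ->; [exact: open_cygt|exact: open_cylt].
have up z : square 0 eta z -> 0 < cy z -> 0 < cy (phi z).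
  move=> sz zy.
  have [|s1 d1] := dir (rho / 2); first by rewrite gtr0_norm; lra.
  apply: (@connected_ind _ (square 0 eta `&` [set z | 0 < cy z]) (fun z => 0 < cy (phi z))
    (pt 0 (rho / 2) + a)).
  - by apply: cvx_connected; apply: cvxI; [exact: cvx_square|exact: cvx_cygt].
  - by split=> //=; rewrite /a !cE; lra.
  - move: d1; rewrite ler_norml gtr0_norm; last by lra.
    by move=> /andP[h1 _]; nra.
  - move=> p [sp /= py].
    have [lt0|gt0] := ltP (cy (phi p)) 0.
      exists [set y | cy (phi y) < 0]; split.
        by apply: (near_sign (fun t => t < 0)) => //; right.
      by move=> u v /= u1 v1 _ _ u2; have := lt_trans u1 u2; rewrite ltxx.
    have {}gt0 : 0 < cy (phi p).
      rewrite lt_def gt0 andbT; apply/eqP => /(phiy p sp) e.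
      by rewrite e ltxx in py.
    exists [set y | 0 < cy (phi y)]; split=> //.
    by apply: (near_sign (fun t => 0 < t)) => //; left.
  - by split.
have down z : square 0 eta z -> cy z < 0 -> cy (phi z) < 0.
  move=> sz zy.
  have [|s1 d1] := dir (- rho / 2); first by rewrite ltr0_norm; lra.
  apply: (@connected_ind _ (square 0 eta `&` [set z | cy z < 0]) (fun z => cy (phi z) < 0)
    (pt 0 (- rho / 2) + a)).
  - by apply: cvx_connected; apply: cvxI; [exact: cvx_square|exact: cvx_cylt].
  - by split=> //=; rewrite /a !cE; lra.
  - move: d1; rewrite ler_norml ltr0_norm; last by lra.
    by move=> /andP[_ h1]; nra.
  - move=> p [sp /= py].
    have [gt0|lt0] := ltP 0 (cy (phi p)).
      exists [set y | 0 < cy (phi y)]; split.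
        by apply: (near_sign (fun t => 0 < t)) => //; left.
      by move=> u v /= u1 v1 _ _ u2; have := lt_trans u1 u2; rewrite ltxx.
    have {}lt0 : cy (phi p) < 0.
      rewrite lt_def lt0 andbT eq_sym; apply/eqP => /(phiy p sp) e.
      by rewrite e ltxx in py.
    exists [set y | cy (phi y) < 0]; split=> //.
    by apply: (near_sign (fun t => t < 0)) => //; right.
  - by split.
exists (k @` square 0 eta); split.
  by rewrite -kq; apply: emb_nbhs => //; [exact: nbhs_square|exact: box0].
move=> z z0 bz bz0 [y sy ey] ez.
have e : y = z by apply: (emb_inj kE) => //; exact: etab.
subst y.
have e : phi z = z0 by apply: (emb_inj k0E) => //; [exact: phib|rewrite phik].
by rewrite -e; split; [exact: up|exact: down].
Qed.

End Sides.

(** * Flat sections *)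

Section Support.
Variables (R : realType) (B : topologicalType) (L : Type).
Variables (A : set ('rV[R]_2 -> B)) (G : graph R B L).
Hypotheses (hB : hausdorff_space B) (hA : oriented_atlas A) (fG : finite_graph A G).

Lemma vertices_finite : finite_set (vertices G).
Proof. by case: fG => fw fb _ _ _; rewrite finite_setU. Qed.

Lemma support_closed : closed (graph_support G).
Proof.
pose F (i : 'I_(nedges G)) : set B := edge_arc i @` `[0, 1]%classic.
have -> : graph_support G = vertices G `|` \bigcup_(i in setT) F i.
  rewrite eqEsubset; split=> p [Vp|[i _ [s ds <-]]]; [by left| |by left|].
    right; exists i => //; move: ds; rewrite /edge_dom; case: ifP => [hi _|hi s01].
      case: (fG) => _ _ _ _ [_ hoops _ _ _]; have [_ per] := hoops i hi.
      (* A hoop is parametrized by the whole line; one period already covers it, and is compact. *)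
      exists (s - (Num.floor s)%:~R) => /=.
        by rewrite in_itv /=; have := @floor_itv _ s; rewrite intrD => ?; apply/andP; split; lra.
      apply/per; exists (- Num.floor s); rewrite intrN; ring.
    by exists s => //; apply: subset_itv_oo_cc.
  case hi : (hoop i).
    by right; exists i => //; exists s => //; rewrite /edge_dom hi.
  have [_ v0 v1 _] : [/\ {within `[0, 1], continuous (edge_arc i)},
      vertices G (edge_arc i 0), vertices G (edge_arc i 1) &
      {in `]0, 1[ &, injective (edge_arc i)}].
    by case: fG => _ _ _ _ [h _ _ _ _]; apply: h; rewrite hi.
  move: ds; rewrite /= in_itv /= => /andP[].
  rewrite le_eqVlt => /orP[/eqP<- _|s0]; first by left.
  rewrite le_eqVlt => /orP[/eqP->|s1]; first by left.
  by right; exists i => //; exists s => //; rewrite /edge_dom hi /= in_itv /= s0.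
apply: closedU.
  by apply: (accessible_finite_set_closed.1 (hausdorff_accessible hB)); exact: vertices_finite.
apply: closed_bigcup => [|i _]; first exact: finite_finset.
apply: compact_closed => //.
apply: continuous_compact; last exact: segment_compact.
case hi : (hoop i).
  case: (fG) => _ _ _ _ [_ hoops _ _ _]; have [ci _] := hoops i hi.
  exact: continuous_subspaceT.
by case: fG => _ _ _ _ [/(_ i)]; rewrite hi => /(_ isT)[].
Qed.

Lemma edge_at_exists p : graph_support G p -> ~ vertices G p ->
  exists x k, edge_at A G p x k.
Proof. by case: fG => _ _ _ _ [_ _ _ h _] [//|/h]. Qed.

Lemma edge_at_not_vertex p x k : edge_at A G p x k -> ~ vertices G p.
Proof. by move=> E; case: (E) => _ nv _ _; rewrite -(edge_at_center E); exact/nv/box0. Qed.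

(** At a point of an edge one leaves the graph vertically. The cone at a vertex may contain the
    vertical direction, so there one only moves to a point that is no vertex and reduces to the
    former case. *)
Lemma support_dense (p : B) (N : set B) : nbhs p N -> exists q, N q /\ ~ graph_support G q.
Proof.
have edge_case q x k M : edge_at A G q x k -> nbhs q M -> exists q, M q /\ ~ graph_support G q.
  move=> E Mq; have kE := edge_at_emb E.
  have : nbhs (0 : 'rV[R]_2) (box `&` k @^-1` M).
    apply: nbhs_setI; first by apply: open_nbhs_nbhs; split; [exact: open_box|exact: box0].
    by apply: (emb_cvg kE (@box0 R)); rewrite /= (edge_at_center E).
  move=> /nbhs_squareP[e e0 sub]; have [|bz Mz] := sub (pt 0 (e / 2)).
    by rewrite /square /= !cE !subr0 normr0 gtr0_norm; lra.
  exists (k (pt 0 (e / 2))); split=> // /(edge_at_support E bz).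
  by rewrite cE; lra.
have nv_case q M : ~ vertices G q -> nbhs q M -> exists q, M q /\ ~ graph_support G q.
  move=> nv Mq; have [sq|nsq] := pselect (graph_support G q).
    by have [x [k E]] := edge_at_exists sq nv; exact: edge_case E Mq.
  by exists q; split=> //; exact: nbhs_singleton.
move=> Np; have [vp|nv] := pselect (vertices G p); last exact: nv_case nv Np.
case: (fG) => _ _ _ _ [_ _ _ _ st]; have [k [[k0 kE _] _ kv _]] := st p vp.
have : nbhs (0 : 'rV[R]_2) (box `&` k @^-1` N^°).
  apply: nbhs_setI; first by apply: open_nbhs_nbhs; split; [exact: open_box|exact: box0].
  by apply: (emb_cvg kE (@box0 R)); rewrite /= k0; exact: nbhs_interior.
move=> /nbhs_squareP[e e0 sub]; have [|bz Mz] := sub (pt 0 (e / 2)).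
  by rewrite /square /= !cE !subr0 normr0 gtr0_norm; lra.
apply: (nv_case _ N _ Mz) => vz; have := kv _ bz vz.
by move=> /(congr1 (@cy R)); rewrite !cE; lra.
Qed.

End Support.

Section Flat.
Variables (R : realType) (B : topologicalType) (L : Type).
Variables (A : set ('rV[R]_2 -> B)) (G : graph R B L).
Variables (Y : Type) (act : Y -> L * bool -> Y).

(** The value is [a] on the left of the edge and [act a (x, false)] on its right, in accordance with
    [crosses], where passing from left to right reads [(x, false)]. Values on the graph itself are
    unconstrained, and nothing is flat at a vertex. *)
Definition flat (p : B) (f : B -> Y) : Prop :=
  [/\ ~ vertices G p,
      ~ graph_support G p ->
        exists a, \forall q \near p, ~ graph_support G q -> f q = a &
      forall x k, edge_at A G p x k -> exists a, \forall q \near p,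
        forall z, box z -> k z = q ->
          (0 < cy z -> f q = a) /\ (cy z < 0 -> f q = act a (x, false))].

Hypotheses (hB : hausdorff_space B) (hA : oriented_atlas A) (fG : finite_graph A G).
Hypothesis actK : forall y l, act (act y l) (l.1, ~~ l.2) = y.

Let Om := ~` graph_support G.

Lemma flat_local_system : local_system Om flat.
Proof.
split.
- move=> p f f' [nv fl fe] near_eq; split=> //.
    move=> np; have [a ha] := fl np; exists a.
    by apply: filterS2 near_eq ha => q h1 h2 nq; rewrite -h1 //; exact: h2.
  move=> x k E; have [a ha] := fe x k E; exists a.
  apply: filterS2 near_eq ha => q h1 h2 z bz ez.
  have [h3 h4] := h2 z bz ez.
  have nq : cy z <> 0 -> Om q by move=> cz; rewrite -ez => /(edge_at_support E bz).
  split=> cz; rewrite -h1.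
  + exact: h3.
  + by apply: nq => e; rewrite e ltxx in cz.
  + exact: h4.
  + by apply: nq => e; rewrite e ltxx in cz.
- move=> p f f' [nv fl fe] [_ fl' fe'].
  have [sp|np] := pselect (graph_support G p); last first.
    have [a ha] := fl np; have [a' ha'] := fl' np.
    exists ([set q | Om q -> f q = a] `&` [set q | Om q -> f' q = a']); split.
      exact: nbhs_setI.
    by move=> z [h1 h2] Oz; rewrite h1 ?h2 // => e q [h3 h4] Oq; rewrite h3 ?h4.
  have [x [k E]] := edge_at_exists fG sp nv.
  have [a ha] := fe x k E; have [a' ha'] := fe' x k E.
  have kE := edge_at_emb E.
  have nk : nbhs p (k @` box).
    rewrite -(edge_at_center E); apply: emb_nbhs => //; last exact: box0.
    by apply: open_nbhs_nbhs; split; [exact: open_box|exact: box0].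
  exists (k @` box `&` ([set q | forall z, box z -> k z = q ->
          (0 < cy z -> f q = a) /\ (cy z < 0 -> f q = act a (x, false))] `&`
     [set q | forall z, box z -> k z = q ->
          (0 < cy z -> f' q = a') /\ (cy z < 0 -> f' q = act a' (x, false))])).
  split; first by do 2 apply: nbhs_setI => //.
  move=> _ [[z bz <-] [h1 h2]] Oz e.
  have act_inj y y' l : act y l = act y' l -> y = y'.
    by move=> e'; rewrite -(actK y l) e' actK.
  have ea : a = a'.
    have [h1p h1n] := h1 z bz erefl; have [h2p h2n] := h2 z bz erefl.
    have [cz|cz|cz] := ltgtP (cy z) 0.
    - by apply: (@act_inj _ _ (x, false)); rewrite -h1n // -h2n.
    - by rewrite -h1p // -h2p.
    - by exfalso; apply: Oz; apply/(edge_at_support E bz).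
  subst a'; move=> _ [[y by_ <-] [h3 h4]] Oy.
  have [h1p h1n] := h3 y by_ erefl; have [h2p h2n] := h4 y by_ erefl.
  have [cz|cz|cz] := ltgtP (cy y) 0.
  - by rewrite h1n // h2n.
  - by rewrite h1p // h2p.
  - by exfalso; apply: Oy; apply/(edge_at_support E by_).
- exact: (support_dense fG).
Qed.

(** Near an edge, one coordinate system [k0] prescribes the two constants. Flatness has to hold in
    every other edge coordinate system too: there the label is the same by [edge_arc_same] and the
    sides are the same by [side_consistent]. *)
Lemma flat_extendable p : ~ vertices G p ->
  exists N, nbhs p N /\ extendable Om flat N.
Proof.
move=> nv; have [sp|np] := pselect (graph_support G p); last first.
  exists Om; split.
    by apply: open_nbhs_nbhs; split=> //; apply: closed_openC; exact: support_closed hB fG.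
  move=> q y _ _; exists (fun=> y); split=> // z Oz; split.
  - by move=> vz; apply: Oz; left.
  - by exists y; exact: filterE.
  - move=> x k E; exfalso; apply: Oz; rewrite -(edge_at_center E).
    by apply/(edge_at_support E (@box0 R)); rewrite cE.
have [x0 [k0 E0]] := edge_at_exists fG sp nv.
have kE := edge_at_emb E0.
exists (k0 @` box); split.
  rewrite -(edge_at_center E0); apply: emb_nbhs => //; last exact: box0.
  by apply: open_nbhs_nbhs; split; [exact: open_box|exact: box0].
move=> _ y [zq bzq <-] Oq.
have czq : cy zq <> 0 by move/(edge_at_support E0 bzq).
(* The left value: if the prescribed value [y] sits on the right side, the letter is undone. *)
pose a := if 0 < cy zq then y else act y (x0, true).
pose f q := if pselect (exists z, [/\ box z, k0 z = q & 0 < cy z]) then a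
  else act a (x0, false).
have fp z : box z -> 0 < cy z -> f (k0 z) = a.
  by move=> bz cz; rewrite /f; case: pselect => // -[]; exists z.
have fn z : box z -> cy z <= 0 -> f (k0 z) = act a (x0, false).
  move=> bz cz; rewrite /f; case: pselect => // h; exfalso.
  by case: h => z' [bz' /(emb_inj kE bz' bz) ->]; rewrite ltNge cz.
exists f; split; last first.
  have [cz|cz|cz] := ltgtP (cy zq) 0.
  - by rewrite fn ?ltW // /a ltNge ltW //=; have := actK y (x0, true).
  - by rewrite fp // /a cz.
  - by [].
move=> _ [z bz <-]; split.
- by case: E0 => _ h _ _; exact: h.
- move=> nz; have cz : cy z <> 0 by move/(edge_at_support E0 bz).
  have [lt|gt|//] := ltgtP (cy z) 0.
    exists (act a (x0, false)).
    have : nbhs z (box `&` [set y | cy y < 0]).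
      apply: nbhs_setI; apply: open_nbhs_nbhs; split=> //; [exact: open_box|exact: open_cylt].
    move=> /(emb_nbhs kE) /(_ bz); apply: filterS => _ [u [bu cu] <-] _.
    by apply: fn => //; exact: ltW.
  exists a.
  have : nbhs z (box `&` [set y | 0 < cy y]).
    apply: nbhs_setI; apply: open_nbhs_nbhs; split=> //; [exact: open_box|exact: open_cygt].
  by move=> /(emb_nbhs kE) /(_ bz); apply: filterS => _ [u [bu cu] <-] _; apply: fp.
- move=> x k E; exists a.
  have ex : x = x0.
    apply: (edge_arc_same fG E0 E (z := 0) (z0 := z)) => //; first exact: box0.
      by rewrite cE.
    exact: edge_at_center E.
  subst x.
  have [N [Nz NP]] := side_consistent hA fG E0 E bz erefl.
  have nk : nbhs (k0 z) (k0 @` box).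
    by apply: emb_nbhs => //; apply: open_nbhs_nbhs; split=> //; exact: open_box.
  apply: filterS2 Nz nk => q Nq [u bu eu] w bw ew.
  have [h1 h2] := NP w u bw bu ltac:(by rewrite ew) ltac:(by rewrite ew).
  by rewrite -eu; split=> [/h1|/h2] cu; [apply: fp|apply: fn => //; exact: ltW].
Qed.

End Flat.

Section WordAction.
Variables (L Y : Type) (act : Y -> L * bool -> Y).
Hypothesis actK : forall y l, act (act y l) (l.1, ~~ l.2) = y.

Lemma word_inv_rcons (w : word L) l : word_inv (rcons w l) = (l.1, ~~ l.2) :: word_inv w.
Proof. by rewrite /word_inv map_rcons rev_rcons. Qed.

Lemma word_inv_cons (w : word L) l : word_inv (l :: w) = rcons (word_inv w) (l.1, ~~ l.2).
Proof. by rewrite /word_inv /= rev_cons. Qed.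

Lemma foldl_word_inv y w : foldl act (foldl act y w) (word_inv w) = y.
Proof.
elim/last_ind: w y => [//|w l IH] y.
by rewrite word_inv_rcons foldl_rcons /= actK IH.
Qed.

Lemma actVK y l : act (act y (l.1, ~~ l.2)) l = y.
Proof. by rewrite -[RHS](actK y (l.1, ~~ l.2)) /= negbK; case: l. Qed.

Lemma foldl_word_invK y w : foldl act (foldl act y (word_inv w)) w = y.
Proof.
elim: w y => [//|l w IH] y.
by rewrite word_inv_cons foldl_rcons /= actVK IH.
Qed.

End WordAction.

(** * Transport of sections along a path *)

Section Walk.
Variables (R : realType) (B : topologicalType) (L : Type).
Variables (A : set ('rV[R]_2 -> B)) (G : graph R B L).
Variables (Y : Type) (act : Y -> L * bool -> Y).
Hypothesis actK : forall y l, act (act y l) (l.1, ~~ l.2) = y.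

Lemma flat_equivariant (Y' : Type) (act' : Y' -> L * bool -> Y') (m : Y -> Y') p f :
  (forall y l, m (act y l) = act' (m y) l) ->
  flat A G act p f -> flat A G act' p (m \o f).
Proof.
move=> mE [nv fl fe]; split=> //.
  by move=> /fl[a ha]; exists (m a); apply: filterS ha => q h nq /=; rewrite h.
move=> x k /fe[a ha]; exists (m a); apply: filterS ha => q h z bz ez /=.
by have [h1 h2] := h z bz ez; split=> [/h1|/h2] ->.
Qed.

Lemma avoid_seq (ts : seq R) (a b : R) : a < b -> exists t, [/\ a < t, t < b & t \notin ts].
Proof.
elim: ts a b => [|s ts IH] a b ab.
  by exists ((a + b) / 2); split=> //; lra.
have [sab|sab] := boolP (a < s < b).
  have /andP[as_ sb] := sab; have [t [ta tb nt]] := IH a s as_.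
  by exists t; split=> //; [lra|rewrite inE negb_or nt lt_eqF].
have [t [ta tb nt]] := IH a b ab; exists t; split=> //.
rewrite inE negb_or nt andbT; apply: contra sab => /eqP <-.
by rewrite ta.
Qed.

Lemma near_count (ts : seq R) (t0 : R) : t0 \notin ts ->
  \forall t \near t0, count (fun s => s < t) ts = count (fun s => s < t0) ts.
Proof.
elim: ts => [|s ts IH] /=; first by move=> _; exact: filterE.
rewrite inE negb_or => /andP[ts0 /IH]; apply: filterS2.
  by move=> t h ->; congr ((_ : bool) + _)%N; exact: h.
have [lt|gt|e] := ltgtP s t0; last by rewrite e eqxx in ts0.
- have : nbhs t0 [set t | s < t] by apply: open_nbhs_nbhs; split=> //; exact: open_gt.
  by apply: filterS => t /= ->.
- have : nbhs t0 [set t | t < s] by apply: open_nbhs_nbhs; split=> //; exact: open_lt.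
  by apply: filterS => t /= h; apply/negbTE; rewrite -leNgt ltW.
Qed.

Lemma within_near (p : R -> B) (t0 : R) (N : set B) :
  {within `[0, 1], continuous p} -> t0 \in `[0, 1] -> nbhs (p t0) N ->
  \forall t \near t0, t \in `[0, 1] -> N (p t).
Proof.
move=> /subspace_continuousP cp t01 Np.
exact: (cp t0 t01 N Np).
Qed.

(** Undoing on [F t] the letters read before time [t] gives a quantity [Phi t] that is locally
    constant off the crossing times: at a crossing, the letter picked up by [F] is the one gained by
    the prefix. [F] only has to agree locally with some flat section, which may vary with time; this
    leaves room for sections that jump. *)
Lemma walk (p : R -> B) ts w (F : R -> Y) :
  reads_at A G p ts w ->
  (forall t0 : R, t0 \in `[0, 1] -> exists g, flat A G act (p t0) g /\
     \forall t \near t0, t \in `[0, 1] -> ~ graph_support G (p t) -> F t = g (p t)) ->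
  F 1 = foldl act (F 0) w.
Proof.
move=> [cp [szw srt] tsin tsP cross] FP.
pose m t := count (fun s => s < t) ts.
pose Phi t := foldl act (F t) (word_inv (take (m t) w)).
have in0 : (0 : R) \in `[0, 1] by rewrite in_itv /= lexx ler01.
have in1 : (1 : R) \in `[0, 1] by rewrite in_itv /= lexx ler01.
have claim (t0 : R) : t0 \in `[0, 1] ->
    exists c, \forall t \near t0, t \in `[0, 1] -> t \notin ts -> Phi t = c.
  move=> t01; have [g [fg gF]] := FP t0 t01.
  have nsupp (t : R) : t \in `[0, 1] -> t \notin ts -> ~ graph_support G (p t).
    by move=> ti nt /(tsP t ti); rewrite (negbTE nt).
  have [tin|tnin] := boolP (t0 \in ts); last first.
    case: fg => _ /(_ (nsupp _ t01 tnin))[a ha] _.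
    exists (foldl act a (word_inv (take (m t0) w))).
    have h1 := within_near cp t01 ha.
    apply: filterS3 h1 gF (near_count tnin) => t h2 h3 h4 ti nt.
    by rewrite /Phi /m h4 h3 ?h2 //; apply: nsupp.
  pose j := index t0 ts.
  have jts : (j < size ts)%N by rewrite index_mem.
  have jw : (j < size w)%N by rewrite -szw.
  have [l0 _] : exists l0 : L * bool, True by case: (w) jw => // l0 _ _; exists l0.
  have := cross j 0 l0 jw; rewrite nth_index // => -[k [E sides]].
  set l := nth l0 w j in E sides.
  case: fg => _ _ /(_ _ _ E)[a ha].
  (* The value just before the crossing; [a] itself is the value on the left of the edge, which
     comes after the crossing when [l.2] holds. *)
  pose v := if l.2 then act a (l.1, false) else a.
  have vl : act v l = if l.2 then a else act a (l.1, false).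
    rewrite /v; case: (l) => x [] //=; exact: (actK a (x, false)).
  exists (foldl act v (word_inv (take j w))).
  have uts : uniq ts by apply: (sorted_uniq lt_trans) srt => x; exact: ltxx.
  have mt0 : count (fun s => s < t0) ts = j.
    by rewrite -{1}(nth_index 0 tin) count_lt_nth.
  have nrem : t0 \notin rem t0 ts by rewrite mem_rem_uniq // !inE eqxx.
  have cE (t : R) : m t = ((t0 < t)%R + count (fun s => (s < t)%R) (rem t0 ts))%N.
    by rewrite /m (permP (perm_to_rem tin)).
  have h1 := within_near cp t01 ha.
  have := nbhs_setI (nbhs_setI h1 gF) (nbhs_setI (near_count nrem) sides).
  apply: filterS => t [[h1t gFt] [cnt [s1 s2]]] ti nt.
  have h2 : forall z, box z -> k z = p t ->
     (0 < cy z -> g (p t) = a) /\ (cy z < 0 -> g (p t) = act a (l.1, false)).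
    exact: h1t.
  have h3 : F t = g (p t) by apply: gFt => //; apply: nsupp.
  have h4 : m t = (j + (t0 < t)%R)%N.
    rewrite cE cnt addnC; congr (_ + _)%N.
    by rewrite -mt0 (permP (perm_to_rem tin)) /= ltxx.
  have [tt|tt|e] := ltgtP t t0; last by rewrite e tin in nt.
  - have [z [bz sz ez]] := s1 tt; have [hp hn] := h2 z bz ez.
    rewrite /Phi h4 ltNge ltW //= addn0 h3; congr (foldl _ _ _).
    by rewrite /v; case: (l.2) sz => [/hn|/hp].
  - have [z [bz sz ez]] := s2 tt; have [hp hn] := h2 z bz ez.
    rewrite /Phi h4 tt addn1 (take_nth l0 jw) word_inv_rcons /= h3 -/l.
    congr (foldl _ _ _); rewrite -[RHS](actK v l) vl.
    by congr (act _ _); case: (l.2) sz => [/hp|/hn].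
(* As [Phi] is uncontrolled at the crossing times, the induction runs on its values near a time; a
   nearby time outside [ts] links two neighborhoods. *)
have key : \forall t \near (1 : R), t \in `[0, 1] -> t \notin ts -> Phi t = Phi 0.
  apply: (@connected_ind R `[0, 1]%classic (fun t0 : R =>
    \forall t \near t0, t \in `[0, 1] -> t \notin ts -> Phi t = Phi 0) 0) => //.
  - exact: segment_connected.
  - have [c hc] := claim 0 in0; have e : Phi 0 = c.
      apply: (nbhs_singleton hc) => //; apply/negP => /tsin.
      by rewrite in_itv /= ltxx.
    by rewrite e.
  - move=> t0 /claim[c hc].
    exists [set t | t \in `[0, 1] -> t \notin ts -> Phi t = c]^°; split.
      exact: nbhs_interior.
    move=> x y Nx Ny xi yi Qx; suff -> : Phi 0 = c by exact: Ny.
    have := nbhs_setI Nx Qx => /nbhs_ballP[e /= e0 sub].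
    have [t [tb tin tnin]] : exists t : R, [/\ ball x e t, t \in `[0, 1] & t \notin ts].
      move: xi; rewrite /= in_itv /= => /andP[x0 x1].
      have [x1'|x1'] := ltP x 1.
        have [|t [xt tm nt]] := @avoid_seq ts x (Num.min (x + e) 1).
          by rewrite lt_min x1' andbT; lra.
        move: tm; rewrite lt_min => /andP[te t1]; exists t; split=> //.
          by rewrite /ball /= ltr_norml; apply/andP; split; lra.
        by rewrite in_itv /=; apply/andP; split; lra.
      have [|t [mt tx nt]] := @avoid_seq ts (Num.max (x - e) 0) x.
        by rewrite gt_max; apply/andP; split; lra.
      move: mt; rewrite gt_max => /andP[te t1]; exists t; split=> //.
        by rewrite /ball /= ltr_norml; apply/andP; split; lra.
      by rewrite in_itv /=; apply/andP; split; lra.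
    by have [h1 h2] := sub t tb; rewrite -h1 // -h2.
have e1 := nbhs_singleton key in1.
have nin1 : 1 \notin ts by apply/negP => /tsin; rewrite in_itv /= ltxx andbF.
have := e1 nin1; rewrite /Phi.
have -> : m 0 = 0%N.
  apply/eqP; rewrite -leqn0 leqNgt -has_count; apply/hasPn => s /tsin.
  by rewrite in_itv /= => /andP[s0 _]; rewrite -leNgt ltW.
have -> : m 1 = size w.
  rewrite -szw; apply/eqP; rewrite -all_count; apply/allP => s /tsin.
  by rewrite in_itv /= => /andP[].
by rewrite take0 take_size /= => <-; rewrite foldl_word_invK.
Qed.

End Walk.

(** * Monodromy around a vertex *)

Section SlitSquare.
Variable R : realType.
Implicit Types (c z : 'rV[R]_2) (d : R).

(** The punctured square is covered by the square slit along the ray going left from [c] and by its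
    left half, which bridges the slit. The two simply connected pieces overlap in [upper_left] and
    [lower_left]; sections matched on the first overlap exhibit the monodromy on the second. *)
Definition slit_square c d : set 'rV[R]_2 :=
  square c d `&` [set z | cy z != cy c \/ cx c < cx z].
Definition left_half c d : set 'rV[R]_2 := square c d `&` [set z | cx z < cx c].
Definition upper_left c d : set 'rV[R]_2 := left_half c d `&` [set z | cy c < cy z].
Definition lower_left c d : set 'rV[R]_2 := left_half c d `&` [set z | cy z < cy c].

Lemma open_slit_square c d : open (slit_square c d).
Proof.
have -> : slit_square c d = square c d `&`
    ([set z | cy z < cy c] `|` [set z | cy c < cy z] `|` [set z | cx c < cx z]).
  rewrite eqEsubset; split=> z [sz /= h]; split=> //=.
    by case: h => [|h]; [rewrite neq_lt => /orP[] ?; left; [left|right]|right].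
  by case: h => [[h|h]|h]; [left; rewrite lt_eqF|left; rewrite gt_eqF|right].
apply: openI; first exact: open_square.
by apply: openU; [apply: openU; [exact: open_cylt|exact: open_cygt]|exact: open_cxgt].
Qed.

Lemma open_left_half c d : open (left_half c d).
Proof. by apply: openI; [exact: open_square|exact: open_cxlt]. Qed.
Lemma open_upper_left c d : open (upper_left c d).
Proof. by apply: openI; [exact: open_left_half|exact: open_cygt]. Qed.
Lemma open_lower_left c d : open (lower_left c d).
Proof. by apply: openI; [exact: open_left_half|exact: open_cylt]. Qed.

Lemma cvx_left_half c d : cvx (left_half c d).
Proof. by apply: cvxI; [exact: cvx_square|exact: cvx_cxlt]. Qed.
Lemma cvx_upper_left c d : cvx (upper_left c d).
Proof. by apply: cvxI; [exact: cvx_left_half|exact: cvx_cygt]. Qed.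
Lemma cvx_lower_left c d : cvx (lower_left c d).
Proof. by apply: cvxI; [exact: cvx_left_half|exact: cvx_cylt]. Qed.

Lemma starshaped_slit_square c d : 0 < d ->
  slit_square c d (c + pt (d / 2) 0) /\
  starshaped (c + pt (d / 2) 0) (slit_square c d).
Proof.
move=> d0; have sa : square c d (c + pt (d / 2) 0).
  rewrite /square /= !cE addrAC subrr add0r addr0 subrr normr0 gtr0_norm //; lra.
split; first by split=> //=; right; rewrite !cE; lra.
move=> z s [sz hz] s01; split; first exact: cvx_square.
move: hz; rewrite /= !cE => hz.
have [->|s0] := eqVneq s 0; first by right; lra.
have {}s0 : 0 < s by rewrite lt_def s0; case/andP: s01.
have [e|ne] := eqVneq (cy z) (cy c); last first.
  left; apply: contra ne => /eqP h; apply/eqP.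
  have : s * (cy z - cy c) = 0 by lra.
  by move/eqP; rewrite mulf_eq0 gt_eqF //= subr_eq0 => /eqP.
right; case: hz => [|hz]; first by rewrite e eqxx.
have /andP[_ s1] := s01; have : 0 < s * (cx z - cx c) by apply: mulr_gt0 => //; lra.
have : 0 <= (1 - s) * d by apply: mulr_ge0; lra.
by nra.
Qed.

Lemma slit_or_left c d z : square c d z -> z != c ->
  slit_square c d z \/ (left_half c d z /\ cy z = cy c).
Proof.
move=> sz zc; have [e|ne] := eqVneq (cy z) (cy c); last by left; split=> //; left.
have [lt|gt|e'] := ltgtP (cx z) (cx c).
- by right.
- by left; split=> //; right.
- by case/eqP: zc; exact: cxyP.
Qed.

Lemma slit_square_neq c d z : slit_square c d z -> z != c.
Proof. by move=> [_ /= h]; apply/eqP => e; move: h; rewrite e eqxx ltxx => -[]. Qed.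

Lemma left_half_neq c d z : left_half c d z -> z != c.
Proof. by move=> [_ /= h]; apply/eqP => e; move: h; rewrite e ltxx. Qed.

Lemma punctured_squareE c d : square c d `\ c = slit_square c d `|` left_half c d.
Proof.
rewrite eqEsubset; split=> z.
  by move=> [sz /eqP zc]; case: (slit_or_left sz zc) => [|[]]; [left|right].
move=> [h|h]; split.
- by case: h.
- by apply/eqP; exact: slit_square_neq h.
- by case: h.
- by apply/eqP; exact: left_half_neq h.
Qed.

Lemma slit_leftE c d : slit_square c d `&` left_half c d = upper_left c d `|` lower_left c d.
Proof.
rewrite eqEsubset; split=> z.
  move=> [[_ /= h] [sz /= lz]]; case: h => [|h]; last by have := lt_trans h lz; rewrite ltxx.
  by rewrite neq_lt => /orP[] ?; [right|left].
by move=> [[[sz lz] /= h]|[[sz lz] /= h]]; split; split=> //=; left;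
  [rewrite gt_eqF|rewrite lt_eqF].
Qed.

Lemma upper_left_nonempty c d : 0 < d -> upper_left c d (c + pt (- d / 2) (d / 2)).
Proof.
move=> d0; split; last by rewrite /= !cE; lra.
split; last by rewrite /= !cE; lra.
rewrite /square /= !cE ![_ + _ - _]addrAC !subrr !add0r ltr0_norm; last by lra.
by rewrite gtr0_norm; lra.
Qed.

Lemma lower_left_nonempty c d : 0 < d -> lower_left c d (c + pt (- d / 2) (- d / 2)).
Proof.
move=> d0; split; last by rewrite /= !cE; lra.
split; last by rewrite /= !cE; lra.
by rewrite /square /= !cE ![_ + _ - _]addrAC !subrr !add0r ltr0_norm; lra.
Qed.

End SlitSquare.

(** * Sections over the two pieces of a punctured square *)

Section SlitSections.
Variables (R : realType) (B : topologicalType) (k : 'rV[R]_2 -> B).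
Hypothesis kE : open_embedding k.
Variables (c : 'rV[R]_2) (d : R).
Hypotheses (d0 : 0 < d) (sub : square c d `<=` box).
Variables (Y : Type) (Om : set B) (P : B -> (B -> Y) -> Prop).
Hypothesis LS : local_system Om P.

Let SD := slit_square c d.
Let LD := left_half c d.
Let UL := upper_left c d.
Let LL := lower_left c d.

Lemma slit_box : SD `<=` box. Proof. by move=> z [/sub]. Qed.
Lemma left_box : LD `<=` box. Proof. by move=> z [/sub]. Qed.
Lemma ul_slit : UL `<=` SD.
Proof. by move=> z [[sz _] /= h]; split=> //; left; rewrite gt_eqF. Qed.
Lemma ll_slit : LL `<=` SD.
Proof. by move=> z [[sz _] /= h]; split=> //; left; rewrite lt_eqF. Qed.
Lemma ul_left : UL `<=` LD. Proof. by move=> z []. Qed.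
Lemma ll_left : LL `<=` LD. Proof. by move=> z []. Qed.

Lemma slit_connected : connected (k @` SD).
Proof.
apply: emb_connected => //; first exact: slit_box.
by have [h1 h2] := @starshaped_slit_square R c d d0; exact: starshaped_connected h1 h2.
Qed.

Lemma left_connected : connected (k @` LD).
Proof. by apply: emb_connected; [|exact: left_box|apply: cvx_connected; exact: cvx_left_half]. Qed.

Lemma open_slit : open (k @` SD).
Proof. by apply: emb_open; [|exact: open_slit_square|exact: slit_box]. Qed.
Lemma open_left : open (k @` LD).
Proof. by apply: emb_open; [|exact: open_left_half|exact: left_box]. Qed.

Lemma punctured_imageE : k @` (square c d `\ c) = k @` SD `|` k @` LD.
Proof. by rewrite punctured_squareE image_setU. Qed.

Lemma punctured_open : open (k @` (square c d `\ c)).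
Proof. by rewrite punctured_imageE; apply: openU; [exact: open_slit|exact: open_left]. Qed.

Lemma punctured_connected : connected (k @` (square c d `\ c)).
Proof.
rewrite punctured_imageE; apply: connectedU; last exact: left_connected.
  have h := @upper_left_nonempty R c d d0.
  by eexists; split; exists (c + pt (- d / 2) (d / 2)) => //; [exact: ul_slit|exact: ul_left].
exact: slit_connected.
Qed.

Lemma open_meets (C : set 'rV[R]_2) z : open C -> C `<=` box -> C z ->
  exists u, C u /\ Om (k u).
Proof.
move=> oC Cb Cz.
have [_ [[u Cu <-] Ou]] := ls_dense LS (open_nbhs_nbhs
  (conj (emb_open kE oC Cb) (ex_intro2 _ _ z Cz erefl))).
by exists u.
Qed.

Lemma sections_uniq_on (C : set 'rV[R]_2) f f' u : open C -> C `<=` box -> connected (k @` C) ->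
  sections P (k @` C) f -> sections P (k @` C) f' -> C u -> Om (k u) -> f (k u) = f' (k u) ->
  forall z, C z -> Om (k z) -> f (k z) = f' (k z).
Proof.
move=> oC Cb cC sf sf' Cu Ou e z Cz Oz.
apply: (sections_uniq LS (emb_open kE oC Cb) cC sf sf' (z := k u)) => //; by [exists u|exists z].
Qed.

Lemma sections_image_sub (C C' : set 'rV[R]_2) f : C `<=` C' ->
  sections P (k @` C') f -> sections P (k @` C) f.
Proof. by move=> CC sf _ [z /CC Cz <-]; apply: sf; exists z. Qed.

Lemma slit_glue f1 f2 : sections P (k @` SD) f1 -> sections P (k @` LD) f2 ->
  (forall u, UL u -> Om (k u) -> f1 (k u) = f2 (k u)) ->
  (forall u, LL u -> Om (k u) -> f1 (k u) = f2 (k u)) ->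
  exists f, [/\ sections P (k @` (square c d `\ c)) f,
    forall u, SD u -> f (k u) = f1 (k u) &
    forall u, LD u -> Om (k u) -> f (k u) = f2 (k u)].
Proof.
move=> s1 s2 eU eL.
pose f b := if pselect ((k @` SD) b) then f1 b else f2 b.
have fS u : SD u -> f (k u) = f1 (k u).
  by move=> su; rewrite /f; case: pselect => // -[]; exists u.
have fL u : LD u -> Om (k u) -> f (k u) = f2 (k u).
  move=> lu Ou; rewrite /f; case: pselect => // su.
  have su' : SD u by apply/(emb_imageP kE slit_box) => //; exact: left_box.
  have : (SD `&` LD) u by [].
  by rewrite slit_leftE => -[h|h]; [exact: eU|exact: eL].
exists f; split=> //; rewrite punctured_imageE => p [[u su <-]|[u lu <-]].
  apply: (ls_germ LS (s1 (k u) _)); first by exists u.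
  apply: filterS (open_nbhs_nbhs (conj open_slit (ex_intro2 _ _ u su erefl))).
  by move=> _ [z sz <-] _; rewrite fS.
apply: (ls_germ LS (s2 (k u) _)); first by exists u.
apply: filterS (open_nbhs_nbhs (conj open_left (ex_intro2 _ _ u lu erefl))).
by move=> _ [z sz <-] Oz; rewrite fL.
Qed.

Hypothesis loc : forall z, square c d z -> z != c ->
  exists N, nbhs (k z) N /\ extendable Om P N.

Lemma slit_extendable : extendable Om P (k @` SD).
Proof.
have [h1 h2] := @starshaped_slit_square R c d d0.
apply: (extendable_starshaped kE LS slit_box (@open_slit_square R c d) h2) => z sz.
by apply: loc; [case: sz|exact: slit_square_neq sz].
Qed.

Lemma left_extendable : extendable Om P (k @` LD).
Proof.
have lz : LD (c + pt (- d / 2) (d / 2)) by apply: ul_left; exact: upper_left_nonempty.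
apply: (extendable_starshaped kE LS left_box (@open_left_half R c d)
  (a := c + pt (- d / 2) (d / 2))) => [|z sz].
  exact: cvx_left_half lz.
by apply: loc; [case: sz|exact: left_half_neq sz].
Qed.

(** Continuation of a section from [D] to [D'] through a connected part [C] of their overlap; other
    parts of the overlap may disagree. *)
Lemma transfer (C D D' : set 'rV[R]_2) f u : open C -> connected (k @` C) ->
  C `<=` D -> C `<=` D' -> D `<=` box -> C u ->
  sections P (k @` D) f -> extendable Om P (k @` D') ->
  exists f', sections P (k @` D') f' /\ forall z, C z -> Om (k z) -> f' (k z) = f (k z).
Proof.
move=> oC cC CD CD' Db Cu sf ext.
have Cb : C `<=` box by move=> z /CD /Db.
have [w [Cw Ow]] := open_meets oC Cb Cu.
have [|f' [sf' e]] := ext (k w) (f (k w)) _ Ow; first by exists w => //; exact: CD'.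
exists f'; split=> //; apply: (sections_uniq_on oC Cb cC _ _ Cw Ow e).
- exact: sections_image_sub sf'.
- exact: sections_image_sub sf.
Qed.

Lemma ul_connected : connected (k @` UL).
Proof.
by apply: emb_connected; [|move=> z /ul_left /left_box|apply: cvx_connected; exact: cvx_upper_left].
Qed.

Lemma ll_connected : connected (k @` LL).
Proof.
by apply: emb_connected; [|move=> z /ll_left /left_box|apply: cvx_connected; exact: cvx_lower_left].
Qed.

Lemma slit_pair z y : square c d z -> z != c -> Om (k z) ->
  exists f1 f2, [/\ sections P (k @` SD) f1, sections P (k @` LD) f2,
    forall u, UL u -> Om (k u) -> f1 (k u) = f2 (k u) &
    (SD z -> f1 (k z) = y) /\ (~ SD z -> f2 (k z) = y)].
Proof.
move=> sz zc Oz; have hU := @upper_left_nonempty R c d d0.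
have [Sz|nS] := pselect (SD z).
  have [|f1 [s1 e1]] := slit_extendable (q := k z) y _ Oz; first by exists z.
  have [f2 [s2 e2]] := transfer (@open_upper_left R c d) ul_connected ul_slit ul_left
    slit_box hU s1 left_extendable.
  by exists f1, f2; split=> // u uu Ou; rewrite e2.
have lz : LD z by case: (slit_or_left sz zc) => [//|[]].
have [|f2 [s2 e2]] := left_extendable (q := k z) y _ Oz; first by exists z.
have [f1 [s1 e1]] := transfer (@open_upper_left R c d) ul_connected ul_left ul_slit
  left_box hU s2 slit_extendable.
by exists f1, f2; split.
Qed.

(** Completes the tour around [c]: when [f2] continues a section [f1] of the slit square through the
    upper overlap, comparing [f3] with [f1] gives the monodromy. *)
Lemma slit_next f2 : sections P (k @` LD) f2 ->
  exists f3, sections P (k @` SD) f3 /\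
    forall u, LL u -> Om (k u) -> f3 (k u) = f2 (k u).
Proof.
move=> s2; exact: (transfer (@open_lower_left R c d) ll_connected ll_left ll_slit
  left_box (@lower_left_nonempty R c d d0) s2 slit_extendable).
Qed.

End SlitSections.

(** * The boundary circle of the disc *)

Section Circle.
Variable R : realType.

Definition circle_pt (s : R) : 'rV[R]_2 :=
  pt (2^-1 * cos (2 * pi * s)) (2^-1 * sin (2 * pi * s)).

Lemma circleE (B : topologicalType) (k : 'rV[R]_2 -> B) s : circle k s = k (circle_pt s).
Proof. by []. Qed.

Lemma circle_pt_box s : box (circle_pt s).
Proof.
rewrite /box /circle_pt /= !cE !normrM gtr0_norm; last by rewrite invr_gt0.
have h1 : `|cos (2 * pi * s)| <= 1 by rewrite ler_norml cos_geN1 cos_le1.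
have h2 : `|sin (2 * pi * s)| <= 1 by rewrite ler_norml sin_geN1 sin_le1.
by split; lra.
Qed.

Lemma circle_pt_neq0 s : circle_pt s != 0.
Proof.
apply/eqP => e; have hx := congr1 (@cx R) e; have hy := congr1 (@cy R) e.
rewrite /circle_pt !cE in hx hy.
have := @cos2Dsin2 R (2 * pi * s).
have -> : cos (2 * pi * s) = 0 by lra.
have -> : sin (2 * pi * s) = 0 by lra.
by rewrite expr0n /= addr0; lra.
Qed.

Lemma circle_pt_norm s : cx (circle_pt s) ^+ 2 + cy (circle_pt s) ^+ 2 = 2^-1 ^+ 2.
Proof. by rewrite /circle_pt !cE !exprMn -mulrDr cos2Dsin2 mulr1. Qed.

Lemma circle_pt0 : circle_pt 0 = pt 2^-1 0.
Proof. by rewrite /circle_pt mulr0 cos0 sin0 mulr1 mulr0. Qed.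

Lemma circle_pt1 : circle_pt 1 = pt 2^-1 0.
Proof. by rewrite /circle_pt mulr1 mulr_natl cos2pi sin2pi mulr1 mulr0. Qed.

Lemma circle_pt_half : circle_pt 2^-1 = pt (- 2^-1) 0.
Proof.
by rewrite /circle_pt mulrAC divff ?pnatr_eq0 // mul1r cospi sinpi mulrN1 mulr0.
Qed.

Lemma cy_circle_gt0 s : 0 < s < 2^-1 -> 0 < cy (circle_pt s).
Proof.
move=> /andP[s0 s1]; rewrite /circle_pt cE; apply: mulr_gt0; first by rewrite invr_gt0.
by have := @pi_gt0 R => p0; apply: sin_gt0_pi; apply/andP; split; nra.
Qed.

Lemma cy_circle_lt0 s : 2^-1 < s < 1 -> cy (circle_pt s) < 0.
Proof.
move=> /andP[s0 s1]; rewrite /circle_pt cE pmulr_rlt0; last by rewrite invr_gt0.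
have -> : 2 * pi * s = 2 * pi * (s - 2^-1) + pi by field.
rewrite sinDpi oppr_lt0.
by have := @pi_gt0 R => p0; apply: sin_gt0_pi; apply/andP; split; nra.
Qed.

Lemma cx_circle_lt0 s : 4^-1 < s < 3 / 4 -> cx (circle_pt s) < 0.
Proof.
move=> /andP[s0 s1]; rewrite /circle_pt cE pmulr_rlt0; last by rewrite invr_gt0.
have -> : 2 * pi * s = 2 * pi * (s - 2^-1) + pi by field.
rewrite cosDpi oppr_lt0.
by have := @pi_gt0 R => p0; apply: cos_gt0_pihalf; apply/andP; split; nra.
Qed.

Lemma cx_circle_ge0 s : 0 <= s <= 4^-1 \/ 3 / 4 <= s <= 1 -> 0 <= cx (circle_pt s).
Proof.
have p0 := @pi_gt0 R.
rewrite /circle_pt cE => h; apply: mulr_ge0; first by rewrite invr_ge0.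
case: h => /andP[s0 s1].
  by apply: cos_ge0_pihalf; apply/andP; split; nra.
have -> : 2 * pi * s = - (2 * pi * (1 - s)) + pi *+ 2 by rewrite mulr2n; ring.
rewrite cosD cos2pi sin2pi mulr1 mulr0 subr0 cosN.
by apply: cos_ge0_pihalf; apply/andP; split; nra.
Qed.

Lemma circle_slit s : s \in `[0, 1] -> s != 2^-1 -> slit_square 0 1 (circle_pt s).
Proof.
rewrite in_itv /= => /andP[s0 s1] sh; split; first by rewrite -box_square; exact: circle_pt_box.
rewrite /= cx0 cy0.
have [s0'|s0'] := eqVneq s 0; first by right; rewrite s0' circle_pt0 cE invr_gt0.
have [s1'|s1'] := eqVneq s 1; first by right; rewrite s1' circle_pt1 cE invr_gt0.
left; move: sh; rewrite neq_lt => /orP[h|h].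
  by rewrite gt_eqF //; apply: cy_circle_gt0; rewrite h andbT lt_def s0' s0.
by rewrite lt_eqF //; apply: cy_circle_lt0; rewrite h /= lt_def eq_sym s1' s1.
Qed.

Lemma circle_pt_surj (z : 'rV[R]_2) : bdisc z -> exists s : R, s \in `[0, 1] /\ circle_pt s = z.
Proof.
rewrite /bdisc /= => hz; have p0 := @pi_gt0 R.
have x1 : -1 <= 2 * cx z <= 1.
  have hy := sqr_ge0 (cy z); rewrite -ler_norml -(@ler_pXn2r _ 2) ?nnegrE // expr1n.
  by rewrite real_normK ?num_real // exprMn; lra.
have [/andP[a0 ap] ca] := acos_def x1; set a := acos _ in a0 ap ca.
have sa := sin_ge0_pi (introT andP (conj a0 ap)).
have sa2 : sin a ^+ 2 = (2 * cy z) ^+ 2 by have := cos2Dsin2 a; rewrite ca !exprMn; lra.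
have sa_abs : sin a = `|2 * cy z|.
  by apply/eqP; rewrite -(@eqrXn2 _ 2) // real_normK ?num_real // sa2.
have ang (b : R) : 2 * pi * (b / (2 * pi)) = b.
  by rewrite mulrC divfK // gt_eqF // mulr_gt0.
have pp : 0 < 2 * pi :> R by lra.
have [y0|y0] := leP 0 (cy z).
  exists (a / (2 * pi)); split.
    rewrite in_itv /= divr_ge0 ?ler_pdivrMr //=; lra.
  rewrite ger0_norm in sa_abs; last by lra.
  by apply: cxyP; rewrite /circle_pt !cE ang ?ca ?sa_abs; lra.
exists ((pi *+ 2 - a) / (2 * pi)); split.
  rewrite in_itv /= divr_ge0 ?ler_pdivrMr //=; rewrite ?mulr2n; lra.
rewrite ltr0_norm in sa_abs; last by lra.
apply: cxyP; rewrite /circle_pt !cE ang.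
  by rewrite cosB cos2pi sin2pi mul1r mul0r addr0 ca; lra.
by rewrite sinB cos2pi sin2pi mul1r mul0r sub0r sa_abs; lra.
Qed.

Lemma circle_pt_quarter : circle_pt (4^-1 : R) = pt 0 2^-1.
Proof.
rewrite /circle_pt (_ : 2 * pi * 4^-1 = pi / 2); last by field.
by rewrite cos_pihalf sin_pihalf mulr1 mulr0.
Qed.

Lemma circle_pt_3quarter : circle_pt (3 / 4 : R) = pt 0 (- 2^-1).
Proof.
rewrite /circle_pt (_ : 2 * pi * (3 / 4) = pi / 2 + pi); last by field.
by rewrite sinDpi cosDpi cos_pihalf sin_pihalf oppr0 mulrN1 mulr0.
Qed.

Lemma cy_circle_continuous : continuous (fun s : R => cy (circle_pt s)).
Proof.
have -> : (fun s : R => cy (circle_pt s)) = (fun s => 2^-1 * sin (2 * pi * s)).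
  by apply/funext => s; rewrite /circle_pt cE.
move=> s; apply: (@continuousM _ _ (fun=> 2^-1) (fun s => sin (2 * pi * s))).
  exact: cst_continuous.
apply: (@continuous_comp _ _ _ (fun s => 2 * pi * s) sin); last exact: continuous_sin.
by apply: (@continuousM _ _ (fun=> 2 * pi) id); [exact: cst_continuous|exact: cvg_id].
Qed.

Lemma near_cy_circle_lt (s c : R) : cy (circle_pt s) < c ->
  \forall r \near s, cy (circle_pt r) < c.
Proof.
move=> h; apply: (@cy_circle_continuous s [set x | x < c]).
by apply: open_nbhs_nbhs; split=> //; exact: open_lt.
Qed.

Lemma near_cy_circle_gt (s c : R) : c < cy (circle_pt s) ->
  \forall r \near s, c < cy (circle_pt r).
Proof.
move=> h; apply: (@cy_circle_continuous s [set x | c < x]).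
by apply: open_nbhs_nbhs; split=> //; exact: open_gt.
Qed.

End Circle.

(** * The monodromy at a vertex, in arbitrary coordinates *)

Section VertexJump.
Variables (R : realType) (B : topologicalType) (L : Type).
Variables (A : set ('rV[R]_2 -> B)) (G : graph R B L).
Hypotheses (hB : hausdorff_space B) (hA : oriented_atlas A) (fG : finite_graph A G).

Let Om := ~` graph_support G.

Section Action.
Variables (Y : Type) (act : Y -> L * bool -> Y).
Hypothesis actK : forall y l, act (act y l) (l.1, ~~ l.2) = y.

Lemma flat_punctured (k : 'rV[R]_2 -> B) (c : 'rV[R]_2) (d : R) :
  (forall z, square c d z -> vertices G (k z) -> z = c) ->
  forall z, square c d z -> z != c ->
    exists N, nbhs (k z) N /\ extendable Om (flat A G act) N.
Proof.
move=> kv z sz zc; apply: flat_extendable => // vz.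
by move/eqP: zc; apply; exact: kv.
Qed.

(* The loop [circle k] leaves the slit square once, through the left half. *)
Lemma circle_jump v k w f1 f2 (nu : Y -> Y) :
  star_at A G v k -> intersection_word A G (circle k) w ->
  (forall y l, nu (act y l) = act (nu y) l) -> involutive nu ->
  (forall y, foldl act y w = nu y) ->
  sections (flat A G act) (k @` slit_square 0 1) f1 ->
  sections (flat A G act) (k @` left_half 0 1) f2 ->
  (forall u, upper_left 0 1 u -> Om (k u) -> f1 (k u) = f2 (k u)) ->
  forall u, lower_left 0 1 u -> Om (k u) -> f1 (k u) = nu (f2 (k u)).
Proof.
move=> [[_ kE _] _ kv _] [ts rd] nuA nuK nuw s1 s2 eU.
have LS := flat_local_system fG actK.
have sub : square (0 : 'rV[R]_2) 1 `<=` box by rewrite -box_square.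
have loc := @flat_punctured k 0 1 (fun z sz => kv z (sub z sz)).
have [f3 [s3 eL]] := slit_next kE (@ltr01 R) sub LS loc s2.
(* The circle meets the slit only at time 1/2, at the point (-1/2, 0), where [f2] takes over;
   afterwards [f3] continues [f2] below the slit. Hence [f3] is [nu] after [f1] at the starting
   point. *)
pose F (s : R) := if s < 2^-1 then f1 (circle k s) else
  if s == 2^-1 then f2 (circle k s) else f3 (circle k s).
have Fw : F 1 = foldl act (F 0) w.
  apply: (walk actK rd) => t0 t01.
  have [lt|gt|e] := ltgtP t0 2^-1.
  - exists f1; split.
      by apply: s1; exists (circle_pt t0) => //; apply: circle_slit => //; rewrite lt_eqF.
    have : nbhs t0 [set t | t < 2^-1] by apply: open_nbhs_nbhs; split=> //; exact: open_lt.
    by apply: filterS => t /= h _ _; rewrite /F h.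
  - exists f3; split.
      by apply: s3; exists (circle_pt t0) => //; apply: circle_slit => //; rewrite gt_eqF.
    have : nbhs t0 [set t | 2^-1 < t] by apply: open_nbhs_nbhs; split=> //; exact: open_gt.
    by apply: filterS => t /= h _ _; rewrite /F ltNge ltW //= gt_eqF.
  - subst t0; exists f2; split.
      apply: s2; exists (circle_pt 2^-1) => //; split; first by rewrite -box_square; exact: circle_pt_box.
      by rewrite /= circle_pt_half cE cx0; lra.
    have : nbhs (2^-1 : R) ([set t | 4^-1 < t] `&` [set t | t < 3 / 4]).
      by apply: nbhs_setI; apply: open_nbhs_nbhs; split;
          [exact: open_gt|rewrite /=; lra|exact: open_lt|rewrite /=; lra].
    apply: filterS => t /= [h1 h2] _ nt.
    have lt : left_half 0 1 (circle_pt t).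
      split; first by rewrite -box_square; exact: circle_pt_box.
      by rewrite /= cx0; apply: cx_circle_lt0; rewrite h1.
    rewrite /F; case: ltgtP => h //.
    + apply: eU => //; split=> //=; rewrite cy0; apply: cy_circle_gt0; apply/andP; split=> //; lra.
    + apply: eL => //; split=> //=; rewrite cy0; apply: cy_circle_lt0; apply/andP; split=> //; lra.
have O0 : Om (k (pt 2^-1 0)).
  rewrite -circle_pt0 -circleE; case: rd => _ _ tin tP _ /(tP 0).
  by rewrite in_itv /= lexx ler01 => /(_ isT) /tin; rewrite in_itv /= ltxx.
move: Fw; rewrite /F invr_gt0 ltr0n /= !circleE circle_pt0 circle_pt1 nuw.
have -> : ((1 : R) < 2^-1) = false by lra.
have -> : ((1 : R) == 2^-1) = false by rewrite gt_eqF //; lra.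
move=> Fw.
have s1' : sections (flat A G act) (k @` slit_square 0 1) (nu \o f1).
  by move=> p /s1 fp; apply: flat_equivariant fp.
have S0 : slit_square 0 1 (pt 2^-1 0 : 'rV[R]_2).
  by rewrite -circle_pt0; apply: circle_slit; rewrite ?in_itv /= ?lexx ?ler01 // lt_eqF ?invr_gt0.
have e31 := sections_uniq_on kE LS (@open_slit_square R 0 1) (slit_box sub)
  (slit_connected kE (@ltr01 R) sub) s3 s1' S0 O0 Fw.
by move=> u Lu Ou; have e := e31 u (ll_slit Lu) Ou; rewrite -eL // e /= nuK.
Qed.

End Action.

Variables (Y : Type) (act : Y -> L * bool -> Y).
Hypothesis actK : forall y l, act (act y l) (l.1, ~~ l.2) = y.

(** The coordinates [t] are unrelated to the star coordinates in which [w] is read. It suffices that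
    the continuation [f3] of [f1] around [c] takes at one point the value [nu] of [f1] or the value
    of [f1] itself; both cases lead to the jump [nu]. *)
Lemma vertex_jump (t : 'rV[R]_2 -> B) c N w (nu : Y -> Y) :
  open_embedding t -> box c -> nbhs c N -> vertex_word A G (t c) w ->
  (forall y l, nu (act y l) = act (nu y) l) -> involutive nu ->
  (forall y, foldl act y w = nu y) ->
  exists d : R, [/\ 0 < d, square c d `<=` box `&` N,
    forall z, square c d z -> vertices G (t z) -> z = c &
    forall f1 f2,
      sections (flat A G act) (t @` slit_square c d) f1 ->
      sections (flat A G act) (t @` left_half c d) f2 ->
      (forall u, upper_left c d u -> Om (t u) -> f1 (t u) = f2 (t u)) ->
      forall u, lower_left c d u -> Om (t u) -> f1 (t u) = nu (f2 (t u))].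
Proof.
move=> tE bc Nc vw nuA nuK nuw.
have [k [st _ kw]] := vw setT filterT.
have [[k0 kE _] _ kv _] := st.
have LS := flat_local_system fG actK.
have subk : square (0 : 'rV[R]_2) 1 `<=` box by rewrite -box_square.
have [d [d0 subN subtk]] : exists d : R, [/\ 0 < d, square c d `<=` box `&` N &
    t @` square c d `<=` k @` box].
  have : nbhs c (box `&` N `&` t @^-1` (k @` box)).
    apply: nbhs_setI.
      by apply: nbhs_setI => //; apply: open_nbhs_nbhs; split=> //; exact: open_box.
    apply: (emb_cvg tE bc); rewrite -k0; apply: emb_nbhs => //; last exact: box0.
    by apply: open_nbhs_nbhs; split; [exact: open_box|exact: box0].
  move=> /nbhs_squareP[e e0 h]; exists e; split=> //.
    by move=> z /h[].
  by move=> _ [z /h[_ hz] <-].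
have sub : square c d `<=` box by move=> z /subN[].
have onlyv z : square c d z -> vertices G (t z) -> z = c.
  move=> sz vz; have [|u bu eu] := subtk (t z); first by exists z.
  have e : u = 0 by apply: kv => //; rewrite eu.
  apply: (emb_inj tE) => //; first exact: sub.
  by rewrite -k0 -e.
exists d; split=> // f1 f2 s1 s2 eU.
have loct := @flat_punctured _ _ actK t c d onlyv.
have lock := @flat_punctured _ _ actK k 0 1 (fun z sz => kv z (subk z sz)).
have [f3 [s3 eL]] := slit_next tE d0 sub LS loct s2.
have uniqS := sections_uniq_on tE LS (@open_slit_square R c d) (slit_box sub)
  (slit_connected tE d0 sub).
have nuS (C : set 'rV[R]_2) f : sections (flat A G act) (t @` C) f ->
    sections (flat A G act) (t @` C) (nu \o f).
  by move=> sf p /sf fp; apply: flat_equivariant fp.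
suff key : forall u, slit_square c d u -> Om (t u) -> f3 (t u) = nu (f1 (t u)).
  by move=> u Lu Ou; rewrite -eL // key ?nuK //; exact: ll_slit.
have [w0 [Uw0 Ow0]] := open_meets tE LS (@open_upper_left R c d)
  (fun z h => left_box sub (ul_left h)) (@upper_left_nonempty R c d d0).
have Sw0 := ul_slit Uw0.
suff [e|e] : f3 (t w0) = nu (f1 (t w0)) \/ f3 (t w0) = f1 (t w0).
- exact: (uniqS _ _ _ s3 (nuS _ _ s1) Sw0 Ow0 e).
(* With no monodromy, [f1] and [f2] glue to a section [h] over the whole punctured square. A star
   circle inside this square returns [h] to its value and also applies [w] to it, so [nu] fixes [h]
   and [f3 = f1 = nu f1]. *)
- have e31 := uniqS _ _ _ s3 s1 Sw0 Ow0 e.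
  have [|h [sh hS hL]] := slit_glue tE sub LS s1 s2 eU.
    by move=> u Lu Ou; rewrite -eL // e31 //; exact: ll_slit.
  have onbhs : nbhs (t c) (t @` square c d).
    by apply: emb_nbhs => //; exact: nbhs_square.
  have [k' [[[k0' kE' _] _ kv' _] subk' [ts rd]]] := vw _ onbhs.
  have inP s : (t @` (square c d `\ c)) (circle k' s).
    have [|z sz ez] := subk' (circle k' s).
      by exists (circle_pt s) => //; exact: circle_pt_box.
    exists z => //; split=> //= zc; subst z.
    have /eqP := circle_pt_neq0 s; apply.
    by apply: (emb_inj kE'); [exact: circle_pt_box|exact: box0|rewrite k0' ez].
  have Hw : h (circle k' 1) = foldl act (h (circle k' 0)) w.
    apply: (walk actK (F := fun s => h (circle k' s)) rd) => s _; exists h; split.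
      exact: sh.
    exact: filterE.
  have O0 : Om (circle k' 0).
    case: rd => _ _ tin tP _ /(tP 0).
    by rewrite in_itv /= lexx ler01 => /(_ isT) /tin; rewrite in_itv /= ltxx.
  rewrite nuw in Hw.
  have e10 : circle k' 1 = circle k' 0 by rewrite !circleE circle_pt0 circle_pt1.
  rewrite e10 in Hw.
  have hnu : forall q, (t @` (square c d `\ c)) q -> Om q -> h q = nu (h q).
    apply: (sections_uniq LS (punctured_open tE sub) (punctured_connected tE d0 sub)
      sh (nuS _ _ sh) (inP 0) O0 Hw).
  move=> u Su Ou; rewrite e31 // -{1}hS // hnu ?hS //.
  by exists u => //; split; [case: Su|apply/eqP; exact: slit_square_neq Su].
(* In the star coordinates the orbits under [nu] of the sections [g1] and [g2] glue over the
   punctured square. Its restriction to the smaller punctured square of [t] equals the orbits of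
   [f1], [f2] and [f3] in turn, so [f3] lies in the orbit of [f1]. *)
pose orb y : set Y := [set y; nu y].
pose act' (S : set Y) l : set Y := (fun y => act y l) @` S.
have act'K S l : act' (act' S l) (l.1, ~~ l.2) = S.
  rewrite /act' image_comp (_ : _ \o _ = id) ?image_id //.
  by apply/funext => y /=; exact: actK.
have orbA y l : orb (act y l) = act' (orb y) l.
  by rewrite /orb /act' image_setU !image_set1 nuA.
have orbnu y : orb (nu y) = orb y by rewrite /orb nuK setUC.
have LS' := flat_local_system fG act'K.
have orbS (C : set B) f : sections (flat A G act) C f ->
    sections (flat A G act') C (orb \o f).
  by move=> sf p /sf fp; apply: flat_equivariant fp.
have [|z0 bz0 ez0] := subtk (t w0); first by exists w0 => //; case: Sw0.
have z00 : z0 != 0.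
  apply/eqP => e; have := slit_square_neq Sw0 => /eqP; apply.
  apply: (emb_inj tE) => //; first by apply: sub; case: Sw0.
  by rewrite -ez0 e k0.
have sz0 : square 0 1 z0 by rewrite -box_square.
have [|g1 [g2 [sg1 sg2 geU [ge1 ge2]]]] :=
  slit_pair kE (@ltr01 R) subk LS lock (f1 (t w0)) sz0 z00; first by rewrite ez0.
have geL := circle_jump actK st kw nuA nuK nuw sg1 sg2 geU.
have [|u Lu Ou|orbg [so oS oL]] := slit_glue kE subk LS' (orbS _ _ sg1) (orbS _ _ sg2).
- by move=> u Uu Ou /=; rewrite geU.
- by rewrite /= geL // orbnu.
have tk (C : set 'rV[R]_2) : C `<=` square c d `\ c ->
    t @` C `<=` k @` (square 0 1 `\ 0).
  move=> Cc _ [z /Cc[sz zc] <-]; have [|y by_ ey] := subtk (t z); first by exists z.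
  exists y => //; split; first by rewrite -box_square.
  move=> /= y0; apply: zc => /=; apply: (emb_inj tE) => //; first exact: sub.
  by rewrite -ey y0 k0.
have oS1 : sections (flat A G act') (t @` slit_square c d) orbg.
  move=> p /(tk (slit_square c d)) h; apply: so; apply: h => z Sz.
  by split; [case: Sz|apply/eqP; exact: slit_square_neq Sz].
have oS2 : sections (flat A G act') (t @` left_half c d) orbg.
  move=> p /(tk (left_half c d)) h; apply: so; apply: h => z Sz.
  by split; [case: Sz|apply/eqP; exact: left_half_neq Sz].
have ew0 : orb (f1 (t w0)) = orbg (t w0).
  have [Sz|nS] := pselect (slit_square 0 1 z0).
    by rewrite -ez0 oS //= ge1 // ez0.
  case: (slit_or_left sz0 z00) => [//|[Lz _]].
  by rewrite -ez0 oL ?ez0 //= -{2}ez0 ge2.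
have uniqS' := sections_uniq_on tE LS' (@open_slit_square R c d) (slit_box sub)
  (slit_connected tE d0 sub).
have uniqL' := sections_uniq_on tE LS' (@open_left_half R c d) (left_box sub)
  (left_connected tE sub).
have e2 : forall u, left_half c d u -> Om (t u) -> orb (f2 (t u)) = orbg (t u).
  apply: (uniqL' _ _ _ (orbS _ _ s2) oS2 (ul_left Uw0) Ow0).
  by rewrite /= -eU // ew0.
have [w1 [Lw1 Ow1]] := open_meets tE LS (@open_lower_left R c d)
  (fun z h => left_box sub (ll_left h)) (@lower_left_nonempty R c d d0).
have e3 : forall u, slit_square c d u -> Om (t u) -> orb (f3 (t u)) = orbg (t u).
  apply: (uniqS' _ _ _ (orbS _ _ s3) oS1 (ll_slit Lw1) Ow1).
  by rewrite /= eL // e2 //; exact: ll_left.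
have : orb (f1 (t w0)) (f3 (t w0)) by rewrite ew0 -e3 //; left.
by case=> ->; [right|left].
Qed.

End VertexJump.

(** * Monodromy around a disc *)

Section Counting.
Variables (T : topologicalType) (Y : Type) (nu : Y -> Y).
Hypothesis nuK : involutive nu.

Lemma iter_odd n y : iter n nu y = iter (odd n) nu y.
Proof.
elim: n => [//|n IH]; rewrite iterS IH /=.
by case: (odd n) => //=; rewrite nuK.
Qed.

Lemma iter_iterK n y : iter n nu (iter n nu y) = y.
Proof. by rewrite -iterD addnn iter_odd odd_double. Qed.

Lemma near_seq (I : eqType) (vs : seq I) (x : T) (Q : I -> T -> Prop) :
  (forall v, v \in vs -> \forall y \near x, Q v y) ->
  \forall y \near x, forall v, v \in vs -> Q v y.
Proof.
elim: vs => [|v vs IH] h; first by apply: filterE.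
have h1 := h v (mem_head _ _).
have h2 : \forall y \near x, forall v, v \in vs -> Q v y.
  by apply: IH => u uvs; apply: h; rewrite inE uvs orbT.
apply: filterS2 h1 h2 => y Qv Qvs u; rewrite inE => /orP[/eqP-> //|]; exact: Qvs.
Qed.

Lemma near_parity (I : eqType) (vs : seq I) (x : T) (S : set T) (a b : I -> T -> bool) :
  (forall v, v \in vs -> exists e : bool, \forall y \near x, S y -> a v y (+) b v y = e) ->
  exists e : bool, \forall y \near x,
    S y -> odd (count (a ^~ y) vs + count (b ^~ y) vs) = e.
Proof.
elim: vs => [|v vs IH] h; first by exists false; exact: filterE.
have [e1 h1] := h v (mem_head _ _).
have [|e2 h2] := IH; first by move=> u uvs; apply: h; rewrite inE uvs orbT.
exists (e1 (+) e2); apply: filterS2 h1 h2 => y h1 h2 Sy /=.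
rewrite -(h1 Sy) -(h2 Sy) !oddD !oddb.
by case: (a v y); case: (b v y); case: (odd _); case: (odd _).
Qed.

End Counting.

Section Twist.
Variables (R : realType) (B : topologicalType) (L : Type).
Variables (A : set ('rV[R]_2 -> B)) (G : graph R B L).
Hypotheses (hB : hausdorff_space B) (hA : oriented_atlas A) (fG : finite_graph A G).
Variables (Y : Type) (act : Y -> L * bool -> Y) (nu : Y -> Y).
Hypotheses (actK : forall y l, act (act y l) (l.1, ~~ l.2) = y).
Hypotheses (nuA : forall y l, nu (act y l) = act (nu y) l) (nuK : involutive nu).
Variable t : 'rV[R]_2 -> B.
Hypothesis tE : open_embedding t.
Variable vs : seq 'rV[R]_2.
Variable tinv : B -> 'rV[R]_2.
Hypothesis tinvK : forall z, box z -> tinv (t z) = z.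

Let Om := ~` graph_support G.

Lemma iter_nuA n y l : iter n nu (act y l) = act (iter n nu y) l.
Proof. by elim: n => [//|n IH]; rewrite !iterS IH nuA. Qed.

(* [below v p q]: p lies on the cut to the left of v, and q below this cut. *)
Definition below (v p q : 'rV[R]_2) : bool := [&& cx p < cx v, cy p == cy v & cy q < cy v].

Definition twist (p q : 'rV[R]_2) : nat := count (fun v => below v p q) vs.

(** Away from the cuts the twist is 0 and this is flatness. At a point of a cut, applying [nu] below
    it must undo the jump; cuts at the same height overlap, hence the iterate. *)
Definition twisted_flat (b : B) (f : B -> Y) : Prop :=
  flat A G act b (fun b' => iter (twist (tinv b) (tinv b')) nu (f b')).

Lemma twisted_flat_local_system : local_system Om twisted_flat.
Proof.
have LS := flat_local_system fG actK; split; last exact: ls_dense LS.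
  move=> p f f' fp near_eq; apply: (ls_germ LS fp).
  by apply: filterS near_eq => q h /h ->.
move=> p f f' fp fp'; have [N [Np NP]] := ls_uniq LS fp fp'.
exists N; split=> // z Nz Oz e q Nq Oq.
have := NP z Nz Oz; rewrite e => /(_ erefl q Nq Oq) /(congr1 (iter (twist (tinv p) (tinv q)) nu)).
by rewrite !iter_iterK.
Qed.

(* Sections with a jump nu along the cuts going left from the points of vs; at a
   vertex, the condition is on the punctured neighborhoods. *)
Definition twisted (b : B) (f : B -> Y) : Prop :=
  [/\ (t @` box) b,
      vertices G b -> \forall q \near b, q <> b -> twisted_flat q f &
      ~ vertices G b -> twisted_flat b f].

(** At a vertex nothing is imposed at the point itself; uniqueness there comes from the punctured
    square, which is connected. *)
Lemma twisted_local_system : local_system Om twisted.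
Proof.
have LS := twisted_flat_local_system; split; last exact: ls_dense LS.
  move=> p f f' [bp fv fn] near_eq; split=> //.
    move=> /fv h; apply: filterS2 h (nbhs_interior near_eq) => q h1 h2 qp.
    exact: (ls_germ LS (h1 qp)).
  by move=> /fn h; exact: (ls_germ LS h).
move=> p f f' [bp fv fn] [_ fv' fn'].
have [vp|nv] := pselect (vertices G p); last exact: (ls_uniq LS (fn nv) (fn' nv)).
have [z bz ez] := bp; subst p.
have nt : nbhs z (t @^-1` ([set q | q <> t z -> twisted_flat q f] `&`
    [set q | q <> t z -> twisted_flat q f'])).
  by apply: (emb_cvg tE bz); apply: nbhs_setI; [exact: fv|exact: fv'].
have : nbhs z (box `&` t @^-1` ([set q | q <> t z -> twisted_flat q f] `&`
    [set q | q <> t z -> twisted_flat q f'])).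
  by apply: nbhs_setI => //; apply: open_nbhs_nbhs; split=> //; exact: open_box.
move=> /nbhs_squareP[d d0 sub].
have sb : square z d `<=` box by move=> y /sub[].
exists (t @` square z d); split; first by apply: emb_nbhs => //; exact: nbhs_square.
move=> _ [u su <-] Ou e _ [y sy <-] Oy.
have neq x : square z d x -> Om (t x) -> x <> z.
  by move=> _ Ox exz; apply: Ox; rewrite exz; left.
have inj x : square z d x -> x <> z -> t x <> t z.
  by move=> sx xz /(emb_inj tE (sb _ sx) bz).
apply: (sections_uniq LS (punctured_open tE sb) (punctured_connected tE d0 sb)
  (f := f) (f' := f') (z := t u)) => //.
- by move=> _ [x [sx xz] <-]; have [_ [h _]] := sub x sx; apply: h; exact: inj.
- by move=> _ [x [sx xz] <-]; have [_ [_ h]] := sub x sx; apply: h; exact: inj.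
- by exists u => //; split=> //; exact: neq.
- by exists y => //; split=> //; exact: neq.
Qed.

Lemma near_below (z v : 'rV[R]_2) : v != z -> \forall y \near z,
  (cx y < cx v -> cy y = cy v -> cx z < cx v /\ cy z = cy v) /\
  (cx z < cx v -> cx y < cx v).
Proof.
move=> vz.
have h2 : \forall y \near z, cx z < cx v -> cx y < cx v.
  have [lt|ge] := ltP (cx z) (cx v); last by apply: filterE.
  have : nbhs z [set y | cx y < cx v] by apply: open_nbhs_nbhs; split=> //; exact: open_cxlt.
  by apply: filterS.
suff h1 : \forall y \near z, cx y < cx v -> cy y = cy v -> cx z < cx v /\ cy z = cy v.
  by apply: filterS2 h1 h2.
have [lt|gt|e] := ltgtP (cy z) (cy v).
- have : nbhs z [set y | cy y < cy v] by apply: open_nbhs_nbhs; split=> //; exact: open_cylt.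
  by apply: filterS => y /= h _ e; rewrite e ltxx in h.
- have : nbhs z [set y | cy v < cy y] by apply: open_nbhs_nbhs; split=> //; exact: open_cygt.
  by apply: filterS => y /= h _ e; rewrite e ltxx in h.
have [lt|gt|e'] := ltgtP (cx z) (cx v).
- exact: filterE.
- have : nbhs z [set y | cx v < cx y] by apply: open_nbhs_nbhs; split=> //; exact: open_cxgt.
  by apply: filterS => y /= h h' _; have := lt_trans h h'; rewrite ltxx.
- by case/eqP: vz; exact: cxyP.
Qed.

(** The twist depends on a base point, and here the base moves from [z] to a nearby [y]. If [y] is
    on the cut of [v] then so is [z] and nothing changes; otherwise [below v y] is false and
    [below v z] is constant near [y]. A constant power of [nu] does not affect flatness. *)
Lemma below_parity (z v y : 'rV[R]_2) :
  (cx y < cx v -> cy y = cy v -> cx z < cx v /\ cy z = cy v) ->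
  (cx z < cx v -> cx y < cx v) ->
  exists e : bool, \forall r \near y, below v y r (+) below v z r = e.
Proof.
move=> h1 h2; rewrite /below.
have [lt|ge] := ltP (cx y) (cx v); last first.
  exists false; apply: filterE => r /=; case: ltP => // /h2 h.
  by have := lt_le_trans h ge; rewrite ltxx.
have [e|ne] := eqVneq (cy y) (cy v).
  have [-> ->] := h1 lt e; exists false; apply: filterE => r.
  by rewrite eqxx addbb.
have near_cy : exists e : bool, \forall r \near y, (cy r < cy v) = e.
  move: ne; rewrite neq_lt => /orP[h|h].
    exists true; have : nbhs y [set r | cy r < cy v].
      by apply: open_nbhs_nbhs; split=> //; exact: open_cylt.
    by apply: filterS.
  exists false; have : nbhs y [set r | cy v < cy r].
      by apply: open_nbhs_nbhs; split=> //; exact: open_cygt.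
  by apply: filterS => r /= h'; apply/negbTE; rewrite -leNgt ltW.
have [e he] := near_cy; exists ([&& cx z < cx v, cy z == cy v & e]).
by apply: filterS he => r ->.
Qed.

Lemma twist_flat_germ b y g f : box y -> flat A G act (t y) g ->
  (\forall r \near y, box r -> Om (t r) ->
     iter (twist y r) nu (f (t r)) = iter b nu (g (t r))) ->
  twisted_flat (t y) f.
Proof.
move=> by_ fg near_eq; rewrite /twisted_flat tinvK //.
have fg' : flat A G act (t y) (iter b nu \o g).
  by apply: flat_equivariant fg => x l; rewrite iter_nuA.
apply: (ls_germ (flat_local_system fG actK) fg').
have : nbhs y (box `&` [set r | box r -> Om (t r) ->
     iter (twist y r) nu (f (t r)) = iter b nu (g (t r))]).
  by apply: nbhs_setI => //; apply: open_nbhs_nbhs; split=> //; exact: open_box.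
move=> /(emb_nbhs tE) /(_ by_); apply: filterS => _ [r [br hr] <-] Or.
by rewrite /= tinvK // hr.
Qed.

Lemma twisted_extendable z : box z -> z \notin vs -> ~ vertices G (t z) ->
  exists N, nbhs (t z) N /\ extendable Om twisted N.
Proof.
move=> bz zvs nv.
have [N [Nz ext]] := flat_extendable (act := act) hB hA fG actK nv.
have h1 := near_seq (vs := vs) (x := z) (Q := fun v y =>
  (cx y < cx v -> cy y = cy v -> cx z < cx v /\ cy z = cy v) /\
  (cx z < cx v -> cx y < cx v)) _.
have {}h1 := h1 (fun v vvs => near_below (memPn zvs v vvs)).
have onv : nbhs (t z) (~` vertices G).
  apply: open_nbhs_nbhs; split=> //; apply: closed_openC.
  by apply: (accessible_finite_set_closed.1 (hausdorff_accessible hB)); exact: vertices_finite fG.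
have h2 : nbhs z (box `&` t @^-1` (N `&` ~` vertices G)).
  apply: nbhs_setI; first by apply: open_nbhs_nbhs; split=> //; exact: open_box.
  by apply: (emb_cvg tE bz); apply: nbhs_setI.
have /nbhs_squareP[d d0 sub] := nbhs_setI h1 h2.
have sb : square z d `<=` box by move=> y /sub[_ []].
exists (t @` square z d); split; first by apply: emb_nbhs => //; exact: nbhs_square.
move=> _ y [u su <-] Ou.
have [_ [_ [Nu _]]] := sub u su.
have [g [sg eg]] := ext (t u) (iter (twist z u) nu y) Nu Ou.
(* An ordinary flat section made to jump along the cuts through [z]; [nu] being an involution, the
   same iterate also removes the jumps. *)
exists (fun b => iter (twist z (tinv b)) nu (g b)); split; last first.
  by rewrite tinvK; [rewrite eg iter_iterK|exact: sb].
move=> _ [x sx <-]; have [st [bx [Nx nvx]]] := sub x sx.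
split; [by exists x|by []|move=> _].
have [e he] : exists e : bool, \forall r \near x, setT r ->
    odd (twist x r + twist z r) = e.
  apply: near_parity => v /st[p1 p2].
  by have [e he] := below_parity p1 p2; exists e; apply: filterS he.
apply: (@twist_flat_germ e x g) => //; first exact: sg.
apply: filterS he => r hr br Or; rewrite tinvK // -iterD (iter_odd nuK) hr //.
Qed.

Hypothesis vs_uniq : uniq vs.

(** The jump across the slit given by [vertex_jump] is the one that [z] prescribes along its own
    cut: [nu] if [z] is in [vs], none otherwise. The cuts of the other points through [z] are
    handled as at an ordinary point. *)
Lemma twisted_extendable_vertex z w : box z -> vertices G (t z) ->
  vertex_word A G (t z) w ->
  (forall y, foldl act y w = iter (z \in vs) nu y) ->
  exists N, nbhs (t z) N /\ extendable Om twisted N.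
Proof.
move=> bz vz vw aw.
set ep := z \in vs in aw.
pose nu' := iter ep nu.
have nu'A y l : nu' (act y l) = act (nu' y) l by exact: iter_nuA.
have nu'K : involutive nu' by move=> y; exact: iter_iterK.
pose us := rem z vs.
have zus : z \notin us by rewrite /us mem_rem_uniq // !inE eqxx.
have h1 := near_seq (vs := us) (x := z) (Q := fun v y =>
  (cx y < cx v -> cy y = cy v -> cx z < cx v /\ cy z = cy v) /\
  (cx z < cx v -> cx y < cx v)) _.
have {}h1 := h1 (fun v vvs => near_below (memPn zus v vvs)).
have [d [d0 sub onlyv jump]] := vertex_jump hB hA fG actK tE bz h1 vw nu'A nu'K aw.
have sb : square z d `<=` box by move=> y /sub[].
have LS := flat_local_system fG actK.
have loc := flat_punctured hB hA fG actK onlyv.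
have twE x r : twist x r = (ep && below z x r + count (fun v => below v x r) us)%N.
  rewrite /twist /us /ep; have [zvs|zvs] := boolP (z \in vs).
    by rewrite (permP (perm_to_rem zvs)).
  by rewrite rem_id.
have twz r : twist z r = count (fun v => below v z r) us.
  by rewrite twE /below ltxx andbF.
exists (t @` square z d); split; first by apply: emb_nbhs => //; exact: nbhs_square.
move=> _ y [u su <-] Ou.
have uz : u != z by apply/eqP => e; apply: Ou; rewrite e; left.
have [f1 [f2 [s1 s2 eU [e1 e2]]]] := slit_pair tE d0 sb LS loc (iter (twist z u) nu y) su uz Ou.
have eL := jump f1 f2 s1 s2 eU.
(* On the cut itself the section of the left half is used; it agrees with [f1] above the cut, and
   with [f1] up to [nu'] below it. *)
pose g b := if pselect (slit_square z d (tinv b)) then f1 b else f2 b.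
have gS r : box r -> slit_square z d r -> g (t r) = f1 (t r).
  by move=> br Sr; rewrite /g tinvK //; case: pselect.
have gL r : left_half z d r -> cy r = cy z -> g (t r) = f2 (t r).
  move=> [sr /= lr] er; rewrite /g tinvK; last exact: sb.
  case: pselect => // -[_ /= h]; exfalso; move: h; rewrite er eqxx => -[//|h].
  by have := lt_trans h lr; rewrite ltxx.
pose f b := iter (twist z (tinv b)) nu (g b).
have tf x : square z d x -> x <> z -> twisted_flat (t x) f.
  move=> sx xz; have [bx st] := sub x sx.
  have [e he] : exists e : bool, \forall r \near x, setT r ->
      odd (count (fun v => below v x r) us + count (fun v => below v z r) us) = e.
    apply: near_parity => v /st[p1 p2].
    by have [e he] := below_parity p1 p2; exists e; apply: filterS he.
  have parity r : odd (count (fun v => below v x r) us + count (fun v => below v z r) us) = e ->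
      box r -> iter (twist x r) nu (f (t r)) = iter e nu (iter (ep && below z x r) nu (g (t r))).
    move=> hr br; rewrite /f tinvK // -!iterD [LHS](iter_odd nuK) [RHS](iter_odd nuK).
    congr (iter (nat_of_bool _) _ _).
    rewrite twz twE -addnA oddD hr oddD !oddb addbC //.
  have [Sx|[Lx ex]] := slit_or_left sx (introN eqP xz).
    apply: (@twist_flat_germ e x f1) => //; first by apply: s1; exists x.
    have : nbhs x (slit_square z d) by apply: open_nbhs_nbhs; split=> //; exact: open_slit_square.
    apply: filterS2 he => r /(_ I) hr Sr br _.
    rewrite parity // gS //.
    have -> : below z x r = false.
      case: Sx => _ /= h; rewrite /below; case: h => [/negbTE->|h]; first by rewrite andbF.
      by rewrite ltNge ltW.
    by rewrite andbF.
  apply: (@twist_flat_germ e x f2) => //; first by apply: s2; exists x.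
  have : nbhs x (left_half z d) by apply: open_nbhs_nbhs; split=> //; exact: open_left_half.
  apply: filterS2 he => r /(_ I) hr Lr br Or.
  rewrite parity //; congr (iter _ _ _).
  have -> : below z x r = (cy r < cy z) by rewrite /below ex eqxx (proj2 Lx).
  have [lt|gt|er] := ltgtP (cy r) (cy z).
  - rewrite gS //; last by split; [case: Lr|left; rewrite lt_eqF].
    by rewrite andbT eL //; exact: nu'K.
  - rewrite andbF /= gS //; last by split; [case: Lr|left; rewrite gt_eqF].
    by apply: eU.
  - by rewrite andbF /= gL.
exists f; split; last first.
  rewrite /f tinvK; last exact: sb.
  have [Su|nS] := pselect (slit_square z d u).
    by rewrite gS ?e1 ?iter_iterK //; exact: sb.
  by case: (slit_or_left su uz) => // -[Lu eu]; rewrite gL // e2 // iter_iterK.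
have inj x : square z d x -> t x <> t z -> x <> z by move=> _ h e; rewrite e in h.
move=> _ [x sx <-]; split.
- by exists x => //; exact: sb.
- move=> vx; have e : x = z by exact: onlyv.
  subst x.
  have : nbhs (t z) (t @` square z d) by apply: emb_nbhs => //; exact: nbhs_square.
  by apply: filterS => _ [r sr <-] /(inj r sr); exact: tf.
- by move=> nvx; apply: tf => // e; apply: nvx; rewrite e.
Qed.

End Twist.

(** * The holonomy of the boundary circle *)

Section Disc.
Variables (R : realType) (B : topologicalType) (L : Type).
Variables (A : set ('rV[R]_2 -> B)) (G : graph R B L).
Hypotheses (hB : hausdorff_space B) (hA : oriented_atlas A) (fG : finite_graph A G).
Variables (Y : Type) (act : Y -> L * bool -> Y) (nu : Y -> Y).
Hypotheses (actK : forall y l, act (act y l) (l.1, ~~ l.2) = y).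
Hypotheses (nuA : forall y l, nu (act y l) = act (nu y) l) (nuK : involutive nu).
Variable t : 'rV[R]_2 -> B.
Hypothesis tE : open_embedding t.

Let Om := ~` graph_support G.

Definition sqnorm (z : 'rV[R]_2) : R := cx z ^+ 2 + cy z ^+ 2.

Lemma starshaped_sqnorm (rho : R) : 0 <= rho -> starshaped 0 [set z | sqnorm z < rho].
Proof.
move=> rho0 z s /= hz /andP[s0 s1]; rewrite subr0 add0r /sqnorm !cE !exprMn -mulrDr.
have h : 0 <= cx z ^+ 2 + cy z ^+ 2 by rewrite addr_ge0 ?sqr_ge0.
by apply: le_lt_trans hz; rewrite ler_piMl // exprn_ile1.
Qed.

Lemma sqnorm_box (z : 'rV[R]_2) : sqnorm z < 1 -> box z.
Proof.
rewrite /sqnorm => h; have hx := sqr_ge0 (cx z); have hy := sqr_ge0 (cy z).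
have key (a : R) : a ^+ 2 < 1 -> `|a| < 1.
  by move=> a1; rewrite -(@ltr_pXn2r _ 2) ?nnegrE // expr1n real_normK ?num_real.
by split; apply: key; lra.
Qed.

Lemma sqnorm_continuous : continuous sqnorm.
Proof.
move=> z; apply: (@continuousD _ _ _ (fun z => cx z ^+ 2) (fun z => cy z ^+ 2)).
  apply: (@continuous_comp _ _ _ (@cx R) (fun x => x ^+ 2)); first exact: cx_continuous.
  exact: exprn_continuous.
apply: (@continuous_comp _ _ _ (@cy R) (fun x => x ^+ 2)); first exact: cy_continuous.
exact: exprn_continuous.
Qed.

Lemma open_sqnorm (rho : R) : open [set z : 'rV[R]_2 | sqnorm z < rho].
Proof.
apply: (@open_comp _ _ sqnorm [set x | x < rho]); last exact: open_lt.
by move=> z _; exact: sqnorm_continuous.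
Qed.

Lemma disc_sqnorm (z : 'rV[R]_2) : disc z <-> sqnorm z <= 4^-1.
Proof. by rewrite /disc /sqnorm /= (_ : 2^-1 ^+ 2 = 4^-1 :> R) //; field. Qed.

Lemma disc_box (z : 'rV[R]_2) : disc z -> box z.
Proof. by move/disc_sqnorm => h; apply: sqnorm_box; apply: le_lt_trans h _; lra. Qed.

(** Sections are extended over an open disc, which has to contain the boundary circle. Finiteness of
    the vertices leaves room for a radius that adds no vertex outside the closed disc. *)
Lemma vertex_free_collar : exists rho : R, [/\ 4^-1 < rho, rho <= 1 &
  forall z, sqnorm z < rho -> vertices G (t z) -> disc z].
Proof.
have /finite_seqP[s sP] := vertices_finite fG.
suff [rho [r4 r1 rP]] : exists rho : R, [/\ 4^-1 < rho, rho <= 1 &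
    forall z, box z -> sqnorm z < rho -> t z \in s -> disc z].
  exists rho; split=> // z zr vz; apply: rP => //.
    by apply: sqnorm_box; apply: lt_le_trans zr _.
  by have : [set` s] (t z) by rewrite -sP.
elim: s {sP} => [|v s [rho [r4 r1 rP]]]; first by exists 1; split=> //; lra.
have [[z [bz ez nz]]|no] := pselect (exists z, [/\ box z, t z = v & 4^-1 < sqnorm z]).
  exists (Num.min rho (sqnorm z)); split; first by rewrite lt_min r4.
    by rewrite ge_min r1.
  move=> y by_; rewrite lt_min => /andP[yr yz]; rewrite inE => /orP[/eqP ey|]; last exact: rP.
  have e : y = z by apply: (emb_inj tE) => //; rewrite ey ez.
  by rewrite e ltxx in yz.
exists rho; split=> // z bz zr; rewrite inE => /orP[/eqP ez|]; last exact: rP.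
apply/disc_sqnorm; rewrite leNgt; apply/negP => h; apply: no; by exists z.
Qed.

Lemma circle_not_vertex ts w s : reads_at A G (circle t) ts w -> s \in `[0, 1] ->
  ~ vertices G (circle t s).
Proof.
move=> [_ [szw _] _ tsP cross] s01 vs.
have sts : s \in ts by apply/(tsP s s01); left.
have jw : (index s ts < size w)%N by rewrite -szw index_mem.
have [l0 _] : exists l0 : L * bool, True by case: (w) jw => // l0 _ _; exists l0.
have [k [E _]] := cross _ 0 l0 jw; move: E; rewrite nth_index // => E.
exact: edge_at_not_vertex E vs.
Qed.

Section Past.
Variable v : 'rV[R]_2.
Hypothesis v_in : sqnorm v < 4^-1.

(* The circle has crossed the cut of v by the time s. *)
Definition past (s : R) : bool :=
  (3 / 4 <= s) || (4^-1 < s) && (cy (circle_pt s) < cy v).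

Lemma cy_in : - 2^-1 < cy v < 2^-1.
Proof.
have h : cy v ^+ 2 < 2^-1 ^+ 2.
  have := sqr_ge0 (cx v); have := v_in; rewrite /sqnorm.
  have -> : 2^-1 ^+ 2 = 4^-1 :> R by field.
  by lra.
by rewrite -ltr_norml -(@ltr_pXn2r _ 2) ?nnegrE // ?invr_ge0 // real_normK ?num_real.
Qed.

Lemma cx_circle_level (s : R) : cy (circle_pt s) = cy v -> `|cx v| < `|cx (circle_pt s)|.
Proof.
move=> e; have := circle_pt_norm s; rewrite e => h.
rewrite -(@ltr_pXn2r _ 2) ?nnegrE // !real_normK ?num_real //.
have := v_in; rewrite /sqnorm; have : 2^-1 ^+ 2 = 4^-1 :> R by field.
by lra.
Qed.

(** When the circle is on the cut, both indicators are locally [cy (circle_pt r) < cy v]; at other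
    times the first is false and the second locally constant. By [cx_circle_level], at the height of
    [v] the circle lies farther out than [v], so it is on the cut exactly in its left half. *)
Lemma past_below (s : R) : s \in `[0, 1] -> exists e : bool,
  \forall r \near s, below v (circle_pt s) (circle_pt r) (+) past r = e.
Proof.
rewrite in_itv /= => /andP[s0 s1].
have /andP[v1 v2] := cy_in.
have openlt (a b : R) : a < b -> \forall r \near a, r < b.
  by move=> ab; apply: (open_nbhs_nbhs (A := [set x | x < b])); split=> //; exact: open_lt.
have opengt (a b : R) : b < a -> \forall r \near a, b < r.
  by move=> ab; apply: (open_nbhs_nbhs (A := [set x | b < x])); split=> //; exact: open_gt.
have [mid|nmid] := boolP (4^-1 < s < 3 / 4).
  have cx0' := cx_circle_lt0 mid; have /andP[m1 m2] := mid.
  have nmid : \forall r \near s, 4^-1 < r < 3 / 4.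
    by apply: filterS2 (opengt _ _ m1) (openlt _ _ m2) => r -> ->.
  have pastE r : 4^-1 < r < 3 / 4 -> past r = (cy (circle_pt r) < cy v).
    by rewrite /past => /andP[r1 r2]; rewrite leNgt r2 r1.
  have [e|ne] := eqVneq (cy (circle_pt s)) (cy v).
    exists false; apply: filterS nmid => r /pastE ->.
    rewrite /below e eqxx /=.
    have -> : cx (circle_pt s) < cx v.
      have := cx_circle_level e; rewrite [ltRHS]ltr0_norm // ltr_norml => /andP[]; lra.
    by rewrite addbb.
  have near_cy : exists e : bool, \forall r \near s, (cy (circle_pt r) < cy v) = e.
    move: ne; rewrite neq_lt => /orP[h|h].
      by exists true; apply: near_cy_circle_lt.
    exists false; apply: filterS (near_cy_circle_gt h) => r /= h'.
    by apply/negbTE; rewrite -leNgt ltW.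
  have [e he] := near_cy; exists e.
  apply: filterS2 nmid he => r /pastE -> ->.
  by rewrite /below (negbTE ne) andbF.
have side : 0 <= s <= 4^-1 \/ 3 / 4 <= s <= 1.
  move: nmid; rewrite negb_and -!leNgt => /orP[h|h]; [left|right]; apply/andP; split=> //.
have cxge := cx_circle_ge0 side.
have bF r : below v (circle_pt s) r = false.
  rewrite /below; case: ltP => //= h; apply/negP => /andP[/eqP e _].
  have := cx_circle_level e; rewrite [ltRHS]ger0_norm // ltr_norml => /andP[]; lra.
case: side => /andP[h1 h2].
  exists false.
  have [lt|] := ltP s 4^-1.
    apply: filterS (openlt _ _ lt) => r h; rewrite bF /past /=.
    by apply/negbTE; rewrite negb_or -ltNge negb_and -leNgt (ltW h) /=; lra.
  (* At the top of the circle the test [4^-1 < r] switches, but the height exceeds that of [v], so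
     [past] stays false; symmetrically it stays true at the bottom. *)
  move=> ge; have e : s = 4^-1 by apply/eqP; rewrite eq_le h2.
  have hc : cy v < cy (circle_pt s) by rewrite e circle_pt_quarter cE.
  have h3 : s < 3 / 4 by rewrite e; lra.
  apply: filterS2 (openlt _ _ h3) (near_cy_circle_gt hc) => r h4 h5.
  by rewrite bF /past leNgt h4 /= [_ < cy v]ltNge ltW //= andbF.
exists true.
have [gt|] := ltP (3 / 4) s.
  by apply: filterS (opengt _ _ gt) => r h; rewrite bF /past (ltW h).
move=> le; have e : s = 3 / 4 by apply/eqP; rewrite eq_le h1 le.
have hc : cy (circle_pt s) < cy v by rewrite e circle_pt_3quarter cE.
have h3 : 4^-1 < s by rewrite e; lra.
apply: filterS2 (opengt _ _ h3) (near_cy_circle_lt hc) => r h4 h5.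
by rewrite bF /past h4 h5 orbT.
Qed.

Lemma past0 : past 0 = false.
Proof.
rewrite /past; apply/negbTE; rewrite negb_or -ltNge negb_and -leNgt.
by apply/andP; split; [lra|apply/orP; left; lra].
Qed.

Lemma past1 : past 1 = true.
Proof. by rewrite /past (_ : 3 / 4 <= 1) //; lra. Qed.

End Past.

(** The jumping sections have no monodromy left, so one extends over the disc. Applying [nu] once
    for each cut already passed makes it flat along the circle; at time 1 all the cuts have been
    passed, and [f] has returned to its initial value. *)
Lemma disc_holonomy vs ts w : uniq vs -> reads_at A G (circle t) ts w ->
  (forall v, v \in vs -> disc v /\ vertices G (t v)) ->
  (forall z, disc z -> vertices G (t z) -> exists w', vertex_word A G (t z) w' /\
     forall y, foldl act y w' = iter (z \in vs) nu y) ->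
  forall y, foldl act y w = iter (size vs) nu y.
Proof.
move=> uvs rd vsP vwP y.
have /choice[tinv tinvP] : forall b, exists z : 'rV[R]_2, forall u, box u -> t u = b -> u = z.
  move=> b; have [[z [bz ez]]|no] := pselect (exists z, box z /\ t z = b).
    by exists z => u bu eu; apply: (emb_inj tE) => //; rewrite eu.
  by exists 0 => u bu eu; exfalso; apply: no; exists u.
have tinvK z : box z -> tinv (t z) = z by move=> bz; rewrite -(tinvP (t z) z bz erefl).
have in0 : (0 : R) \in `[0, 1] by rewrite in_itv /= lexx ler01.
have in1 : (1 : R) \in `[0, 1] by rewrite in_itv /= lexx ler01.
(* A point of [vs] on the circle would be a vertex on a path whose word is read. *)
have vs_in v : v \in vs -> sqnorm v < 4^-1.
  move=> /vsP[/disc_sqnorm dv vv]; rewrite lt_neqAle dv andbT; apply/eqP => e.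
  have [|s [s01 es]] := @circle_pt_surj R v.
    by rewrite /bdisc /=; move: e; rewrite /sqnorm => ->; field.
  by apply: (circle_not_vertex rd s01); rewrite circleE es.
have [rho [r4 r1 rP]] := vertex_free_collar.
have LS := twisted_local_system fG actK nuK tE vs tinv.
pose C : set 'rV[R]_2 := [set z | sqnorm z < rho].
have Cb : C `<=` box by move=> z /= h; apply: sqnorm_box; exact: lt_le_trans h r1.
have sC : starshaped 0 C by apply: starshaped_sqnorm; lra.
have ext : extendable Om (twisted A G act nu t vs tinv) (t @` C).
  apply: (extendable_starshaped tE LS Cb (@open_sqnorm rho) sC) => z Cz.
  have [vz|nv] := pselect (vertices G (t z)).
    have [w' [vw' aw']] := vwP z (rP z Cz vz) vz.
    exact: (twisted_extendable_vertex hB hA fG actK nuA nuK tE tinvK uvs (Cb _ Cz) vz vw' aw').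
  apply: (twisted_extendable hB hA fG actK nuA nuK tE tinvK (Cb _ Cz)) => //.
  by apply/negP => /vsP[].
have Ccirc s : C (circle_pt s).
  rewrite /C /= /sqnorm circle_pt_norm; apply: le_lt_trans r4.
  by rewrite (_ : 2^-1 ^+ 2 = 4^-1 :> R) //; field.
have O0 : Om (circle t 0).
  case: rd => _ _ tin tP _ /(tP 0 in0) /tin; by rewrite in_itv /= ltxx.
have [|f [sf ef]] := ext (circle t 0) y _ O0; first by exists (circle_pt 0).
pose n s := count (fun v => past v s) vs.
have Hw : iter (n 1) nu (f (circle t 1)) = foldl act (iter (n 0) nu (f (circle t 0))) w.
  apply: (walk actK (F := fun s => iter (n s) nu (f (circle t s))) rd) => s s01.
  have [_ _ tw] : twisted A G act nu t vs tinv (circle t s) f.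
    by apply: sf; exists (circle_pt s).
  have fl := tw (circle_not_vertex rd s01).
  rewrite /twisted_flat circleE tinvK in fl; last exact: circle_pt_box.
  have [e he] : exists e : bool, \forall r \near s, setT r ->
      odd (count (fun v => below v (circle_pt s) (circle_pt r)) vs +
           count (fun v => past v r) vs) = e.
    apply: (near_parity (a := fun v r => below v (circle_pt s) (circle_pt r))
       (b := fun v r => past v r)) => v /vs_in vin.
    by have [e he] := past_below vin s01; exists e; apply: filterS he.
  exists (iter e nu \o (fun b' => iter (twist vs (circle_pt s) (tinv b')) nu (f b'))); split.
    by apply: flat_equivariant fl => z l; apply: iter_nuA.
  apply: filterS he => r /(_ I) hr _ _ /=.
  rewrite circleE tinvK; last exact: circle_pt_box.
  rewrite -iterD [LHS](iter_odd nuK) [RHS](iter_odd nuK).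
    congr (iter (nat_of_bool _) _ _).
  by rewrite oddD oddb -hr oddD -addbA addbC -addbA addbb addbF.
have n0 : n 0 = 0%N.
  by apply/eqP; rewrite -leqn0 leqNgt -has_count; apply/hasPn => v _; rewrite past0.
have n1 : n 1 = size vs.
  by apply/eqP; rewrite -all_count; apply/allP => v _; rewrite past1.
have e10 : circle t 1 = circle t 0 by rewrite !circleE circle_pt0 circle_pt1.
by rewrite n0 n1 e10 ef /= in Hw.
Qed.

End Disc.

(** * The Burau action *)

Lemma iota_rcons m : iota 0 m.+1 = rcons (iota 0 m) m.
Proof. by rewrite -cats1 -[m.+1]addn1 iotaD. Qed.

Section CommonZero.
Variables (F : fieldType) (n m : nat) (phi : nat -> 'rV[F]_n -> F).

Lemma common_zero : (m < n)%N ->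
  (forall k a b c, phi k (a *: b + c) = a * phi k b + phi k c) ->
  exists b, b != 0 /\ forall k, (k < m)%N -> phi k b = 0.
Proof.
move=> mn lin.
pose M := \matrix_(i < n, k < m) phi k (delta_mx 0 i).
have : kermx M != 0.
  by rewrite -mxrank_eq0 mxrank_ker -lt0n subn_gt0 (leq_ltn_trans (rank_leq_col _)).
case/rowV0Pn => b /sub_kermxP bM b0; exists b; split=> // k km.
have phi0 : phi k 0 = 0.
  have := lin k 1 0 0; rewrite scale1r addr0 mul1r => /eqP.
  by rewrite -subr_eq subrr eq_sym => /eqP.
have phiD a c : phi k (a + c) = phi k a + phi k c by have := lin k 1 a c; rewrite scale1r mul1r.
have phiZ a c : phi k (a *: c) = a * phi k c by have := lin k a c 0; rewrite !addr0 phi0 addr0.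
rewrite (row_sum_delta b) (big_morph (phi k) phiD phi0).
have /rowP/(_ (Ordinal km)) := bM; rewrite !mxE => e.
rewrite -[RHS]e; apply: eq_bigr => i _; rewrite phiZ mxE; congr (_ * phi _ _).
Qed.

End CommonZero.

(* The Burau action: B_(N+1) acts on (N+1)-colorings by the Alexander quandle
   x * y = t y + (1 - t) x, rescaled by c. *)
Section Burau.
Variables (F : fieldType) (c t : F) (N : nat).
Implicit Types (h : nat -> F) (l : nat * bool).

(** Colorings are sequences indexed by all natural numbers here, so that the relations are checked
    entry by entry; [rowf] later keeps the first N+1 entries. *)
Definition burau_step h l : nat -> F := fun j =>
  if l.2 then
    c^-1 * (if j == l.1 then h l.1.+1
            else if j == l.1.+1 then t^-1 * (h l.1 - (1 - t) * h l.1.+1) else h j)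
  else
    c * (if j == l.1 then t * h l.1.+1 + (1 - t) * h l.1
         else if j == l.1.+1 then h l.1 else h j).

Lemma burau_stepC h i j : (i.+1 < j)%N ->
  burau_step (burau_step h (i, false)) (j, false) =
  burau_step (burau_step h (j, false)) (i, false).
Proof.
move=> ij; apply/funext => k; rewrite /burau_step /=.
have h1 : (i == j) = false by lia.
have h2 : (i.+1 == j) = false by lia.
have h3 : (j == i) = false by lia.
have h4 : (j == i.+1) = false by lia.
have h5 : (i == j.+1) = false by lia.
have h6 : (j.+1 == i) = false by lia.
have h7 : (j.+1 == i.+1) = false by lia.
have h8 : (i.+1 == j.+1) = false by lia.
rewrite h1 h2 h3 h4 h5 h6 h7 h8.
case: (eqVneq k i) => [->|ki]; first by rewrite h1 h5; ring.
case: (eqVneq k i.+1) => [->|ki']; first by rewrite h2 h8; ring.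
by case: (k == j) => //; case: (k == j.+1) => //; ring.
Qed.

Lemma burau_step_braid h i :
  burau_step (burau_step (burau_step h (i, false)) (i.+1, false)) (i, false) =
  burau_step (burau_step (burau_step h (i.+1, false)) (i, false)) (i.+1, false).
Proof.
apply/funext => k; rewrite /burau_step /= !eqxx.
have h1 : (i == i.+1) = false by lia.
have h2 : (i.+1 == i) = false by lia.
have h3 : (i == i.+2) = false by lia.
have h4 : (i.+2 == i) = false by lia.
have h5 : (i.+2 == i.+1) = false by lia.
have h6 : (i.+1 == i.+2) = false by lia.
rewrite !(h1, h2, h3, h4, h5, h6).
case: (eqVneq k i) => [->|ki]; first by rewrite !(h1, h3); ring.
case: (eqVneq k i.+1) => [_|ki']; first by ring.
by case: (k == i.+2); ring.
Qed.

Lemma burau_iota h m : foldl burau_step h [seq (i, false) | i <- iota 0 m] =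
  fun j => c ^+ m * (if (j < m)%N then t * h j.+1 + (1 - t) * h 0%N
                     else if j == m then h 0%N else h j).
Proof.
elim: m => [|m IH].
  by apply/funext => j /=; rewrite expr0 mul1r; case: eqP => [->|].
rewrite iota_rcons map_rcons foldl_rcons IH /burau_step /=.
apply/funext => j; rewrite ltnn eqxx [in X in _ * (if _ then _ * X + _ else _)]ltnNge leqnSn /=.
rewrite (gtn_eqF (ltnSn m)) exprS ltnS.
case: (ltngtP j m) => [jm|jm|->].
- by rewrite ltn_eqF 1?ltnW // mulrA.
- by case: eqP => _; rewrite mulrA.
- by ring.
Qed.

(** The entry at 0 is left unspecified: on colorings of weight 0 it is determined by the others. *)
Lemma burau_rev_iota h m : exists z,
  foldl burau_step h [seq (i, false) | i <- rev (iota 0 m)] =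
  fun j => if j == 0%N then z else c ^+ m * (if (j <= m)%N then h j.-1 else h j).
Proof.
elim: m h => [|m IH] h.
  exists (h 0%N); apply/funext => j /=; rewrite expr0 mul1r.
  by case: j.
rewrite iota_rcons rev_rcons /=.
have [z ->] := IH (burau_step h (m, false)); exists z; apply/funext => -[//|j] /=.
rewrite /burau_step /= ltnS exprSr -mulrA; congr (_ * _).
case: (ltngtP j m) => [jm|jm|->].
- by have -> : (j == m.+1) = false by lia.
- by rewrite gtn_eqF 1?ltnW // eqSS gtn_eqF.
- by rewrite eqxx gtn_eqF.
Qed.

Hypotheses (c0 : c != 0) (t0 : t != 0).

Lemma burau_stepK h l : burau_step (burau_step h l) (l.1, ~~ l.2) = h.
Proof.
case: l => i [] /=; apply/funext => j; rewrite /burau_step /=.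
all: rewrite !eqxx (gtn_eqF (ltnSn i)); case: (eqVneq j i) => [->|ji];
  last (case: (eqVneq j i.+1) => [->|ji']).
all: by field; rewrite ?c0 ?t0.
Qed.

(** Idempotence of the quandle: a crossing between equal colors changes nothing but the scale. *)
Lemma burau_fixed h (w : seq (nat * bool)) e : all (fun l => (l.2 == e) && (h l.1 == h l.1.+1)) w ->
  foldl burau_step h w = fun j => (if e then c^-1 else c) ^+ size w * h j.
Proof.
elim: w h => [|[i e'] w IH] h /=.
  by move=> _; apply/funext => j; rewrite mul1r.
move=> /andP[/andP[/eqP-> /eqP hi] hw].
have step : burau_step h (i, e) = fun j => (if e then c^-1 else c) * h j.
  apply/funext => j; rewrite /burau_step /= -hi; case: (e).
    case: eqP => [->//|_]; case: eqP => [->|//].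
    by rewrite -hi; field; rewrite c0 t0.
  case: eqP => [->|_]; first by ring.
  by case: eqP => [->|//]; rewrite -hi.
rewrite step IH.
  by apply/funext => j; rewrite exprSr mulrA.
apply: sub_all hw => l /andP[-> /eqP->]; by rewrite eqxx.
Qed.

Hypothesis tN : t ^+ N.+1 = 1.

(** Modulo constants, the product of all the generators is the cyclic shift of the entries times
    [c ^+ N * t]; the wrap-around entry fits because t h(0) + (1 - t) h(0) = h(0). *)
Lemma burau_full_twist h k : exists a, forall j, (j <= N)%N ->
  iter k (fun h => foldl burau_step h [seq (i, false) | i <- iota 0 N]) h j =
  (c ^+ N * t) ^+ k * h ((j + k) %% N.+1)%N + a.
Proof.
elim: k => [|k [a IH]].
  by exists 0 => j jN /=; rewrite expr0 mul1r addr0 addn0 modn_small.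
set h' := iter k _ h in IH.
exists (c ^+ N * t * a + c ^+ N * (1 - t) * h' 0%N) => j jN.
rewrite iterS burau_iota -/h'.
have -> : (if (j < N)%N then t * h' j.+1 + (1 - t) * h' 0%N else if j == N then h' 0%N else h' j) =
    t * h' (j.+1 %% N.+1)%N + (1 - t) * h' 0%N.
  have [lt|ge] := ltnP j N; first by rewrite modn_small.
  have -> : j = N by apply/eqP; rewrite eqn_leq jN.
  by rewrite eqxx modnn; ring.
rewrite IH; last by rewrite -ltnS ltn_pmod.
rewrite modnDml addSnnS exprS; ring.
Qed.

Definition rowf h : 'rV[F]_N.+1 := \row_j h j.
Definition entry (b : 'rV[F]_N.+1) : nat -> F := fun j => b 0 (inord j).

Lemma entryK b : rowf (entry b) = b.
Proof. by apply/rowP => j; rewrite mxE /entry inord_val. Qed.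

Lemma entry_rowf h j : (j <= N)%N -> entry (rowf h) j = h j.
Proof. by move=> jN; rewrite /entry mxE inordK. Qed.

Lemma entry0 b : entry b 0 = b 0 0.
Proof. by rewrite /entry (_ : inord 0 = 0) //; apply: val_inj; rewrite /= inordK. Qed.

Lemma rowfP h h' : (forall j, (j <= N)%N -> h j = h' j) -> rowf h = rowf h'.
Proof. by move=> e; apply/rowP => j; rewrite !mxE e // -ltnS. Qed.

Definition burau_row (b : 'rV[F]_N.+1) l : 'rV[F]_N.+1 := rowf (burau_step (entry b) l).

Lemma burau_rowf h l : (l.1 < N)%N -> burau_row (rowf h) l = rowf (burau_step h l).
Proof.
move=> lN; apply: rowfP => j jN; rewrite /burau_step.
by rewrite !entry_rowf // ltnW.
Qed.

Lemma foldl_burau_rowf h w : all (fun l : nat * bool => (l.1 < N)%N) w ->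
  foldl burau_row (rowf h) w = rowf (foldl burau_step h w).
Proof.
by elim: w h => [//|l w IH] h /= /andP[lN wN]; rewrite burau_rowf // IH.
Qed.

Lemma burau_rowK b l : (l.1 < N)%N -> burau_row (burau_row b l) (l.1, ~~ l.2) = b.
Proof. by move=> lN; rewrite {2}/burau_row burau_rowf // burau_stepK entryK. Qed.

Lemma burau_row_linear a b b' l : burau_row (a *: b + b') l = a *: burau_row b l + burau_row b' l.
Proof.
apply/rowP => j; rewrite !mxE /burau_step /entry !mxE; case: (l) => i [] /=.
all: by case: (_ == _); [ring|case: (_ == _); ring].
Qed.

Lemma foldl_burau_linear a b b' w :
  foldl burau_row (a *: b + b') w = a *: foldl burau_row b w + foldl burau_row b' w.
Proof. by elim: w b b' => [//|l w IH] b b' /=; rewrite burau_row_linear IH. Qed.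

Lemma burau_row_const a l : exists a', burau_row (const_mx a) l = const_mx a'.
Proof.
exists ((if l.2 then c^-1 else c) * a); apply/rowP => j; rewrite !mxE /burau_step /entry !mxE.
case: (l) => i [] /=; last by case: (_ == _); [ring|case: (_ == _); ring].
by case: (_ == _); [ring|case: (_ == _) => //; field; rewrite c0 t0].
Qed.

Implicit Types b : 'rV[F]_N.+1.

(** The invariant linear form of the Burau representation: t^i (t x + (1 - t) y) + t^(i+1) y = t^i y
    + t^(i+1) x, so a letter only rescales it. *)
Definition weight b : F := \sum_(j < N.+1) t ^+ j * b 0 j.

Lemma weight_linear a b b' : weight (a *: b + b') = a * weight b + weight b'.
Proof.
rewrite /weight mulr_sumr -big_split; apply: eq_bigr => j _ /=; rewrite !mxE; ring.
Qed.

Hypothesis t1 : t != 1.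

(** The sum of the powers of a nontrivial root of unity vanishes; hence weight 0 makes sense modulo
    constants. *)
Lemma weight_const a : weight (const_mx a) = 0.
Proof.
rewrite /weight (eq_bigr (fun j : 'I_N.+1 => t ^+ j * a)); last by move=> j _; rewrite mxE.
rewrite -mulr_suml; have := subrX1 t N.+1; rewrite tN subrr => /esym/eqP.
by rewrite mulf_eq0 subr_eq0 (negbTE t1) /= => /eqP->; rewrite mul0r.
Qed.

Lemma weight_sum2 (h : nat -> F) i : (i < N)%N ->
  weight (rowf h) = t ^+ i * h i + t ^+ i.+1 * h i.+1 +
    \sum_(j < N.+1 | (j != i :> nat) && (j != i.+1 :> nat)) t ^+ j * h j.
Proof.
move=> iN; have i1 : (i < N.+1)%N by rewrite ltnW.
rewrite /weight (bigD1 (Ordinal i1)) //= (bigD1 (Ordinal (iN : (i.+1 < N.+1)%N))) /=; last first.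
  by rewrite -val_eqE /= gtn_eqF.
rewrite !mxE addrA; congr (_ + _); apply: eq_big => j; last by rewrite mxE.
by rewrite -!val_eqE.
Qed.

Lemma weight_burau b l : (l.1 < N)%N ->
  weight (burau_row b l) = (if l.2 then c^-1 else c) * weight b.
Proof.
move=> lN; rewrite -{2}(entryK b) /burau_row !(weight_sum2 _ lN) mulrDr; congr (_ + _).
  rewrite /burau_step; case: (l) lN => i [] /= _; rewrite !eqxx (gtn_eqF (ltnSn i)) exprS.
    by field; rewrite c0 t0.
  by ring.
rewrite mulr_sumr; apply: eq_bigr => j /andP[/negbTE ji /negbTE ji'].
by rewrite /burau_step ji ji'; case: (l.2); ring.
Qed.

(** The normal form modulo constants. Representing classes by vectors with first entry 0 stands in
    for a quotient type. *)
Definition recenter b : 'rV[F]_N.+1 := b - const_mx (b 0 0).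

Lemma recenter0 b : recenter b 0 0 = 0.
Proof. by rewrite !mxE subrr. Qed.

Lemma recenter_id b : b 0 0 = 0 -> recenter b = b.
Proof. by move=> e; rewrite /recenter e; apply/rowP => j; rewrite !mxE subr0. Qed.

Lemma recenter_const b a : recenter (b + const_mx a) = recenter b.
Proof. apply/rowP => j; rewrite !mxE; ring. Qed.

Lemma weight_recenter b : weight (recenter b) = weight b.
Proof.
have -> : recenter b = (-1) *: const_mx (b 0 0) + b by rewrite scaleN1r addrC.
by rewrite weight_linear weight_const mulr0 add0r.
Qed.

Lemma burau_recenter b l : recenter (burau_row (recenter b) l) = recenter (burau_row b l).
Proof.
have -> : recenter b = (-1) *: const_mx (b 0 0) + b by rewrite scaleN1r addrC.
have [a ea] := burau_row_const (b 0 0) l.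
rewrite burau_row_linear ea scaleN1r addrC.
have -> : - const_mx a = const_mx (- a) :> 'rV[F]_N.+1 by apply/rowP => j; rewrite !mxE.
exact: recenter_const.
Qed.

(* Colorings of total weight 0, modulo the constant ones. *)
Record coloring := Coloring {
  cval :> 'rV[F]_N.+1; cvalP : (weight cval == 0) && (cval 0 0 == 0) }.

Lemma coloring_inj (x y : coloring) : x = y :> 'rV[F]_N.+1 -> x = y.
Proof.
by case: x y => x xP [y yP] /= e; subst y; congr Coloring; exact: bool_irrelevance.
Qed.

Lemma burau_act_subproof (x : coloring) (l : 'I_N * bool) :
  let b := recenter (burau_row x (val l.1, l.2)) in (weight b == 0) && (b 0 0 == 0).
Proof.
case: x => b /= /andP[/eqP wb _].
by rewrite recenter0 eqxx andbT weight_recenter weight_burau //= wb mulr0.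
Qed.

Definition burau_act x (l : 'I_N * bool) : coloring := Coloring (burau_act_subproof x l).

Lemma burau_opp_subproof (x : coloring) : (weight (- cval x) == 0) && ((- cval x) 0 0 == 0).
Proof.
case: x => b /= /andP[/eqP wb /eqP b0].
have -> : - b = (-1) *: b + 0 by rewrite addr0 scaleN1r.
have w0 : weight 0 = 0 by rewrite /weight big1 // => j _; rewrite mxE mulr0.
by rewrite weight_linear wb w0 mulr0 addr0 eqxx !mxE b0 mulr0 addr0 eqxx.
Qed.

Definition burau_opp x : coloring := Coloring (burau_opp_subproof x).

Lemma burau_oppK : involutive burau_opp.
Proof. by move=> x; apply: coloring_inj; rewrite /= opprK. Qed.

Lemma burau_oppA y (l : 'I_N * bool) : burau_opp (burau_act y l) = burau_act (burau_opp y) l.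
Proof.
apply: coloring_inj => /=.
have -> : - cval y = (-1) *: cval y + 0 by rewrite addr0 scaleN1r.
rewrite burau_row_linear.
have -> : burau_row 0 (val l.1, l.2) = 0.
  have := burau_row_linear 1 0 0 (val l.1, l.2); rewrite scale1r addr0 scale1r.
  by move/eqP; rewrite -subr_eq subrr eq_sym => /eqP.
rewrite addr0 scaleN1r; apply/rowP => j; rewrite !mxE; ring.
Qed.

Lemma burau_actK y (l : 'I_N * bool) : burau_act (burau_act y l) (l.1, ~~ l.2) = y.
Proof.
apply: coloring_inj => /=; rewrite burau_recenter.
have := @burau_rowK (cval y) (val l.1, l.2); rewrite /= => -> //.
by apply: recenter_id; case: y => b /= /andP[_ /eqP].
Qed.

Definition nat_word (w : seq ('I_N * bool)) : seq (nat * bool) :=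
  [seq (val l.1, l.2) | l : 'I_N * bool <- w].

Lemma nat_word_lt (w : seq ('I_N * bool)) : all (fun l : nat * bool => (l.1 < N)%N) (nat_word w).
Proof. by apply/allP => _ /mapP[l _ ->] /=. Qed.

Lemma foldl_burau_act y (w : seq ('I_N * bool)) :
  foldl burau_act y w = recenter (foldl burau_row (cval y) (nat_word w)) :> 'rV[F]_N.+1.
Proof.
elim/last_ind: w => [|w l IH].
  by rewrite /= recenter_id //; case: y => b /= /andP[_ /eqP].
by rewrite foldl_rcons /nat_word map_rcons foldl_rcons /= IH burau_recenter.
Qed.

Lemma foldl_burau_act_rowf y (w : seq ('I_N * bool)) :
  foldl burau_act y w =
  recenter (rowf (foldl burau_step (entry (cval y)) (nat_word w))) :> 'rV[F]_N.+1.
Proof. by rewrite foldl_burau_act -{1}(entryK (cval y)) foldl_burau_rowf // nat_word_lt. Qed.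

Lemma burau_act_id y (w : seq ('I_N * bool)) :
  foldl burau_step (entry (cval y)) (nat_word w) = entry (cval y) -> foldl burau_act y w = y.
Proof.
move=> e; apply: coloring_inj; rewrite foldl_burau_act_rowf e entryK recenter_id //.
by case: y {e} => b /= /andP[_ /eqP].
Qed.

End Burau.

(** * Words acting by a central involution *)

Section ScalarWords.
Variables (L Y : Type) (act : Y -> L * bool -> Y) (nu : Y -> Y).
Hypothesis actK : forall y l, act (act y l) (l.1, ~~ l.2) = y.
Hypotheses (nuA : forall y l, nu (act y l) = act (nu y) l) (nuK : involutive nu).

Lemma foldl_scalar y (w : word L) : nu (foldl act y w) = foldl act (nu y) w.
Proof. by elim: w y => [//|l w IH] y /=; rewrite IH nuA. Qed.

Lemma scalar_word_inv (w : word L) : (forall y, foldl act y w = nu y) ->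
  forall y, foldl act y (word_inv w) = nu y.
Proof. by move=> aw y; rewrite -{1}(nuK y) -aw foldl_word_inv. Qed.

(** A rotation conjugates the word by a prefix, and [nu] commutes with the action. *)
Lemma scalar_cyclic_perm (w r : word L) : cyclic_perm w r ->
  (forall y, foldl act y r = nu y) -> forall y, foldl act y w = nu y.
Proof.
move=> [k ->] ar y; rewrite /rot -{1}(foldl_word_invK actK y (take k r)).
rewrite -foldl_cat catA foldl_cat [foldl act _ (take k r ++ _)]foldl_cat.
set z := foldl act y (word_inv _).
rewrite -[foldl act (foldl act z _) _]foldl_cat cat_take_drop ar -foldl_scalar.
by rewrite foldl_word_invK.
Qed.

End ScalarWords.

(** * The relators and the words of black vertices in the Burau action *)

Section Relators.
Variables (F : fieldType) (c t : F) (g : nat).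
Let N := (2 * g + 1)%N.
Hypotheses (c0 : c != 0) (t0 : t != 0) (tN : t ^+ N.+1 = 1) (t1 : t != 1).
Hypotheses (ct : c ^+ N * c ^+ N * t = 1) (cN : c ^+ (N * N.+1) = -1).

Let act := burau_act c0 t0 tN t1.

Lemma nat_word_chain n : (n <= N)%N ->
  nat_word (chain g n) = [seq (i, false) | i <- iota 0 n].
Proof.
move=> nN; rewrite /nat_word /chain -map_comp.
rewrite (map_comp (fun i => (i, false)) val) map_take val_enum_ord take_iota.
by congr (map _ (iota _ _)); apply/minn_idPl.
Qed.

Lemma r1_act y (i j : X0 g) : (i.+1 < j)%N -> foldl act y (r1 i j) = y.
Proof.
move=> ij; apply: burau_act_id => /=.
rewrite (burau_stepC c t _ ij).
by rewrite (burau_stepK c0 t0 _ (val i, false)) (burau_stepK c0 t0 _ (val j, false)).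
Qed.

Lemma r2_act y (i j : X0 g) : j = i.+1 :> nat -> foldl act y (r2 i j) = y.
Proof.
move=> ij; apply: burau_act_id => /=; rewrite ij burau_step_braid //.
rewrite (burau_stepK c0 t0 _ (i.+1, false)) (burau_stepK c0 t0 _ (val i, false)).
by rewrite (burau_stepK c0 t0 _ (i.+1, false)).
Qed.

(** As the first entry of [y] is 0, the word multiplies every other entry by [c ^+ N * c ^+ N * t],
    which is 1; the first entry of the result is then 0 because its weight is. *)
Lemma r3_act y : foldl act y (r3 g) = y.
Proof.
apply: coloring_inj; rewrite foldl_burau_act_rowf.
have [/eqP wy /eqP y0] := andP (cvalP y).
have := cvalP (foldl act y (r3 g)); rewrite foldl_burau_act_rowf => /andP[/eqP wr _].
rewrite weight_recenter // in wr; move: wr.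
rewrite /nat_word /r3 map_cat map_rev -/(nat_word _) nat_word_chain // foldl_cat burau_iota.
rewrite -map_rev.
set d := fun j => _; have [z ->] := burau_rev_iota c t d N.
set r := fun j => _.
have rE j : (0 < j <= N)%N -> r j = entry (cval y) j.
  move=> /andP[j0 jN]; rewrite /r gtn_eqF // jN /d.
  have -> : (j.-1 < N)%N by rewrite prednK.
  rewrite prednK // entry0 y0.
  by rewrite mulr0 addr0 !mulrA ct mul1r.
rewrite /weight big_ord_recl mxE expr0 mul1r.
have w2 := wy; rewrite /weight big_ord_recl y0 mulr0 add0r in w2.
rewrite (eq_bigr (fun i : 'I_N => t ^+ lift ord0 i * cval y 0 (lift ord0 i))); last first.
  move=> i _; rewrite mxE rE; last by rewrite lift0 /= ltn_ord.
  by rewrite /entry inord_val.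
rewrite w2 addr0 => r0.
rewrite (_ : rowf N r = cval y); first by rewrite recenter_id.
apply/rowP => j; rewrite mxE; case: (posnP j) => [j0|j0].
  by rewrite j0 r0 (_ : j = 0) ?y0 //; exact: val_inj.
rewrite rE; last by rewrite j0 -ltnS ltn_ord.
by rewrite /entry inord_val.
Qed.

(** N+1 cyclic shifts restore the order of the entries, and the accumulated factor is c^(N(N+1))
    t^(N+1) = -1. *)
Lemma r4_act y : foldl act y (r4 g) = burau_opp y.
Proof.
apply: coloring_inj; rewrite foldl_burau_act_rowf /=.
have [/eqP wy /eqP y0] := andP (cvalP y).
have -> : foldl (burau_step c t) (entry (cval y)) (nat_word (r4 g)) =
    iter N.+1 (fun h => foldl (burau_step c t) h [seq (i, false) | i <- iota 0 N]) (entry (cval y)).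
  rewrite /r4 /word_exp (_ : 2 * g + 2 = N.+1)%N; last by rewrite -addnS.
  move: (entry _); elim: (N.+1) => [//|k IH] h.
  by rewrite [nseq _ _]/= [flatten _]/= /nat_word map_cat foldl_cat -/(nat_word _)
    nat_word_chain // IH iterSr.
have [a ha] := burau_full_twist c t N (entry (cval y)) N.+1.
rewrite (rowfP (h' := fun j => - entry (cval y) j + a)); last first.
  move=> j jN; rewrite ha // modnDr modn_small // exprMn -exprM tN mulr1 cN mulN1r //.
have -> : rowf N (fun j => - entry (cval y) j + a) = - cval y + const_mx a.
  by apply/rowP => j; rewrite !mxE /entry inord_val.
by rewrite recenter_const recenter_id // !mxE y0 oppr0.
Qed.

Lemma foldl_burau_row_fixed b e (w : seq (nat * bool)) :
  all (fun l : nat * bool => (l.1 < N)%N) w ->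
  all (fun l : nat * bool => (l.2 == e) && (entry b l.1 == entry b l.1.+1)) w ->
  foldl (burau_row c t (N := N)) b w = (if e then c^-1 else c) ^+ size w *: b.
Proof.
move=> wN wf; rewrite -{1}(entryK b) foldl_burau_rowf // (burau_fixed c0 t0 wf).
by apply/rowP => j; rewrite !mxE /entry inord_val.
Qed.

(* As g is odd, 2h <= g-1 for all h <= g./2. *)
Lemma S0_shape (s : word (X0 g)) : (2 <= g)%N -> odd g -> S0 s -> exists (I : seq nat) e,
  [/\ (size I <= g.-1)%N, (size s <= 2 * g * g.-1)%N &
    forall l : nat * bool, l \in nat_word s -> l.2 = e /\ l.1 \in I].
Proof.
move=> g2 go; have g3 : (2 < g)%N by case: (g) go g2 => [|[|[|]]].
have ellP h : (1 <= h <= g./2)%N -> [/\ (size (iota 0 (2 * h)) <= g.-1)%N,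
    (size (ell g h) <= 2 * g * g.-1)%N &
    forall l : nat * bool, l \in nat_word (ell g h) -> l.2 = false /\ l.1 \in iota 0 (2 * h)].
  move=> /andP[h1 hg]; have gE := odd_double_half g; rewrite go in gE.
  have hN : (2 * h <= N)%N by rewrite /N; lia.
  split; first by rewrite size_iota; lia.
    have -> : size (ell g h) = ((4 * h + 2) * (2 * h))%N.
      rewrite /ell /word_exp size_flatten /shape map_nseq sumn_nseq mulnC; congr (_ * _)%N.
      by rewrite /chain size_map size_take size_enum_ord; case: ltnP => // ?; lia.
    (* The length of [ell g h] is (4h + 2)(2h), at most 2g(g - 1). Bounded lengths will keep the
       eigenvalues away from -1. *)
    have a1 : (4 * h + 2 <= 2 * g)%N by lia.
    have a2 : (2 * h <= g.-1)%N by lia.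
    exact: leq_mul a1 a2.
  move=> l; rewrite /nat_word /ell /word_exp.
  elim: (4 * h + 2)%N => [//|k IH]; rewrite /= map_cat mem_cat => /orP[|]; last exact: IH.
  rewrite -/(nat_word _) nat_word_chain // => /mapP[i ii ->]; by [].
have invP s' (I : seq nat) e :
    (forall l : nat * bool, l \in nat_word s' -> l.2 = e /\ l.1 \in I) ->
    forall l : nat * bool, l \in nat_word (word_inv s') -> l.2 = ~~ e /\ l.1 \in I.
  move=> h l; rewrite /nat_word /word_inv map_rev mem_rev -map_comp => /mapP[x xs ->] /=.
  have [e1 e2] := h (val x.1, x.2) (map_f (fun l => (val l.1, l.2)) xs).
  by rewrite /= in e1 e2; rewrite e1.
case=> [[i [->|->]]|[h [hg [->|->]]]].
- exists [:: val i], false; split=> /=; [by lia|by lia|].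
  by move=> l; rewrite inE => /eqP->; rewrite mem_head.
- exists [:: val i], true; split=> /=; [by lia|by lia|].
  by move=> l; rewrite inE => /eqP->; rewrite mem_head.
- by have [h1 h2 h3] := ellP h hg; exists (iota 0 (2 * h)), false.
- have [h1 h2 h3] := ellP h hg; exists (iota 0 (2 * h)), true; split=> //.
    by rewrite /word_inv size_rev size_map.
  exact: (invP _ _ _ false h3).
Qed.

Lemma nat_word_inv (w : word 'I_N) : nat_word (word_inv w) = word_inv (nat_word w).
Proof. by rewrite /nat_word /word_inv map_rev -!map_comp. Qed.

Lemma foldl_burau_row_inv b (w : seq (nat * bool)) : all (fun l : nat * bool => (l.1 < N)%N) w ->
  foldl (burau_row c t (N := N)) (foldl (burau_row c t (N := N)) b w) (word_inv w) = b.
Proof.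
elim/last_ind: w b => [//|w l IH] b; rewrite all_rcons => /andP[lN wN].
by rewrite word_inv_rcons foldl_rcons /= burau_rowK // IH.
Qed.

Hypothesis c_small : forall x y, (x < N * N.+1)%N -> (y < N * N.+1)%N -> c ^+ x != - c ^+ y.

(* The vector b is in the common kernel of the at most 2(g-1) gaps, of the weight
   and of the first coordinate, in a space of dimension 2g+2 = 2(g-1) + 4. *)
Lemma no_scalar_opp (s s' u : word 'I_N) : (2 <= g)%N -> odd g -> S0 s -> S0 s' ->
  ~ forall y, foldl act y (u ++ s ++ word_inv u ++ word_inv s') = burau_opp y.
Proof.
move=> g2 go Ss Ss' H.
have [I [e [sI ss hI]]] := S0_shape g2 go Ss.
have [I' [e' [sI' ss' hI']]] := S0_shape g2 go Ss'.
pose row := foldl (burau_row c t (N := N)).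
pose gap (b : 'rV[F]_N.+1) i := entry b i - entry b i.+1.
(* The gaps for [s'] are taken on [b] and those for [s] on the image of [b] under [u], where [s] is
   applied; [u] and its inverse then cancel on the common eigenvector. The last two forms place [b]
   among the colorings. *)
pose phi k b :=
  if (k < size I')%N then gap b (nth 0%N I' k)
  else if (k < size I' + size I)%N then gap (row b (nat_word u)) (nth 0%N I (k - size I'))
  else if k == (size I' + size I)%N then weight t b else entry b 0.
have gapL a b b' i : gap (a *: b + b') i = a * gap b i + gap b' i.
  by rewrite /gap /entry !mxE; ring.
have [|k a b b'|b [b0 bP]] := @common_zero F N.+1 (size I' + size I + 2) phi.
- have a1 : (size I' + size I <= g.-1 + g.-1)%N by apply: leq_add.
  by rewrite /N; move: a1; lia.
- rewrite /phi; case: ifP => _; first exact: gapL.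
  case: ifP => _; first by rewrite /row foldl_burau_linear.
  by case: ifP => _; [exact: weight_linear|rewrite /entry !mxE].
have wb : weight t b = 0.
  have <- : phi (size I' + size I)%N b = weight t b.
    by rewrite /phi ltnNge leq_addr /= ltnn eqxx.
  by apply: bP; lia.
have bz : b 0 0 = 0.
  have <- : phi (size I' + size I).+1 b = b 0 0.
    have e1 : ((size I' + size I).+1 < size I')%N = false by lia.
    have e2 : ((size I' + size I).+1 < size I' + size I)%N = false by lia.
    by rewrite /phi e1 e2 gtn_eqF // entry0.
  by apply: bP; lia.
have gap' i : i \in I' -> entry b i = entry b i.+1.
  move=> iI; have iI' : (index i I' < size I')%N by rewrite index_mem.
  have e1 : phi (index i I') b = gap b i by rewrite /phi iI' nth_index.
  by apply/eqP; rewrite -subr_eq0 -/(gap b i) -e1 bP //; lia.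
have gapu i : i \in I -> entry (row b (nat_word u)) i = entry (row b (nat_word u)) i.+1.
  move=> iI; have iI' : (index i I < size I)%N by rewrite index_mem.
  have e1 : phi (size I' + index i I)%N b = gap (row b (nat_word u)) i.
    by rewrite /phi ltnNge leq_addr /= ltn_add2l iI' addKn nth_index.
  by apply/eqP; rewrite -subr_eq0 -/(gap _ i) -e1 bP //; lia.
have yP : (weight t b == 0) && (b 0 0 == 0) by rewrite wb bz !eqxx.
pose y := Coloring yP.
have := congr1 (@cval _ _ _) (H y).
rewrite foldl_burau_act /nat_word !map_cat -!/(nat_word _) !foldl_cat !nat_word_inv -/row /=.
have fixS : row (row b (nat_word u)) (nat_word s) =
    (if e then c^-1 else c) ^+ size s *: row b (nat_word u).
  rewrite /row (@foldl_burau_row_fixed _ e); [by rewrite /nat_word size_map|exact: nat_word_lt|].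
  by apply/allP => l /hI[-> /gapu el]; rewrite /row in el; rewrite el !eqxx.
have fixS' : row b (word_inv (nat_word s')) = (if ~~ e' then c^-1 else c) ^+ size s' *: b.
  rewrite /row (@foldl_burau_row_fixed _ (~~ e')).
  - by rewrite /word_inv size_rev !size_map.
  - by rewrite -nat_word_inv nat_word_lt.
  apply/allP => l; rewrite /word_inv mem_rev => /mapP[x /hI'[h1 h2] ->] /=.
  by rewrite h1 (gap' _ h2) !eqxx.
have rowZ a x w : row (a *: x) w = a *: row x w.
  have row0 : row 0 w = 0.
    have := @foldl_burau_linear F c t N 1 0 0 w; rewrite !scale1r addr0 -/row.
    by move/eqP; rewrite -subr_eq subrr eq_sym => /eqP.
  by rewrite -[a *: x]addr0 /row foldl_burau_linear -/row row0 addr0.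
have fixU : row (row b (nat_word u)) (word_inv (nat_word u)) = b.
  by apply: foldl_burau_row_inv; exact: nat_word_lt.
rewrite fixS rowZ fixU rowZ fixS' scalerA.
set kap := _ ^+ size s; set kap' := _ ^+ size s'.
rewrite recenter_id; last by rewrite mxE bz mulr0.
move=> /eqP; rewrite -subr_eq0 opprK -{2}(scale1r b) -scalerDl scaler_eq0 (negbTE b0) orbF.
rewrite addr_eq0 /kap /kap' {kap kap'}.
have cX k : c ^+ k != 0 by rewrite expf_neq0.
(* The lengths of [s] and [s'] add up to at most 4g(g - 1), within the range (2g + 1)(2g + 2) where
   [c_small] separates powers of [c] from opposites of powers. *)
have big : (2 * g * g.-1 + 2 * g * g.-1 < N * N.+1)%N by rewrite /N; nia.
have ls : (size s < N * N.+1)%N := leq_ltn_trans ss (leq_ltn_trans (leq_addr _ _) big).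
have ls' : (size s' < N * N.+1)%N := leq_ltn_trans ss' (leq_ltn_trans (leq_addr _ _) big).
have lss : (size s + size s' < N * N.+1)%N := leq_ltn_trans (leq_add ss ss') big.
have l0 : (0 < N * N.+1)%N := leq_ltn_trans (leq0n _) big.
(* The product of the eigenvalues of [s] and of the inverse of [s'] would be -1. In each case of
   signs, moving the negative powers to the other side contradicts [c_small]. *)
case: (e); case: (e') => /=; rewrite ?exprVn => /eqP h.
- have /eqP := c_small ls' ls; apply; rewrite -[LHS]mul1r -(divff (cX (size s))) mulrAC.
  by rewrite -mulrA mulrC [X in X * _]mulrC h mulN1r.
- have /eqP := c_small l0 lss; apply; rewrite expr0 exprD -[RHS]mulr1 mulNr mulr1.
  by rewrite -[RHS]mulrN1 -h -invfM divff ?mulf_neq0.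
- by have /eqP := c_small lss l0; apply; rewrite expr0 exprD.
- have /eqP := c_small ls ls'; apply.
  by rewrite -[LHS]mulr1 -(divff (cX (size s'))) mulrA mulrAC h mulN1r.
Qed.

End Relators.

(** * The transition move *)

Section Scaling.
Variables (R : realType) (B : topologicalType).

Lemma det_lin1_scale (f f' : 'rV[R]_2 -> 'rV[R]_2) (s : R) :
  (forall v, f' v = s *: f v) -> \det (lin1_mx f') = s ^+ 2 * \det (lin1_mx f).
Proof.
move=> e; rewrite -detZ; congr (\det _).
by apply/matrixP => i j; rewrite !mxE e mxE.
Qed.

Lemma positive_at_scale (k l : 'rV[R]_2 -> B) (s : R) z z' : 0 < s ->
  positive_at k l (s *: z) z' -> positive_at (fun y => k (s *: y)) l z z'.
Proof.
move=> s0 [h [hz hl hd hJ]].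
have scd y : differentiable (fun y : 'rV[R]_2 => s *: y) y.
  exact: (@differentiableZ _ _ _ id).
have scc : (fun y : 'rV[R]_2 => s *: y) y @[y --> z] --> s *: z.
  exact: (differentiable_continuous (scd z)).
exists (fun y => h (s *: y)); split.
- exact: hz.
- exact: (scc _ hl).
- exact: (differentiable_comp (scd z) hd).
have dg v : 'd (fun y : 'rV[R]_2 => s *: y) z v = s *: v.
  have sc : continuous (GRing.scale s : {linear 'rV[R]_2 -> 'rV[R]_2}).
    by move=> y; apply: differentiable_continuous; exact: scd.
  exact: (congr1 (fun F => F v) (diff_lin z sc)).
have e v := congr1 (fun F => F v) (diff_comp (scd z) hd).
have e' v : ('d h (s *: z) \o 'd (fun y : 'rV[R]_2 => s *: y) z) v = s *: 'd h (s *: z) v.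
  apply: etrans (congr1 ('d h (s *: z)) (dg v)) _.
  exact: (linearZ_LR ('d h (s *: z)) s v).
have e4 := det_lin1_scale (fun v => etrans (e v) (e' v)).
have p : 0 < s ^+ 2 * \det (lin1_mx ('d h (s *: z))).
  by apply: mulr_gt0; [rewrite exprn_gt0|exact: hJ].
exact: (eq_ind_r (fun x => 0 < x) p e4).
Qed.

Lemma box_scale (s : R) (z : 'rV[R]_2) : 0 < s <= 1 -> box z -> box (s *: z).
Proof.
move=> /andP[s0 s1] [h1 h2]; split; rewrite !cE normrM gtr0_norm //.
- by apply: le_lt_trans h1; rewrite ler_piMl.
- by apply: le_lt_trans h2; rewrite ler_piMl.
Qed.

Lemma scale_continuous (s : R) : continuous (fun y : 'rV[R]_2 => s *: y).
Proof. by move=> z; apply: differentiable_continuous; exact: (@differentiableZ _ _ _ id). Qed.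

Lemma open_embedding_scale (k : 'rV[R]_2 -> B) (s : R) : 0 < s <= 1 ->
  open_embedding k -> open_embedding (fun y => k (s *: y)).
Proof.
move=> s01 kE; have s0 : 0 < s by case/andP: s01.
split.
- move=> y z; rewrite !inE => by_ bz /(emb_inj kE (box_scale s01 by_) (box_scale s01 bz)).
  by apply: scalerI; rewrite gt_eqF.
- move=> z bz U Uk.
  exact: (scale_continuous (emb_cvg kE (box_scale s01 bz) Uk)).
- move=> U oU Ub; have -> : (fun y => k (s *: y)) @` U = k @` ((fun y => s^-1 *: y) @^-1` U).
    rewrite eqEsubset; split=> _ [z Uz <-].
      by exists (s *: z) => //=; rewrite scalerA mulVf ?scale1r // gt_eqF.
    by exists (s^-1 *: z) => //; rewrite scalerA divff ?scale1r // gt_eqF.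
  apply: (emb_open kE).
    by apply: open_comp => // z _; exact: scale_continuous.
  move=> z /= /Ub /(box_scale s01).
  by rewrite scalerA divff ?scale1r // gt_eqF.
Qed.

Variables (L : Type) (A : set ('rV[R]_2 -> B)) (G : graph R B L).

Lemma edge_at_scale p x k (s : R) : 0 < s <= 1 ->
  edge_at A G p x k -> edge_at A G p x (fun y => k (s *: y)).
Proof.
move=> s01 [[k0 kE kpos] nv sup [i [li [f [fm fd fa]]]]].
have s0 : 0 < s by case/andP: s01.
split.
- split; [by rewrite scaler0|exact: open_embedding_scale|].
  move=> l z z' Al bz bz' z0 e; apply: positive_at_scale => //.
  by apply: kpos => //; [exact: box_scale|rewrite scaler_eq0 gt_eqF].
- by move=> z bz; apply: nv; exact: box_scale.
- move=> z bz; have h := sup _ (box_scale s01 bz); rewrite cyZ in h.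
  split=> [/h/eqP|cz]; last by apply/h; rewrite cz mulr0.
  by rewrite mulf_eq0 gt_eqF //= => /eqP.
- have inr r : r \in `]-1, 1[ -> s * r \in `]-1, 1[.
    rewrite !in_itv /= -!ltr_norml normrM gtr0_norm // => h.
    by apply: le_lt_trans h; rewrite ler_piMl //; case/andP: s01.
  exists i; split=> //; exists (fun r => f (s * r)); split.
  + by move=> r r' hr hr' rr; apply: fm; [exact: inr|exact: inr|rewrite ltr_pM2l].
  + by move=> r hr; apply/fd/inr.
  + move=> r hr; rewrite -fa; last exact: inr.
    by congr (k _); apply: cxyP; rewrite !cE ?mulr0.
Qed.

Lemma edge_at_shrink p x k (N : set B) : edge_at A G p x k -> nbhs p N ->
  exists s, 0 < s <= 1 /\ forall z, box z -> N (k (s *: z)).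
Proof.
move=> E Np; have := Np; rewrite -(edge_at_center E) => /(emb_cvg (edge_at_emb E) (@box0 R)) h.
have /nbhs_squareP[e e0 sub] : nbhs (0 : 'rV[R]_2) (k @^-1` N) := h.
exists (Num.min e 1); split.
  by rewrite lt_min e0 ltr01 ge_min lexx orbT.
move=> z [h1 h2]; apply: sub.
have m0 : 0 < Num.min e 1 by rewrite lt_min e0 ltr01.
rewrite /square /= !cE !subr0 !normrM gtr0_norm //.
have me : Num.min e 1 <= e by rewrite ge_min lexx.
by split; apply: lt_le_trans me; rewrite gtr_pMr.
Qed.

End Scaling.

Section Outside.
Variables (R : realType) (B : topologicalType) (L : Type).
Variables (A : set ('rV[R]_2 -> B)) (D : set B).
Hypothesis cD : closed D.

(** The symmetric part of [same_outside] that carries vertex words over, with white and black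
    vertices merged. *)
Definition agree_outside (G G' : graph R B L) : Prop :=
  [/\ forall p, ~ D p -> (vertices G p <-> vertices G' p),
      forall p, ~ D p -> (graph_support G p <-> graph_support G' p) &
      forall p x k, k @` box `<=` ~` D -> (edge_at A G p x k <-> edge_at A G' p x k)].

Lemma agree_outside_sym G G' : agree_outside G G' -> agree_outside G' G.
Proof.
move=> [h1 h2 h3]; split=> [p /h1[]|p /h2[]|p x k /(h3 p x)[]]; by split.
Qed.

(** Only edge coordinates avoiding [D] are shared by the two graphs, so those at the crossing are
    shrunk; the factor is positive and keeps the two sides. *)
Lemma agree_crosses G G' (p : R -> B) t l : agree_outside G G' ->
  {within `[0, 1], continuous p} -> t \in `]0, 1[ -> ~ D (p t) ->
  crosses A G p t l -> crosses A G' p t l.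
Proof.
move=> [_ _ hE] cp t01 nD [k [E sides]].
have oD : nbhs (p t) (~` D) by apply: open_nbhs_nbhs; split=> //; exact: closed_openC.
have [s [s01 sD]] := edge_at_shrink E oD.
have Es := edge_at_scale s01 E.
have s0 : 0 < s by case/andP: s01.
exists (fun y => k (s *: y)); split.
  by apply/hE => // _ [z bz <-]; exact: sD.
have kE := edge_at_emb E; have kEs := edge_at_emb Es.
have nk : nbhs (p t) ((fun y => k (s *: y)) @` box).
  rewrite -(edge_at_center Es); apply: (emb_nbhs kEs); last exact: box0.
  by apply: open_nbhs_nbhs; split; [exact: open_box|exact: box0].
have h1 := within_near cp (subset_itv_oo_cc t01) nk.
have h2 : \forall r \near t, r \in `[0, 1].
  have : nbhs t `]0, 1[%classic.
    by apply: open_nbhs_nbhs; split=> //; exact: itv_open.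
  by apply: filterS => r; exact: subset_itv_oo_cc.
have move_in r (b : bool) : ((fun y => k (s *: y)) @` box) (p r) ->
    (exists z, [/\ box z, (if b then cy z < 0 else 0 < cy z) & k z = p r]) ->
    exists z, [/\ box z, (if b then cy z < 0 else 0 < cy z) & k (s *: z) = p r].
  move=> [u bu eu] [z [bz sz ez]]; exists u; split=> //.
  have e : z = s *: u by apply: (emb_inj kE) => //; [exact: box_scale|rewrite ez eu].
  by move: sz; rewrite e cyZ pmulr_rlt0 // pmulr_rgt0.
apply: filterS3 h1 h2 sides => r h1r h2r [s1 s2].
by split=> [/s1|/s2]; apply: move_in; exact: h1r.
Qed.

(** Since [D] is closed, the small circles defining the word may be taken off [D]. *)
Lemma agree_vertex_word G G' v w : agree_outside G G' -> ~ D v ->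
  vertex_word A G v w -> vertex_word A G' v w.
Proof.
move=> AG nD vw N Nv; have [hv hs _] := AG.
have [|k [[cc vv kv cone] sub [ts [cp sz tin tP cr]]]] := vw (N `&` ~` D).
  by apply: nbhs_setI => //; apply: open_nbhs_nbhs; split=> //; exact: closed_openC.
have out z : box z -> ~ D (k z) by move=> bz; have [] := sub (k z) (ex_intro2 _ _ z bz erefl).
have outc s : ~ D (circle k s) by apply: out; exact: circle_pt_box.
exists k; split.
- split=> //; first by apply/hv.
    by move=> z bz /(hv _ (out z bz)); exact: kv.
  move=> z c bz c01; have h1 := hs _ (out z bz); have h2 := hs _ (out _ (box_scale c01 bz)).
  have h := cone z c bz c01.
  by split=> [/h2/h/h1|/h1/h/h2].
- by move=> p /sub[].
exists ts; split=> //.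
  by move=> s s01; split=> [/(hs _ (outc s))/(tP s s01)|/(tP s s01)/(hs _ (outc s))].
move=> j t0 l0 jw; apply: (agree_crosses AG) => //; last exact: cr.
by apply: tin; rewrite mem_nth // sz.1.
Qed.

End Outside.

Section WordInverse.
Variable L : Type.
Implicit Types w r : word L.

Lemma word_invK w : word_inv (word_inv w) = w.
Proof.
rewrite /word_inv map_rev revK -map_comp -[RHS]map_id.
by apply: eq_map => -[x b] /=; rewrite negbK.
Qed.

Lemma cyclic_perm_inv w r : cyclic_perm w r -> cyclic_perm (word_inv w) (word_inv r).
Proof.
move=> [k ->]; rewrite /word_inv map_rot rev_rot /rotr.
by exists (size (rev [seq (l.1, ~~ l.2) | l <- r]) - k)%N.
Qed.

End WordInverse.

(** Here -1 is c^(N(N+1)), so c^x = - c^y would force x and y to differ by half the order of [c],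
    modulo the order; both being less than half the order, they cannot. *)
Lemma burau_parameters N : (0 < N)%N -> exists c t : algC,
  [/\ c != 0, t != 0, t ^+ N.+1 = 1 & t != 1] /\
  [/\ c ^+ N * c ^+ N * t = 1, c ^+ (N * N.+1) = -1 &
    forall x y, (x < N * N.+1)%N -> (y < N * N.+1)%N -> c ^+ x != - c ^+ y].
Proof.
move=> N0; have M0 : (0 < N * N.+1 * 2)%N by rewrite !muln_gt0 N0.
have [c pc] := C_prim_root_exists M0.
have cM := prim_expr_order pc.
have c0 : c != 0.
  by apply/eqP => c0; move: cM; rewrite c0 expr0n eqn0Ngt M0 => /eqP; rewrite eq_sym oner_eq0.
have half : c ^+ (N * N.+1) = -1.
  have : c ^+ (N * N.+1) ^+ 2 == 1 by rewrite -exprM cM.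
  rewrite sqrf_eq1 => /orP[|/eqP//].
  rewrite -[X in _ == X](expr0 c) (eq_prim_root_expr pc) mod0n modn_small; nia.
exists c, (c ^+ (N * 2))^-1; split; split=> //.
- by rewrite invr_eq0 expf_neq0.
- by rewrite exprVn -exprM mulnAC cM invr1.
- rewrite invr_eq1 -[X in _ != X](expr0 c) (eq_prim_root_expr pc) mod0n modn_small; nia.
- by rewrite -exprD addnn -muln2 divff // expf_neq0.
- move=> x y hx hy; rewrite -[- _]mulN1r -half -exprD (eq_prim_root_expr pc) !modn_small; nia.
Qed.

Section Compactness.
Variable R : realType.

Lemma disc_compact : compact (@disc R).
Proof.
have K := @rV_compact R 2 (fun=> `[-1, 1]%classic) (fun _ => @segment_compact R (-1) 1).
apply: subclosed_compact K _.
  exact: (@closed_comp _ _ (@sqnorm R) [set x | x <= 2^-1 ^+ 2]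
    (fun z _ => @sqnorm_continuous R z) (@closed_le R (2^-1 ^+ 2))).
move=> z /disc_box[hx hy] i; rewrite /= in_itv /= -ler_norml; apply: ltW.
case: i => -[|[|//]] p.
- by move: hx; rewrite /cx (_ : Ordinal p = 0) //; exact: val_inj.
- by move: hy; rewrite /cy (_ : Ordinal p = 1) //; exact: val_inj.
Qed.

Lemma disc_image_closed (B : topologicalType) (k : 'rV[R]_2 -> B) :
  hausdorff_space B -> open_embedding k -> closed (k @` disc).
Proof.
move=> hB kE; apply: compact_closed => //; apply: continuous_compact disc_compact.
by apply: continuous_in_subspaceT => z; rewrite inE => /disc_box; exact: emb_cvg.
Qed.

End Compactness.

Section Transition.
Variables (R : realType) (B : topologicalType) (g : nat) (A : set ('rV[R]_2 -> B)).
Implicit Type G : graph R B (X0 g).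

Definition r4_vertices G : set B :=
  [set v | white_type A G v (r4 g) \/ white_type A G v (word_inv (r4 g))].

Lemma r4_vertices_finite G : finite_graph A G -> finite_set (r4_vertices G).
Proof. by case=> fw _ _ _ _; apply: sub_finite_set fw => v [] []. Qed.

Lemma agree_r4_vertices G G' D v : closed D -> agree_outside A D G G' -> ~ D v ->
  (white G v -> white G' v) -> r4_vertices G v -> r4_vertices G' v.
Proof.
move=> cD AG nD hw; have T r : white_type A G v r -> white_type A G' v r.
  by move=> [/hw wv [w vw cw]]; split=> //; exists w; first exact: (agree_vertex_word cD AG nD vw).
by case=> /T h; [left|right].
Qed.

Section Holonomy.
Variables (Y : Type) (act : Y -> X0 g * bool -> Y) (nu : Y -> Y).
Hypothesis actK : forall y l, act (act y l) (l.1, ~~ l.2) = y.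
Hypotheses (nuA : forall y l, nu (act y l) = act (nu y) l) (nuK : involutive nu).
Hypothesis act_r1 : forall y (i j : X0 g), (i.+1 < j)%N -> foldl act y (r1 i j) = y.
Hypothesis act_r2 : forall y (i j : X0 g), j = i.+1 :> nat -> foldl act y (r2 i j) = y.
Hypothesis act_r3 : forall y, foldl act y (r3 g) = y.
Hypothesis act_r4 : forall y, foldl act y (r4 g) = nu y.

(** The word is chosen according to the type: at a vertex of type r4 or its inverse, the word
    witnessing the type; elsewhere the word of the chart condition, whose relator cannot be r4,
    since the vertex would then have one of these types. *)
Lemma white_vertex_act G v : white G v -> white_ok A (@R0 g) G v ->
  exists w, vertex_word A G v w /\ forall y, foldl act y w = iter `[< r4_vertices G v >] nu y.
Proof.
move=> wv [w [vw [r Rr wr]]].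
have [T|nT] := pselect (r4_vertices G v).
  have [w' [vw' aw']] : exists w', vertex_word A G v w' /\
      forall y, foldl act y (word_inv w') = nu y.
    case: T => -[_ [w' vw' cw']]; exists w'; split=> //.
      exact: (scalar_cyclic_perm actK nuA cw').
    apply: (scalar_cyclic_perm actK nuA cw').
    exact: (scalar_word_inv actK nuK).
  exists w'; split=> // y; rewrite asboolT //= -[w']word_invK.
  exact: (scalar_word_inv actK nuK).
exists w; split=> // y; rewrite asboolF //=; move: y.
suff ar : forall y, foldl act y r = y.
  have ari := scalar_word_inv (nu := id) actK (fun _ => erefl) ar.
  by case: wr => wr; apply: (scalar_cyclic_perm (nu := id) actK (fun _ _ => erefl) wr).
case: Rr => [[i [j [ij ->]]]|[i [j [ij ->]]]|->|er].
- by move=> y; exact: act_r1.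
- by move=> y; exact: act_r2.
- exact: act_r3.
case: nT; case: wr => /cyclic_perm_inv; rewrite er ?word_invK => wr.
- by right; split=> //; exists w.
- by left; split=> //; exists w.
Qed.

(** [disc_holonomy] for the coordinates in the box of the vertices of types r4 and r4^-1; all
    vertices there are white, so each has a word acting by [nu] or trivially. *)
Lemma box_holonomy b0 G t ts w S : hausdorff_space B -> oriented_atlas A ->
  is_chart A (@R0 g) S b0 G -> open_embedding t -> reads_at A G (circle t) ts w ->
  (forall p, (t @` disc) p -> ~ black G p) ->
  forall y, foldl act y w = iter #|` fset_set (r4_vertices G `&` t @` disc)|%fset nu y.
Proof.
move=> hB hA [fG _ wok _] tE rd nb.
have /choice[h hP] : forall p, exists z, (t @` disc) p -> disc z /\ t z = p.
  move=> p; have [[z dz <-]|np] := pselect ((t @` disc) p); first by exists z.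
  by exists 0.
set P := r4_vertices G `&` t @` disc.
have fP : finite_set P by apply: sub_finite_set (r4_vertices_finite fG) => p [].
pose vs := enum_fset (fset_set (h @` P)).
have vsP z : disc z -> (z \in vs) = `[< r4_vertices G (t z) >].
  move=> dz; have Tz : (t @` disc) (t z) by exists z.
  have ez : h (t z) = z.
    have [dh eh] := hP _ Tz; apply: (emb_inj tE) eh; exact: disc_box.
  rewrite /vs in_fset_set; last exact: finite_image.
  apply/idP/asboolP => [|rz]; rewrite inE.
    by move=> [p [rp Tp] <-]; have [_ ->] := hP _ Tp.
  by exists (t z).
have sz : size vs = #|` fset_set P|%fset.
  rewrite /vs fset_set_image //; apply: card_in_imfset => p q.
  rewrite !in_fset_set // !inE => -[_ /hP[_ ep]] [_ /hP[_ eq]] e.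
  by rewrite -ep -eq e.
rewrite -sz; apply: (disc_holonomy hB hA fG actK nuA nuK tE) rd _ _.
- exact: fset_uniq.
- move=> z; rewrite /vs in_fset_set; last exact: finite_image.
  rewrite inE => -[p [rp Tp] <-]; have [dh ->] := hP _ Tp.
  by split=> //; left; case: rp => -[].
- move=> z dz vz; rewrite vsP //.
  have wz : white G (t z) by case: vz => // /nb; case; exists z.
  by apply: white_vertex_act => //; exact: wok.
Qed.

End Holonomy.

End Transition.

Theorem proposition4p4 (R : realType) (g : nat) (hg : (2 <= g)%N)
  (B : topologicalType) (A : set ('rV[R]_2 -> B))
  (hB : closed_oriented_surface A) (b0 : B) (godd : odd g)
  (Gamma Gamma' : graph R B (X0 g))
  (hGamma : is_chart A (@R0 g) (@S0 g) b0 Gamma)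
  (hGamma' : is_chart A (@R0 g) (@S0 g) b0 Gamma')
  (hmove : transition A (@R0 g) (@S0 g) b0 Gamma Gamma') :
  w_number A Gamma = w_number A Gamma'.
Proof.
case: hB => _ _ hausB hA.
have [s [s' [u [v [v' [d [t [h1 h2 [sw sb ss se] h4 h5]]]]]]]] := hmove.
case: h1 => Ss Ss' _; case: h2 => [[bv _]] sd _.
case: h4 => [[bv' _] Dv' nTv' bD wD]; case: h5 => [[_ tE _] TD [ts [_ [rd _]]]].
have [[_ dE _] vv vD _] := sd.
have D0D : d @` odisc `<=` d @` disc.
  by move=> _ [z hz <-]; exists z => //; exact: ltW.
have cD : closed (d @` disc) := disc_image_closed hausB dE.
have AG : agree_outside A (d @` disc) Gamma Gamma'.
  split=> [p np|p np|]; last exact: se.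
  - have := sw p np; have := sb p np; rewrite /vertices /=; tauto.
  - by apply: ss => /D0D.
have AG' := agree_outside_sym AG.
have fG : finite_graph A Gamma by case: hGamma.
have fG' : finite_graph A Gamma' by case: hGamma'.
(* [d] is a star coordinate system at [v], so the black vertex [v] is the only vertex of [Gamma] in
   the disc. *)
have noD p : r4_vertices A Gamma p -> ~ (d @` disc) p.
  move=> rp [z /disc_box bz ez].
  have wp : white Gamma p by case: rp => -[].
  have dz0 : d 0 = v by case: sd => -[].
  have z0 : z = 0 by apply: vD => //; left; rewrite ez.
  have ev : v = p by rewrite -dz0 -z0.
  case: fG => _ _ + _ _ => /seteqP[+ _] => /(_ p); apply; split=> //.
  by rewrite -ev.
(* All white vertices that the move creates lie in the box, and those outside the disc keep their
   types. *)
have eU : r4_vertices A Gamma' = r4_vertices A Gamma `|` (r4_vertices A Gamma' `&` t @` disc).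
  rewrite eqEsubset; split=> p.
    move=> rp; have [Dp|nD] := pselect ((d @` disc) p).
      by right; split=> //; apply: wD => //; case: rp => -[].
    by left; apply: (agree_r4_vertices cD AG' nD) rp => /(sw p nD).
  case=> [rp|[]//]; have nD := noD p rp.
  by apply: (agree_r4_vertices cD AG nD) rp => /(sw p nD).
set S := r4_vertices A Gamma' `&` t @` disc in eU.
have fS : finite_set S by apply: sub_finite_set (r4_vertices_finite fG') => p [].
have fr := r4_vertices_finite fG.
have disj : (fset_set (r4_vertices A Gamma) `&` fset_set S = fset0)%fset.
  rewrite -fset_setI // (_ : _ `&` _ = set0) ?fset_set0 //.
  by rewrite -subset0 => p [/noD np [_ /TD /D0D]].
have card : #|` fset_set (r4_vertices A Gamma')|%fset =
    (#|` fset_set (r4_vertices A Gamma)|%fset + #|` fset_set S|%fset)%N.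
  by rewrite eU fset_setU // cardfsU disj cardfs0 subn0.
suff ev : ~~ odd #|` fset_set S|%fset.
  have -> : w_number A Gamma' = (#|` fset_set (r4_vertices A Gamma')|%fset)%:R by [].
  rewrite card natrD -[X in _ + X%:R]odd_double_half (negbTE ev) add0n -muln2.
  by rewrite natrM pchar_Zp // mulr0 addr0.
(* An odd number in the box would make its boundary word act by [burau_opp], against
   [no_scalar_opp]. *)
apply/negP => oS.
have [|c [tt [[c0 t0 tN t1] [ct cN cs]]]] := @burau_parameters (2 * g + 1); first by rewrite addn1.
apply: (no_scalar_opp (c0 := c0) (t0 := t0) (tN := tN) (t1 := t1) (u := u) cs hg godd Ss Ss') => y.
rewrite (box_holonomy (nu := @burau_opp _ _ _) (burau_actK c0 t0 tN t1)
  (burau_oppA c0 t0 tN t1) (@burau_oppK _ _ _) _ _ _ _ hausB hA hGamma' tE rd).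
- by rewrite (iter_odd (@burau_oppK _ _ _)) oS.
- by move=> z i j; exact: r1_act.
- by move=> z i j; exact: r2_act.
- by move=> z; exact: r3_act.
- by move=> z; exact: r4_act.
(* The only black vertex of [Gamma'] in the disc is [v'], which lies outside the box. *)
- by move=> p Tp /bD; move=> /(_ (D0D _ (TD _ Tp))) e; apply: nTv'; rewrite -e.
Qed.
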